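(* Let $(\Lambda,\Phi,\Gamma)$, with $\Gamma=(f,b,\sigma)$, be a set of coefficients satisfying Assumptions (H1) and (H2) stated in the context. Then the forward-backward stochastic difference equation $$ \begin{cases} x_{k+1}=b(k,\theta_k)+\sigma(k,\theta_k)\,w_k, & k\in\mathbb T,\\ y_k=-f(k+1,\theta_k), & k\in\mathbb T,\\ x_0=\Lambda(y_0),\qquad y_N=\Phi(x_N), \end{cases} \qquad \theta_k=(x_k,y'_{k+1},z'_{k+1}), $$ where $y'_{k+1}=\mathbb E[y_{k+1}\mid\mathcal F_{k-1}]$ and $z'_{k+1}=\mathbb E[y_{k+1}w_k\mid\mathcal F_{k-1}]$, admits a unique solution $(x(\cdot),y(\cdot))\in N^2(\overline{\mathbb T};\mathbb R^{2n})$. Moreover, $$ \mathbb E\Big[\sum_{k=0}^N|x_k|^2+\sum_{k=0}^N|y_k|^2\Big]\le K\,\mathbb E[\mathrm I], $$ where $$ \mathrm I=|\Phi(0)|^2+\sum_{k=0}^{N-1}|b(k,0,0,0)|^2+\sum_{k=0}^{N-1}|\sigma(k,0,0,0)|^2+\sum_{k=0}^{N-1}|f(k+1,0,0,0)|^2+|\Lambda(0)|^2, $$ and $K$ is a positive constant depending only on $\mathbb T$, the Lipschitz constants, $\mu$, $v$ and the bounds of $G$, $A(\cdot)$, $B(\cdot)$, $C(\cdot)$, $M$. Furthermore, let $(\bar\Lambda,\bar\Phi,\bar\Gamma)$, with $\bar\Gamma=(\bar f,\bar b,\bar\sigma)$, be another set of coefficients satisfying Assumptions (H1) and (H2), and let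 $(\bar x(\cdot),\bar y(\cdot))\in N^2(\overline{\mathbb T};\mathbb R^{2n})$ be a solution of the same equation with coefficients $(\bar\Lambda,\bar\Phi,\bar\Gamma)$ in place of $(\Lambda,\Phi,\Gamma)$. Then, with $\bar\theta_k=(\bar x_k,\bar y'_{k+1},\bar z'_{k+1})$, $\bar y'_{k+1}=\mathbb E[\bar y_{k+1}\mid\mathcal F_{k-1}]$, $\bar z'_{k+1}=\mathbb E[\bar y_{k+1}w_k\mid\mathcal F_{k-1}]$, $$ \mathbb E\Big[\sum_{k=0}^N|x_k-\bar x_k|^2+\sum_{k=0}^N|y_k-\bar y_k|^2\Big]\le K\,\mathbb E[\widehat{\mathrm I}], $$ where $$ \begin{aligned} \widehat{\mathrm I}=\;&|\Phi(\bar x_N)-\bar\Phi(\bar x_N)|^2+\sum_{k=0}^{N-1}|b(k,\bar\theta_k)-\bar b(k,\bar\theta_k)|^2+\sum_{k=0}^{N-1}|\sigma(k,\bar\theta_k)-\bar\sigma(k,\bar\theta_k)|^2\\ &+\sum_{k=0}^{N-1}|f(k+1,\bar\theta_k)-\bar f(k+1,\bar\theta_k)|^2+|\Lambda(\bar y_0)-\bar\Lambda(\bar y_0)|^2, \end{aligned} $$ and $K$ is the same constant as in the first estimate.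
   Context: **Probabilistic setting.** $N$ is a fixed positive integer, $\mathbb T=\{0,\dots,N-1\}$, $\overline{\mathbb T}=\{0,\dots,N\}$. On a complete probability space $(\Omega,\mathcal F,\mathbb P)$, $\{w_k\}_{k\in\mathbb T}$ is a real-valued martingale difference sequence with respect to the filtration $\mathcal F_k=\sigma(w_0,\dots,w_k)$, $k=0,\dots,N-1$, with $\mathcal F_{-1}=\{\emptyset,\Omega\}$ trivial: $\mathbb E[w_k\mid\mathcal F_{k-1}]=0$ and $\mathbb E[w_k^2\mid\mathcal F_{k-1}]=1$ for all $k\in\mathbb T$. **Spaces.** $L^2_{\mathcal F_{N-1}}(\Omega;\mathbb H)$ (resp. $L^\infty_{\mathcal F_{N-1}}(\Omega;\mathbb H)$): square-integrable (resp. essentially bounded) $\mathcal F_{N-1}$-measurable $\mathbb H$-valued random variables. For $\mathbb S\in\{\mathbb T,\overline{\mathbb T}\}$, $L^2_{\mathbb F}(\mathbb S;\mathbb H)$ (resp. $L^\infty_{\mathbb F}(\mathbb S;\mathbb H)$): $\mathbb H$-valued processes $(h_k)_{k\in\mathbb S}$ with $h_k$ being $\mathcal F_{k-1}$-measurable and $\mathbb E\sum_{k\in\mathbb S}\|h_k\|^2<\infty$ (resp. essentially bounded). $N^2(\overline{\mathbb T};\mathbb R^{2n})=L^2_{\mathbb F}(\overline{\mathbb T};\mathbb R^n)\times L^2_{\mathbb F}(\overline{\mathbb T};\mathbb R^n)$; $\mathcal N^2(\mathbb T;\mathbb R^{3n})=L^2_{\mathbb F}(\mathbb T;\mathbb R^n)^3$;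 $\mathcal H(\overline{\mathbb T})=\mathbb R^n\times L^2_{\mathcal F_{N-1}}(\Omega;\mathbb R^n)\times\mathcal N^2(\mathbb T;\mathbb R^{3n})$. **Coefficients.** $\Lambda:\mathbb R^n\to\mathbb R^n$ is deterministic, $\Phi:\Omega\times\mathbb R^n\to\mathbb R^n$, and for $k\in\mathbb T$, $\theta=(x,y,z)\in\mathbb R^{3n}$, the (random) maps $b(k,\theta),\sigma(k,\theta),f(k+1,\theta)$ take values in $\mathbb R^n$. Write $\Gamma(k,\theta)=(f(k+1,\theta),b(k,\theta),\sigma(k,\theta))$, and $\langle\Gamma(k,\theta),\theta\rangle=\langle f(k+1,\theta),x\rangle+\langle b(k,\theta),y\rangle+\langle\sigma(k,\theta),z\rangle$; accordingly $\langle\Gamma(k,\theta)-\Gamma(k,\bar\theta),\widehat\theta\rangle$ pairs the $f,b,\sigma$ differences with $\widehat x,\widehat y,\widehat z$ respectively, where $\widehat\theta=\theta-\bar\theta$, $\widehat x=x-\bar x$, etc. **Assumption (H1).** (i) For every $x\in\mathbb R^n$, $\Phi(x)\in L^2_{\mathcal F_{N-1}}(\Omega;\mathbb R^n)$; for every $\theta\in\mathbb R^{3n}$, the process $k\mapsto\Gamma(k,\theta)$ is in $\mathcal N^2(\mathbb T;\mathbb R^{3n})$ (so $f(k+1,\theta),b(k,\theta),\sigma(k,\theta)$ are $\mathcal F_{k-1}$-measurable); and $(\Lambda(0),\Phi(0),\Gamma(\cdot,0,0,0))\in\mathcal H(\overline{\mathbb T})$. (ii) There is $L>0$ such that $|\Lambda(y)-\Lambda(\bar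 y)|\le L|y-\bar y|$, $|\Phi(x)-\Phi(\bar x)|\le L|x-\bar x|$, $|h(k,\theta)-h(k,\bar\theta)|\le L|\theta-\bar\theta|$ for $h=b,\sigma$, and $|f(k+1,\theta)-f(k+1,\bar\theta)|\le L|\theta-\bar\theta|$, for all $k\in\mathbb T$ and all arguments. **Assumption (H2).** There exist constants $\mu\ge0$, $v\ge0$, a matrix $M\in\mathbb R^{\bar m\times n}$, $G\in L^\infty_{\mathcal F_{N-1}}(\Omega;\mathbb R^{\tilde m\times n})$, and $A(\cdot),B(\cdot),C(\cdot)\in L^\infty_{\mathbb F}(\mathbb T;\mathbb R^{m\times n})$ ($m,\bar m,\tilde m\in\mathbb N$ given) such that: (i) either $\mu>0$ and $v=0$ (Case 1), or $\mu=0$ and $v>0$ (Case 2); (ii) (domination) for all $k\in\mathbb T$, almost all $\omega$, and all $x,\bar x,y,\bar y,z,\bar z\in\mathbb R^n$: $|\Lambda(y)-\Lambda(\bar y)|\le\frac1\mu|M\widehat y|$; $|\Phi(x)-\Phi(\bar x)|\le\frac1v|G\widehat x|$; $|f(k+1,x,y,z)-f(k+1,\bar x,y,z)|\le\frac1v|A_k\widehat x|$; $|h(k,x,y,z)-h(k,x,\bar y,\bar z)|\le\frac1\mu|B_k\widehat y+C_k\widehat z|$ for $h=b,\sigma$; here, when $\mu=0$ (resp. $v=0$), $1/\mu$ (resp. $1/v$) means $+\infty$, i.e. the corresponding constraints are void; (iii) (monotonicity) for all $k\in\mathbb T$, almost all $\omega$, and all $\theta=(x,y,z),\bar\theta=(\bar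 x,\bar y,\bar z)\in\mathbb R^{3n}$: $\langle\Lambda(y)-\Lambda(\bar y),\widehat y\rangle\le-\mu|M\widehat y|^2$; $\langle\Phi(x)-\Phi(\bar x),\widehat x\rangle\ge v|G\widehat x|^2$; $\langle\Gamma(k,\theta)-\Gamma(k,\bar\theta),\widehat\theta\rangle\le-v|A_k\widehat x|^2-\mu|B_k\widehat y+C_k\widehat z|^2$. *)

(* Defs.v *)
From HB Require Import structures.
From mathcomp Require Import all_boot all_order all_algebra.
From mathcomp Require Import all_classical all_reals all_analysis.

Set Implicit Arguments.
Unset Strict Implicit.
Unset Printing Implicit Defensive.

Import Order.TTheory GRing.Theory Num.Theory.

Local Open Scope classical_set_scope.
Local Open Scope ring_scope.

(* Euclidean (Frobenius) norm: the library norm on matrices is the max norm. *)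
Definition enorm (R : realType) (p q : nat) (A : 'M[R]_(p, q)) : R :=
  Num.sqrt (\sum_(i < p) \sum_(j < q) A i j ^+ 2).

Definition dot (R : realType) (n : nat) (u v : 'cV[R]_n) : R :=
  \sum_(i < n) u i 0 * v i 0.

(* theta = (x, y, z), written ((x, y), z) *)
Notation vec3 R n := ('cV[R]_n * 'cV[R]_n * 'cV[R]_n)%type.

Definition enorm3 (R : realType) (n : nat) (t : vec3 R n) : R :=
  Num.sqrt (enorm t.1.1 ^+ 2 + enorm t.1.2 ^+ 2 + enorm t.2 ^+ 2).

(* The sigma-algebra F_(k-1) = sigma(w_0, ..., w_(k-1)) is <<s filt w k >>;
   in particular F_(-1) = <<s set0 >> is trivial. The filtration is not
   augmented by null sets. *)
Definition filt (R : realType) (d : measure_display) (Omega : measurableType d)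
    (w : nat -> Omega -> R) (k : nat) : set (set Omega) :=
  \bigcup_(i in `I_k) preimage_set_system setT (w i) measurable.

Definition rv_measurable (R : realType) (d : measure_display)
    (Omega : measurableType d) (G : set (set Omega)) (X : Omega -> R) : Prop :=
  measurable_fun [set: g_sigma_algebraType G]
    (X : g_sigma_algebraType G -> R).

Definition mx_measurable (R : realType) (d : measure_display)
    (Omega : measurableType d) (G : set (set Omega)) (p q : nat)
    (X : Omega -> 'M[R]_(p, q)) : Prop :=
  forall i j, rv_measurable G (fun omega => X omega i j).

(* Y is a version of E[X | sigma(G)] *)
Definition is_condE (R : realType) (d : measure_display)
    (Omega : measurableType d) (P : probability Omega R)
    (G : set (set Omega)) (X Y : Omega -> R) : Prop :=
  [/\ P.-integrable setT (EFin \o X),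
      P.-integrable setT (EFin \o Y),
      rv_measurable G Y
    & forall A, <<s G >> A ->
        (\int[P]_(omega in A) (Y omega)%:E =
         \int[P]_(omega in A) (X omega)%:E)%E].

(* A chosen version of E[X | sigma(G)]; the default value 0 is only taken when
   there is no version, i.e. when X is not integrable. *)
Definition condE (R : realType) (d : measure_display)
    (Omega : measurableType d) (P : probability Omega R)
    (G : set (set Omega)) (X : Omega -> R) : Omega -> R :=
  xget (fun=> 0) [set Y | is_condE P G X Y].

Definition mx_condE (R : realType) (d : measure_display)
    (Omega : measurableType d) (P : probability Omega R)
    (G : set (set Omega)) (p q : nat) (X : Omega -> 'M[R]_(p, q)) :
    Omega -> 'M[R]_(p, q) :=
  fun omega => \matrix_(i, j) condE P G (fun omega' => X omega' i j) omega.

Definition martingale_difference (R : realType) (d : measure_display)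
    (Omega : measurableType d) (P : probability Omega R) (N : nat)
    (w : nat -> Omega -> R) : Prop :=
  forall k, (k < N)%N ->
    is_condE P (filt w k) (w k) (fun=> 0) /\
    is_condE P (filt w k) (fun omega => w k omega ^+ 2) (fun=> 1).

(* Square-integrable, resp. bounded by c almost surely, and sigma(G)-measurable *)
Definition L2 (R : realType) (d : measure_display)
    (Omega : measurableType d) (P : probability Omega R)
    (G : set (set Omega)) (p q : nat) (X : Omega -> 'M[R]_(p, q)) : Prop :=
  mx_measurable G X /\ ('E_P[fun omega => (enorm (X omega) ^+ 2)%R] < +oo)%E.

Definition Linf (R : realType) (d : measure_display)
    (Omega : measurableType d) (P : probability Omega R)
    (G : set (set Omega)) (p q : nat) (c : R) (X : Omega -> 'M[R]_(p, q)) :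
    Prop :=
  mx_measurable G X /\ {ae P, forall omega, enorm (X omega) <= c}.

(* Processes (h_k)_(k < S) with h_k being F_(k-1)-measurable; processes are
   indexed by nat and only their values at k < S matter. *)
Definition L2proc (R : realType) (d : measure_display)
    (Omega : measurableType d) (P : probability Omega R)
    (w : nat -> Omega -> R) (S p q : nat)
    (h : nat -> Omega -> 'M[R]_(p, q)) : Prop :=
  (forall k, (k < S)%N -> mx_measurable (filt w k) (h k)) /\
  ('E_P[fun omega => (\sum_(k < S) enorm (h k omega) ^+ 2)%R] < +oo)%E.

Definition Linfproc (R : realType) (d : measure_display)
    (Omega : measurableType d) (P : probability Omega R)
    (w : nat -> Omega -> R) (S p q : nat) (c : R)
    (h : nat -> Omega -> 'M[R]_(p, q)) : Prop :=
  forall k, (k < S)%N -> Linf P (filt w k) c (h k).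

(* Only the values of cb k and cs k for k < N, and of cf k.+1 for k < N, are
   used. *)
Record coeffs (R : realType) (d : measure_display)
    (Omega : measurableType d) (n : nat) := Coeffs {
  cLambda : 'cV[R]_n -> 'cV[R]_n;
  cPhi : Omega -> 'cV[R]_n -> 'cV[R]_n;
  cf : nat -> Omega -> vec3 R n -> 'cV[R]_n;
  cb : nat -> Omega -> vec3 R n -> 'cV[R]_n;
  cs : nat -> Omega -> vec3 R n -> 'cV[R]_n
}.

(* The process Gamma(., theta) belongs to N^2(T; R^{3n}) *)
Definition Gamma_L2 (R : realType) (d : measure_display)
    (Omega : measurableType d) (P : probability Omega R) (N : nat)
    (w : nat -> Omega -> R) (n : nat) (c : coeffs R Omega n)
    (t : vec3 R n) : Prop :=
  [/\ L2proc P w N (fun k omega => cf c k.+1 omega t),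
      L2proc P w N (fun k omega => cb c k omega t)
    & L2proc P w N (fun k omega => cs c k omega t)].

(* (H1) with Lipschitz constant L. The last conjunct of the first part is the
   requirement (Lambda(0), Phi(0), Gamma(., 0)) \in H, an instance of the
   preceding two since Lambda is deterministic. The Lipschitz conditions on
   random maps hold outside a null set which does not depend on the arguments. *)
Definition H1 (R : realType) (d : measure_display)
    (Omega : measurableType d) (P : probability Omega R) (N : nat)
    (w : nat -> Omega -> R) (n : nat) (L : R) (c : coeffs R Omega n) : Prop :=
  [/\ forall x, L2 P (filt w N) (fun omega => cPhi c omega x),
      forall t, Gamma_L2 P N w c t
    & L2 P (filt w N) (fun omega => cPhi c omega 0) /\ Gamma_L2 P N w c 0] /\
  [/\ 0 < L,
      forall y y', enorm (cLambda c y - cLambda c y') <= L * enorm (y - y'),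
      {ae P, forall omega, forall x x',
        enorm (cPhi c omega x - cPhi c omega x') <= L * enorm (x - x')}
    & forall k, (k < N)%N -> {ae P, forall omega, forall t t',
        [/\ enorm (cb c k omega t - cb c k omega t') <= L * enorm3 (t - t'),
            enorm (cs c k omega t - cs c k omega t') <= L * enorm3 (t - t')
          & enorm (cf c k.+1 omega t - cf c k.+1 omega t')
              <= L * enorm3 (t - t')]}].

(* <Gamma(k, t) - Gamma(k, t'), t - t'> *)
Definition Gamma_pairing (R : realType) (d : measure_display)
    (Omega : measurableType d) (n : nat) (c : coeffs R Omega n) (k : nat)
    (omega : Omega) (t t' : vec3 R n) : R :=
  dot (cf c k.+1 omega t - cf c k.+1 omega t') (t - t').1.1 +
  dot (cb c k omega t - cb c k omega t') (t - t').1.2 +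
  dot (cs c k omega t - cs c k omega t') (t - t').2.

(* (H2) for given mu, v, M, G, A, B, C, with cM, cG, cA, cB, cC bounding the
   matrices. The guards 0 < mu and 0 < v make the domination conditions void
   when the factor 1/mu or 1/v is infinite. *)
Definition H2 (R : realType) (d : measure_display)
    (Omega : measurableType d) (P : probability Omega R) (N : nat)
    (w : nat -> Omega -> R) (n m mbar mtil : nat)
    (mu v cM cG cA cB cC : R)
    (M : 'M[R]_(mbar, n)) (G : Omega -> 'M[R]_(mtil, n))
    (A B C : nat -> Omega -> 'M[R]_(m, n)) (c : coeffs R Omega n) : Prop :=
  [/\ [/\ enorm M <= cM, Linf P (filt w N) cG G, Linfproc P w N cA A,
          Linfproc P w N cB B & Linfproc P w N cC C],
      (0 < mu /\ v = 0) \/ (mu = 0 /\ 0 < v),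
      [/\ 0 < mu -> forall y y',
            enorm (cLambda c y - cLambda c y') <= mu^-1 * enorm (M *m (y - y')),
          0 < v -> {ae P, forall omega, forall x x',
            enorm (cPhi c omega x - cPhi c omega x')
              <= v^-1 * enorm (G omega *m (x - x'))},
          0 < v -> forall k, (k < N)%N -> {ae P, forall omega, forall x x' y z,
            enorm (cf c k.+1 omega (x, y, z) - cf c k.+1 omega (x', y, z))
              <= v^-1 * enorm (A k omega *m (x - x'))}
        & 0 < mu -> forall k, (k < N)%N ->
            {ae P, forall omega, forall x y y' z z',
              enorm (cb c k omega (x, y, z) - cb c k omega (x, y', z'))
                <= mu^-1 * enorm (B k omega *m (y - y') + C k omega *m (z - z'))
              /\
              enorm (cs c k omega (x, y, z) - cs c k omega (x, y', z'))
                <= mu^-1 *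
                   enorm (B k omega *m (y - y') + C k omega *m (z - z'))}]
    & [/\ forall y y', dot (cLambda c y - cLambda c y') (y - y')
            <= - mu * enorm (M *m (y - y')) ^+ 2,
          {ae P, forall omega, forall x x',
            v * enorm (G omega *m (x - x')) ^+ 2
              <= dot (cPhi c omega x - cPhi c omega x') (x - x')}
        & forall k, (k < N)%N -> {ae P, forall omega, forall t t',
            Gamma_pairing c k omega t t'
              <= - v * enorm (A k omega *m (t - t').1.1) ^+ 2
                 - mu * enorm (B k omega *m (t - t').1.2
                               + C k omega *m (t - t').2) ^+ 2}]].

Definition satisfies_H1_H2 (R : realType) (d : measure_display)
    (Omega : measurableType d) (P : probability Omega R) (N : nat)
    (w : nat -> Omega -> R) (n : nat) (c : coeffs R Omega n) : Prop :=
  (exists L : R, H1 P N w L c) /\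
  (exists (m mbar mtil : nat) (mu v cM cG cA cB cC : R)
     (M : 'M[R]_(mbar, n)) (G : Omega -> 'M[R]_(mtil, n))
     (A B C : nat -> Omega -> 'M[R]_(m, n)),
     H2 P N w mu v cM cG cA cB cC M G A B C c).

(* theta_k = (x_k, E[y_(k+1) | F_(k-1)], E[y_(k+1) w_k | F_(k-1)]) *)
Definition theta (R : realType) (d : measure_display)
    (Omega : measurableType d) (P : probability Omega R)
    (w : nat -> Omega -> R) (n : nat) (x y : nat -> Omega -> 'cV[R]_n)
    (k : nat) (omega : Omega) : vec3 R n :=
  (x k omega,
   mx_condE P (filt w k) (y k.+1) omega,
   mx_condE P (filt w k) (fun omega' => w k omega' *: y k.+1 omega') omega).

Definition is_solution (R : realType) (d : measure_display)
    (Omega : measurableType d) (P : probability Omega R) (N : nat)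
    (w : nat -> Omega -> R) (n : nat) (c : coeffs R Omega n)
    (x y : nat -> Omega -> 'cV[R]_n) : Prop :=
  (L2proc P w N.+1 x /\ L2proc P w N.+1 y) /\
  [/\ forall k, (k < N)%N -> {ae P, forall omega,
        x k.+1 omega = cb c k omega (theta P w x y k omega)
                       + w k omega *: cs c k omega (theta P w x y k omega)},
      forall k, (k < N)%N -> {ae P, forall omega,
        y k omega = - cf c k.+1 omega (theta P w x y k omega)},
      {ae P, forall omega, x 0%N omega = cLambda c (y 0%N omega)}
    & {ae P, forall omega, y N omega = cPhi c omega (x N omega)}].

Definition data_I (R : realType) (d : measure_display)
    (Omega : measurableType d) (N n : nat) (c : coeffs R Omega n)
    (omega : Omega) : R :=
  enorm (cPhi c omega 0) ^+ 2
  + \sum_(k < N) enorm (cb c k omega 0) ^+ 2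
  + \sum_(k < N) enorm (cs c k omega 0) ^+ 2
  + \sum_(k < N) enorm (cf c k.+1 omega 0) ^+ 2
  + enorm (cLambda c 0) ^+ 2.

Definition data_Ihat (R : realType) (d : measure_display)
    (Omega : measurableType d) (P : probability Omega R) (N : nat)
    (w : nat -> Omega -> R) (n : nat) (c c' : coeffs R Omega n)
    (x' y' : nat -> Omega -> 'cV[R]_n) (omega : Omega) : R :=
  let t k := theta P w x' y' k omega in
  enorm (cPhi c omega (x' N omega) - cPhi c' omega (x' N omega)) ^+ 2
  + \sum_(k < N) enorm (cb c k omega (t k) - cb c' k omega (t k)) ^+ 2
  + \sum_(k < N) enorm (cs c k omega (t k) - cs c' k omega (t k)) ^+ 2
  + \sum_(k < N) enorm (cf c k.+1 omega (t k) - cf c' k.+1 omega (t k)) ^+ 2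
  + enorm (cLambda c (y' 0%N omega) - cLambda c' (y' 0%N omega)) ^+ 2.

(* Main.v *)
Require Import Defs.
From HB Require Import structures.
From mathcomp Require Import all_boot all_order all_algebra.
From mathcomp Require Import all_classical all_reals all_analysis.
From mathcomp Require Import finmap measurable_realfun ring lra.
Import Order.TTheory GRing.Theory Num.Theory.
Import numFieldNormedType.Exports.
Local Open Scope classical_set_scope.
Local Open Scope ring_scope.

Set Implicit Arguments.
Unset Strict Implicit.
Unset Printing Implicit Defensive.

(** A solution is a fixed point of the map S that sends a pair u = (x, y) of
    adapted square-integrable processes to the right-hand sides of the
    equation. For tau in [0, 1] consider the equation u - tau S u = g. At
    tau = 0 it is trivially solvable; at tau = 1 and g = 0 it is the equation
    to be solved. Everything rests on the a priori estimate (lemma stability)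
      |u - v|^2 <= K |(u - tau S u) - (v - tau S v)|^2,  0 <= tau <= 1,
    in the mean square norm, with K independent of tau. It allows tau to be
    increased by a fixed step, by a contraction argument, until it reaches 1
    (lemma continuation_fixpoint); at tau = 1 it gives uniqueness, and also
    both estimates: if v solves the equation with other coefficients, then
    v - S v is the difference of the two right-hand sides at v, whose mean
    square is at most twice the data term. The first estimate is the case of
    zero coefficients and v = 0.

    The a priori estimate comes from three facts. First, the matrices can be
    eliminated from the domination and monotonicity conditions: if mu > 0 the
    increments of Lambda, b and sigma, if v > 0 those of Phi and f, are
    controlled by the increments of the variables in which they are only
    Lipschitz and by the monotonicity gap, that is, up to sign, the pairing of
    the increments (lemma gap_of_H1_H2). In this form the conditions pass from
    the coefficients to tau times them. Second, duality: conditioning y_(k+1),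
    respectively y_(k+1) w_k, on the past is adjoint to multiplying by 1,
    respectively by w_k, so the inner product of the increments of x and y at
    time k can be computed from either equation, and the sum over k shows that
    the mean gaps add up to inner products with the residual
    (u - tau S u) - (v - tau S v) (lemma energy_identity). Third, once the gaps
    are known to be small, a recursion in one direction of time bounds one
    component, and a recursion in the other direction bounds the other
    (lemmas forward_backward_le and backward_forward_le). The sum of the gaps
    is absorbed by Young's inequality (lemma absorb_le).

    The noise enters through its conditional second moment: as it equals 1,
    multiplication by w_k and its adjoint are contractions
    (lemmas weight_L2 and weight_condE_L2). Random coefficients evaluated at
    random points are only almost surely equal to measurable functions, so
    adaptedness is understood up to null sets (definition aemeas), and strictly
    adapted versions are chosen at the end (lemma adapted_version). *)

(** * Means of real random variables *)

Section Expectation.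
Context {R : realType} {d : measure_display} {Omega : measurableType d}.
Variable P : probability Omega R.
Implicit Types f g : Omega -> R.

Definition L1 f := P.-integrable setT (EFin \o f).
Definition Ex f : R := (\int[P]_omega f omega)%R.

Lemma L1_meas f : L1 f -> measurable_fun setT f.
Proof. by move=> /measurable_int /measurable_EFinP. Qed.

Lemma L1_cst (c : R) : L1 (fun=> c).
Proof. exact: finite_measure_integrable_cst. Qed.

Lemma L1D f g : L1 f -> L1 g -> L1 (fun w => f w + g w).
Proof. by move=> lf lg; have := integrableD measurableT lf lg. Qed.

Lemma L1Z c f : L1 f -> L1 (fun w => c * f w).
Proof. by move=> lf; have := integrableZl measurableT c lf. Qed.

Lemma L1N f : L1 f -> L1 (fun w => - f w).
Proof. by move=> lf; have := integrableN lf. Qed.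

Lemma L1B f g : L1 f -> L1 g -> L1 (fun w => f w - g w).
Proof. by move=> lf lg; apply: L1D => //; exact: L1N. Qed.

Lemma L1_sum (I : Type) (s : seq I) (F : I -> Omega -> R) :
  (forall i, L1 (F i)) -> L1 (fun w => \sum_(i <- s) F i w).
Proof.
move=> lF; elim: s => [|i s IH].
  by under eq_fun do rewrite big_nil; exact: L1_cst.
by under eq_fun do rewrite big_cons; exact: L1D.
Qed.

Lemma le_L1 f g : measurable_fun setT f -> (forall w, `|f w| <= g w) ->
  L1 g -> L1 f.
Proof.
move=> mf fg; apply: le_integrable => //; first exact/measurable_EFinP.
by move=> w _ /=; rewrite lee_fin (le_trans (fg w))// ler_norm.
Qed.

Lemma ExE f : L1 f -> (Ex f)%:E = (\int[P]_w (f w)%:E)%E.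
Proof. by move=> lf; rewrite /Ex /Rintegral fineK//; apply: integrable_fin_num. Qed.

Lemma Ex_cst c : Ex (fun=> c) = c.
Proof. by rewrite /Ex Rintegral_cst//= probability_setT mulr1. Qed.

Lemma ExD f g : L1 f -> L1 g -> Ex (fun w => f w + g w) = Ex f + Ex g.
Proof. by move=> lf lg; rewrite /Ex RintegralD. Qed.

Lemma ExB f g : L1 f -> L1 g -> Ex (fun w => f w - g w) = Ex f - Ex g.
Proof. by move=> lf lg; rewrite /Ex RintegralB. Qed.

Lemma ExZ c f : L1 f -> Ex (fun w => c * f w) = c * Ex f.
Proof. by move=> lf; rewrite /Ex RintegralZl. Qed.

Lemma Ex_sum (I : Type) (s : seq I) (F : I -> Omega -> R) :
  (forall i, L1 (F i)) ->
  Ex (fun w => \sum_(i <- s) F i w) = \sum_(i <- s) Ex (F i).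
Proof.
move=> lF; elim: s => [|i s IH].
  by under [in LHS]eq_fun do rewrite big_nil; rewrite big_nil Ex_cst.
under [in LHS]eq_fun do rewrite big_cons.
by rewrite ExD ?big_cons ?IH//; exact: L1_sum.
Qed.

Lemma eq_Ex_ae f g : L1 f -> L1 g -> {ae P, forall w, f w = g w} -> Ex f = Ex g.
Proof.
move=> lf lg fg; congr fine; apply: ae_eq_integral => //.
- exact: measurable_int lf.
- exact: measurable_int lg.
- by apply: filterS fg => w -> _.
Qed.

Lemma Ex_ge0 f : (forall w, 0 <= f w) -> 0 <= Ex f.
Proof. by move=> f0; exact: Rintegral_ge0. Qed.

Lemma le_Ex f g : L1 f -> L1 g -> {ae P, forall w, f w <= g w} -> Ex f <= Ex g.
Proof.
move=> lf lg fg; rewrite -subr_ge0 -ExB//.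
pose h w := Order.max 0 (g w - f w).
have mh : measurable_fun setT h.
  apply: measurable_maxr => //; apply: measurable_funB; exact: L1_meas.
have lh : L1 h.
  apply: (@le_L1 _ (fun w => `|g w - f w|)) => //.
    move=> w; rewrite ger0_norm ?le_max ?lexx// ge_max normr_ge0 ler_norm//.
  by have := integrable_norm (L1B lg lf).
rewrite (@eq_Ex_ae _ h)//; [|exact: L1B|].
  by apply: Ex_ge0 => w; rewrite le_max lexx.
by apply: filterS fg => w fg; rewrite /h max_r// subr_ge0.
Qed.

Lemma Ex_eq0_ae f : L1 f -> (forall w, 0 <= f w) -> Ex f <= 0 ->
  {ae P, forall w, f w = 0}.
Proof.
move=> lf f0 Ef0.
have : (\int[P]_(w in setT) `|(f w)%:E| = 0)%E.
  under eq_integral do rewrite gee0_abs ?lee_fin//.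
  rewrite -ExE//; congr EFin; apply/eqP; rewrite eq_le Ef0/=; exact: Ex_ge0.
move/(ae_eq_integral_abs P measurableT (measurable_int _ lf)).
by apply: filterS => w /(_ I) [].
Qed.

Lemma L1_ae f g : measurable_fun setT g -> {ae P, forall w, f w = g w} ->
  L1 f -> L1 g.
Proof.
move=> mg fg lf; apply/integrableP; split; first exact/measurable_EFinP.
have /integrableP[mf] := lf; apply: le_lt_trans.
rewrite le_eqVlt; apply/orP; left; apply/eqP; apply: ae_eq_integral => //.
- by apply: measurableT_comp => //; exact/measurable_EFinP.
- exact: measurableT_comp.
- by apply: filterS fg => w fg _ /=; rewrite fg.
Qed.

(** Fatou's lemma in the form of a bound on the mean of an almost sure limit. *)
Lemma fatou_bound (F : nat -> Omega -> R) f (C : R) :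
  (forall n, L1 (F n)) -> (forall n w, 0 <= F n w) ->
  measurable_fun setT f -> (forall w, 0 <= f w) ->
  {ae P, forall w, F ^~ w @ \oo --> f w} ->
  (forall n, Ex (F n) <= C) -> L1 f /\ Ex f <= C.
Proof.
move=> lF F0 mf f0 Ff EF.
have mFn n : measurable_fun setT (EFin \o F n) := measurable_int _ (lF n).
have ffat : (\int[P]_w (f w)%:E <= C%:E)%E.
  have -> : (\int[P]_w (f w)%:E = \int[P]_w limn_einf (fun n => (F n w)%:E))%E.
    apply: ae_eq_integral => //; first exact/measurable_EFinP.
      have -> : (fun w => limn_einf (fun n => (F n w)%:E)) =
          (fun w => - limn_esup (fun n => (- F n w)%:E))%E.
        by apply/funext => w; rewrite /limn_einf.
      apply: measurableT_comp => //; apply: measurable_fun_limn_esup => n.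
      by apply: measurableT_comp => //; apply: measurableT_comp => //; exact: L1_meas.
    apply: filterS Ff => w Fw _.
    have /cvg_limn_einf_sup[-> _]// : (fun n => (F n w)%:E) @ \oo --> (f w)%:E.
    by apply: cvg_EFin => //; near=> n.
  apply: (le_trans (@fatou _ _ _ P _ measurableT (fun n w => (F n w)%:E) _ _)) => //.
    by move=> n w _; rewrite lee_fin.
  rewrite limn_einf_lim; apply: lime_le; first exact: is_cvg_einfs.
  apply: nearW => n; apply: (@le_trans _ _ (\int[P]_w (F n w)%:E)%E).
    by apply: ereal_inf_lbound; exists n => /=.
  by rewrite -ExE// lee_fin.
have lf : L1 f.
  apply/integrableP; split; first exact/measurable_EFinP.
  rewrite (eq_integral (EFin \o f)) => [|w _]; last by rewrite /= ger0_norm.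
  exact: le_lt_trans ffat (ltry _).
by split => //; rewrite -lee_fin ExE.
Unshelve. all: by end_near. Qed.

End Expectation.

(** * Conditional expectation *)

Section ConditionalExpectation.
Context {R : realType} {d : measure_display} {Omega : measurableType d}.
Variable P : probability Omega R.
Variable G : set (set Omega).
Hypothesis subG : <<s G >> `<=` measurable.
Implicit Types X Y phi : Omega -> R.

Let idG : Omega -> g_sigma_algebraType G := id.

Lemma measurable_idG : measurable_fun setT idG.
Proof. by move=> _ A mA; rewrite setTI; exact: subG. Qed.

Lemma rv_measurable_fun X : rv_measurable G X -> measurable_fun setT X.
Proof.
move=> mX _ A mA; rewrite setTI; apply: subG.
by have := mX measurableT A mA; rewrite setTI.
Qed.

(** The conditional expectation is the Radon-Nikodym derivative of the charge
    with density X with respect to P, both pushed forward by the identity to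
    the measurable space carried by G. *)
Lemma condE_exists X : L1 P X -> exists Y, is_condE P G X Y.
Proof.
move=> lX.
have numu : pushforward (induced_charge lX) idG `<< pushforward P idG.
  apply: dominates_pushforward => //; first exact: measurable_idG.
  apply/null_content_dominatesP => A mA PA0.
  apply: null_set_integral => //.
  exact: measurable_funTS (measurable_int _ lX).
pose idm : {mfun Omega >-> g_sigma_algebraType G} :=
  HB.pack idG (isMeasurableFun.Build _ _ _ _ _ measurable_idG).
pose mu : probability (g_sigma_algebraType G) R := distribution P idm.
pose nu : {charge set (g_sigma_algebraType G) -> \bar R} :=
  measure_function_pushforward__canonical__charge_Charge
    (charge_induced_charge__canonical__charge_Charge lX) measurable_idG.
have Yint := @Radon_Nikodym_integrable _ _ _ nu mu numu.
have Yfin w := @Radon_Nikodym_fin_num _ _ _ nu mu w numu.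
have YE A := @Radon_Nikodym_integral _ _ _ nu mu A numu.
set Y := Radon_Nikodym nu mu in Yint Yfin YE.
have YfinE : EFin \o (fine \o Y) = Y by apply/funext => w /=; rewrite fineK.
have mY : measurable_fun [set: g_sigma_algebraType G] Y := measurable_int _ Yint.
have lY : L1 P (fine \o Y).
  rewrite /L1 YfinE; apply/integrableP; split.
    exact: (measurableT_comp mY measurable_idG).
  have /integrableP[_] := Yint.
  rewrite ge0_integral_pushforward//.
  exact: measurableT_comp.
exists (fine \o Y); split => //.
- exact: (measurableT_comp _ mY).
- move=> A GA; have mA := subG GA.
  transitivity (\int[P]_(w in A) Y w)%E.
    by apply: eq_integral => w _; rewrite /= fineK.
  transitivity (nu A); last by [].
  rewrite YE// integral_pushforward//.
  have := integrableS measurableT mA (@subsetT _ A) lY.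
  by rewrite YfinE.
Qed.

Lemma condE_spec X : L1 P X -> is_condE P G X (condE P G X).
Proof. by move=> /condE_exists [Y hY]; apply: (@xgetPex _ (fun=> 0) [set Y | is_condE P G X Y]); exists Y. Qed.

Lemma is_condEB X X' Y Y' : is_condE P G X Y -> is_condE P G X' Y' ->
  is_condE P G (fun w => X w - X' w) (fun w => Y w - Y' w).
Proof.
move=> [lX lY mY XY] [lX' lY' mY' XY']; split.
- exact: L1B.
- exact: L1B.
- exact: measurable_funB.
- move=> A GA; have mA := subG GA.
  rewrite [LHS](@integralB_EFin _ _ _ P A)//; [|exact: integrableS lY|exact: integrableS lY'].
  rewrite [RHS](@integralB_EFin _ _ _ P A)//; [|exact: integrableS lX|exact: integrableS lX'].
  by rewrite XY// XY'.
Qed.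

(** The chosen versions agree everywhere and not just almost surely, since both
    are picked from the same set of versions. *)
Lemma condE_eq_ae X X' : L1 P X -> L1 P X' -> {ae P, forall w, X w = X' w} ->
  condE P G X = condE P G X'.
Proof.
move=> lX lX' XX'; rewrite /condE; congr xget; apply/seteqP.
have eqA A : <<s G >> A ->
    (\int[P]_(w in A) (X w)%:E = \int[P]_(w in A) (X' w)%:E)%E.
  move=> /subG mA; apply: ae_eq_integral => //.
  - by apply: measurable_funTS; exact: measurable_int lX.
  - by apply: measurable_funTS; exact: measurable_int lX'.
  - by apply: filterS XX' => w -> _.
split=> Y [_ lY mY XY]; split => // A GA; rewrite XY//.
  exact: eqA.
by rewrite eqA.
Qed.

Lemma Ex_dominated_cvg (F : nat -> Omega -> R) (f g : Omega -> R) :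
  (forall n, measurable_fun setT (F n)) -> measurable_fun setT f -> L1 P g ->
  (forall w, F ^~ w @ \oo --> f w) -> (forall n w, `|F n w| <= g w) ->
  (fun n => Ex P (F n)) @ \oo --> Ex P f.
Proof.
move=> mF mf lg Ff Fg.
have lf : L1 P f.
  apply: (le_L1 _ _ lg) => // w.
  have cvn : (fun n => `|F n w|) @ \oo --> `|f w| by apply: cvg_norm; exact: Ff.
  rewrite -(cvg_lim _ cvn)//; apply: limr_le; first exact: cvgP cvn.
  exact: nearW.
have [] := @dominated_convergence _ _ _ P setT measurableT
  (fun n w => (F n w)%:E) (fun w => (f w)%:E) (fun w => (g w)%:E) _ _ _ lg _.
- by move=> n; exact/measurable_EFinP.
- exact/measurable_EFinP.
- by apply: aeW => w _; apply: cvg_EFin; [exact: nearW|exact: Ff].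
- by apply: aeW => w n _; rewrite lee_fin.
by move=> _ _; rewrite -ExE// => /fine_cvg.
Qed.

Lemma Ex_indic A X : measurable A ->
  Ex P (fun w => \1_A w * X w) = fine (\int[P]_(w in A) (X w)%:E).
Proof.
move=> mA; rewrite /Ex /Rintegral; congr fine.
rewrite [RHS]integral_mkcond epatch_indic; apply: eq_integral => w _ /=.
by rewrite mulrC.
Qed.

Section pullout.
Variables X Y : Omega -> R.
Hypothesis XY : is_condE P G X Y.
Import HBNNSimple.

Let lX : L1 P X. Proof. by case: XY. Qed.
Let lY : L1 P Y. Proof. by case: XY. Qed.

Lemma L1_simple (h : {nnsfun (g_sigma_algebraType G) >-> R}) Z :
  L1 P Z -> L1 P (fun w => h w * Z w).
Proof.
move=> lZ; have [M [_ hM]] := simple_bounded h.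
have {}hM w : `|h w| <= M + 1 by apply: hM => //; rewrite ltrDl.
apply: (@le_L1 _ _ _ P _ (fun w => (M + 1) * `|Z w|)).
- apply: measurable_funM; last exact: L1_meas lZ.
  by apply: rv_measurable_fun; exact: measurable_funPT.
- by move=> w; rewrite normrM ler_wpM2r.
- by apply: L1Z; exact: integrable_norm lZ.
Qed.

Lemma pullout_simple (h : {nnsfun (g_sigma_algebraType G) >-> R}) :
  Ex P (fun w => h w * X w) = Ex P (fun w => h w * Y w).
Proof.
have lI A Z : <<s G >> A -> L1 P Z -> L1 P (fun w => \1_A w * Z w).
  move=> GA lZ; apply: (@le_L1 _ _ _ P _ (fun w => `|Z w|)).
  - apply: measurable_funM; last exact: L1_meas lZ.
    exact/measurable_indicP/subG.
  - move=> w; rewrite normrM indicE.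
    by case: (w \in A); rewrite ?normr1 ?mul1r// normr0 mul0r.
  - exact: integrable_norm lZ.
have mh y : <<s G >> (h @^-1` [set y]).
  by have := measurable_funPT h measurableT _ (measurable_set1 y); rewrite setTI.
have hE Z : L1 P Z -> Ex P (fun w => h w * Z w) =
   \sum_(y <- fset_set (range h)) y * fine (\int[P]_(w in h @^-1` [set y]) (Z w)%:E).
  move=> lZ; transitivity (Ex P (fun w => \sum_(y <- fset_set (range h))
      y * (\1_(h @^-1` [set y]) w * Z w))).
    congr Ex; apply/funext => w; rewrite fimfunE fsbig_finite//= mulr_suml.
    by apply: eq_bigr => y _; rewrite mulrA.
  rewrite Ex_sum; last by move=> y; exact/L1Z/lI.
  apply: eq_bigr => y _; rewrite ExZ; last exact: lI.
  by rewrite Ex_indic//; exact: subG.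
rewrite !hE//; apply: eq_bigr => y _; congr (_ * fine _).
by case: XY => _ _ _ ->.
Qed.

Let approx phi (mphi : rv_measurable G phi) :=
  nnsfun_approx measurableT
    ((@measurable_EFinP _ (g_sigma_algebraType G) R setT phi).2 mphi).

Let cvg_approx phi (mphi : rv_measurable G phi) w : (forall w, 0 <= phi w) ->
  (fun n => approx mphi n w) @ \oo --> phi w.
Proof.
move=> phi0; have := @cvg_nnsfun_approx _ (g_sigma_algebraType G) _ setT measurableT _
  ((@measurable_EFinP _ (g_sigma_algebraType G) R setT phi).2 mphi) _ w I.
by move=> /(_ _)/fine_cvg; apply=> t _; rewrite lee_fin.
Qed.

Let le_approx phi (mphi : rv_measurable G phi) n w : (forall w, 0 <= phi w) ->
  approx mphi n w <= phi w.
Proof.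
move=> phi0; rewrite /approx nnsfun_approxE -lee_fin.
by apply: le_approx => // t _; rewrite lee_fin.
Qed.

(** For nonnegative functions the integrability of phi X is a conclusion: phi
    is an increasing limit of simple functions, for which the two means
    agree, and Fatou's lemma passes to the limit. *)
Lemma pullout_le phi : rv_measurable G phi -> (forall w, 0 <= phi w) ->
  (forall w, 0 <= X w) -> (forall w, 0 <= Y w) -> L1 P (fun w => phi w * Y w) ->
  L1 P (fun w => phi w * X w) /\
  Ex P (fun w => phi w * X w) <= Ex P (fun w => phi w * Y w).
Proof.
move=> mphi phi0 X0 Y0 lphi.
apply: (@fatou_bound _ _ _ P (fun n w => approx mphi n w * X w)).
- by move=> n; exact: L1_simple.
- by move=> n w; rewrite mulr_ge0.
- by apply: measurable_funM; [exact: rv_measurable_fun|exact: L1_meas lX].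
- by move=> w; rewrite mulr_ge0.
- apply: aeW => w; apply: cvgM; last exact: cvg_cst.
  exact: cvg_approx.
- move=> n; rewrite pullout_simple; apply: le_Ex => //; first exact: L1_simple.
  by apply: aeW => w; rewrite ler_wpM2r//; exact: le_approx.
Qed.

Let pullout_ge0 phi : rv_measurable G phi -> (forall w, 0 <= phi w) ->
  L1 P (fun w => phi w * X w) -> L1 P (fun w => phi w * Y w) ->
  Ex P (fun w => phi w * X w) = Ex P (fun w => phi w * Y w).
Proof.
move=> mphi phi0 lphiX lphiY.
have cv Z : L1 P Z -> L1 P (fun w => phi w * Z w) ->
    (fun n => Ex P (fun w => approx mphi n w * Z w)) @ \oo -->
    Ex P (fun w => phi w * Z w).
  move=> lZ lphiZ.
  apply: (@Ex_dominated_cvg _ _ (fun w => `|phi w * Z w|)).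
  - by move=> n; exact: L1_meas (L1_simple _ lZ).
  - exact: L1_meas lphiZ.
  - exact: integrable_norm lphiZ.
  - by move=> w; apply: cvgM; [exact: cvg_approx|exact: cvg_cst].
  - move=> n w; rewrite !normrM ler_wpM2r// !ger0_norm//.
    exact: le_approx.
have := cv _ lX lphiX; under eq_fun do rewrite pullout_simple.
by move=> /(cvg_unique _)/(_ (cv _ lY lphiY)) ->.
Qed.

(** Taking out what is known: the two parts of phi are limits of simple
    functions, dominated by phi itself. *)
Lemma pullout phi : rv_measurable G phi ->
  L1 P (fun w => phi w * X w) -> L1 P (fun w => phi w * Y w) ->
  Ex P (fun w => phi w * X w) = Ex P (fun w => phi w * Y w).
Proof.
move=> mphi lphiX lphiY.
pose p w := Order.max (phi w) 0; pose m w := Order.max (- phi w) 0.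
have mp : rv_measurable G p by apply: measurable_maxr => //; exact: measurable_cst.
have mm : rv_measurable G m.
  by apply: measurable_maxr; [exact: measurableT_comp|exact: measurable_cst].
have p0 w : 0 <= p w by rewrite le_max lexx orbT.
have m0 w : 0 <= m w by rewrite le_max lexx orbT.
have pm w : phi w = p w - m w.
  rewrite /p /m; have [h|h] := leP 0 (phi w).
    by rewrite max_r ?oppr_le0// subr0.
  by rewrite max_l ?oppr_ge0 ?ltW// sub0r opprK.
have lq q Z : rv_measurable G q -> (forall w, `|q w| <= `|phi w|) -> L1 P Z ->
    L1 P (fun w => phi w * Z w) -> L1 P (fun w => q w * Z w).
  move=> mq qphi lZ lphiZ.
  apply: (@le_L1 _ _ _ P _ (fun w => `|phi w * Z w|)).
  - by apply: measurable_funM; [exact: rv_measurable_fun|exact: L1_meas lZ].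
  - by move=> w; rewrite !normrM ler_wpM2r.
  - exact: integrable_norm lphiZ.
have pphi w : `|p w| <= `|phi w|.
  by rewrite ger0_norm// ge_max ler_norm normr_ge0.
have mphi' w : `|m w| <= `|phi w|.
  by rewrite ger0_norm// ge_max -normrN ler_norm normr_ge0.
have split Z : (fun w => phi w * Z w) = (fun w => p w * Z w - m w * Z w).
  by apply/funext => w; rewrite pm mulrBl.
rewrite !split ExB ?ExB//; [|exact: lq..].
by congr (_ - _); apply: pullout_ge0 => //; exact: lq.
Qed.

End pullout.

End ConditionalExpectation.

(** * Square-integrable functions and unit weights *)

Section SquareIntegrable.
Context {R : realType} {d : measure_display} {Omega : measurableType d}.
Variable P : probability Omega R.
Implicit Types f g : Omega -> R.

Definition L2s f := measurable_fun setT f /\ L1 P (fun w => f w ^+ 2).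

Lemma L2s_cst c : L2s (fun=> c).
Proof. by split; [exact: measurable_cst|exact: L1_cst]. Qed.

Lemma L2s_ae f g : measurable_fun setT g -> {ae P, forall w, f w = g w} ->
  L2s f -> L2s g.
Proof.
move=> mg fg [mf lf]; split => //.
apply: L1_ae lf; first exact: measurable_funX.
by apply: filterS fg => w ->.
Qed.

Lemma L2s_mul f g : L2s f -> L2s g -> L1 P (fun w => f w * g w).
Proof.
move=> [mf lf] [mg lg].
apply: (@le_L1 _ _ _ P _ (fun w => f w ^+ 2 + g w ^+ 2)).
- exact: measurable_funM.
- move=> w; rewrite ler_norml; apply/andP; split; nra.
- exact: L1D.
Qed.

Lemma L2s_L1 f : L2s f -> L1 P f.
Proof.
move=> lf; have := L2s_mul lf (L2s_cst 1).
by under eq_fun do rewrite mulr1.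
Qed.

Lemma L2sD f g : L2s f -> L2s g -> L2s (fun w => f w + g w).
Proof.
move=> lf lg; have lfg := L2s_mul lf lg; case: lf lg => [mf lf] [mg lg].
split; first exact: measurable_funD.
have -> : (fun w => (f w + g w) ^+ 2) =
  (fun w => f w ^+ 2 + (2 * (f w * g w) + g w ^+ 2)).
  by apply/funext => w; ring.
by apply: L1D => //; apply: L1D => //; exact: L1Z.
Qed.

Lemma L2sZ c f : L2s f -> L2s (fun w => c * f w).
Proof.
move=> [mf lf]; split; first exact: measurable_funM (measurable_cst _) mf.
by under eq_fun do rewrite exprMn; exact: L1Z.
Qed.

Lemma L2sN f : L2s f -> L2s (fun w => - f w).
Proof. by move=> /(L2sZ (-1)); under eq_fun do rewrite mulN1r. Qed.

Lemma L2sB f g : L2s f -> L2s g -> L2s (fun w => f w - g w).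
Proof. by move=> lf lg; apply: L2sD => //; exact: L2sN. Qed.

(** Almost sure equality with a G-measurable function: the form of
    measurability that survives composition with coefficients whose
    regularity only holds outside a null set. *)
Definition aemeas (G : set (set Omega)) f :=
  exists2 g, rv_measurable G g & {ae P, forall w, f w = g w}.

Definition L2a G f := L2s f /\ aemeas G f.

Lemma aemeas_ae G f g : {ae P, forall w, f w = g w} -> aemeas G f -> aemeas G g.
Proof.
move=> fg [h mh fh]; exists h => //.
by apply: filterS2 fg fh => w -> ->.
Qed.

Lemma aemeas_comp2 G (op : R -> R -> R) f g :
  (forall f g : Omega -> R, rv_measurable G f -> rv_measurable G g ->
    rv_measurable G (fun w => op (f w) (g w))) ->
  aemeas G f -> aemeas G g -> aemeas G (fun w => op (f w) (g w)).
Proof.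
move=> mop [f' mf ff] [g' mg gg]; exists (fun w => op (f' w) (g' w)).
  exact: mop.
by apply: filterS2 ff gg => w -> ->.
Qed.

Lemma aemeas_cst G c : aemeas G (fun=> c).
Proof. by exists (fun=> c); [exact: measurable_cst|exact: aeW]. Qed.

Lemma L2a_cst G c : L2a G (fun=> c).
Proof. by split; [exact: L2s_cst|exact: aemeas_cst]. Qed.

Lemma L2aD G f g : L2a G f -> L2a G g -> L2a G (fun w => f w + g w).
Proof.
move=> [lf af] [lg ag]; split; first exact: L2sD.
by apply: (aemeas_comp2 (op := +%R)) => // *; exact: measurable_funD.
Qed.

Lemma L2aZ G c f : L2a G f -> L2a G (fun w => c * f w).
Proof.
move=> [lf af]; split; first exact: L2sZ.
apply: (aemeas_comp2 (op := *%R)) (aemeas_cst G c) af => f' g' *.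
exact: measurable_funM.
Qed.

Lemma L2aN G f : L2a G f -> L2a G (fun w => - f w).
Proof. by move=> /(L2aZ (-1)); under eq_fun do rewrite mulN1r. Qed.

Lemma L2aB G f g : L2a G f -> L2a G g -> L2a G (fun w => f w - g w).
Proof. by move=> lf lg; apply: L2aD => //; exact: L2aN. Qed.

Lemma rv_measurable_sub (G G' : set (set Omega)) f : <<s G >> `<=` <<s G' >> ->
  rv_measurable G f -> rv_measurable G' f.
Proof.
move=> GG' mf _ A mA; rewrite setTI; apply: GG'.
by have := mf measurableT A mA; rewrite setTI.
Qed.

Lemma L2a_sub (G G' : set (set Omega)) f : <<s G >> `<=` <<s G' >> ->
  L2a G f -> L2a G' f.
Proof.
by move=> GG' [lf [g mg fg]]; split => //; exists g => //; exact: rv_measurable_sub mg.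
Qed.

(** For a weight W with conditional second moment 1, multiplication by W and
    the map Y |-> E[W Y | G] are adjoint contractions of the square-integrable
    functions. Both W = 1 and W = w_k are used. *)
Section weight.
Variables (G : set (set Omega)) (W : Omega -> R).
Hypothesis subG : <<s G >> `<=` measurable.
Hypothesis mW : measurable_fun setT W.
Hypothesis W1 : is_condE P G (fun w => W w ^+ 2) (fun=> 1).

Let weight_L2m f : L2s f -> rv_measurable G f ->
  L2s (fun w => W w * f w) /\
  Ex P (fun w => (W w * f w) ^+ 2) <= Ex P (fun w => f w ^+ 2).
Proof.
move=> [mf lf] mGf.
have eW : (fun w => (W w * f w) ^+ 2) = (fun w => f w ^+ 2 * W w ^+ 2).
  by apply/funext => w; ring.
have e1 : (fun w => f w ^+ 2) = (fun w => f w ^+ 2 * 1).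
  by apply/funext => w; ring.
have [| | | | |l1 l2] := pullout_le subG W1 (phi := fun w => f w ^+ 2).
- exact: measurable_funX.
- by move=> w; rewrite sqr_ge0.
- by move=> w; rewrite sqr_ge0.
- by [].
- by rewrite -e1.
rewrite /L2s eW [X in _ <= Ex P X]e1; split => //; split => //.
exact: measurable_funM.
Qed.

(** Pulling f^2 out of the conditional second moment of W shows that f and W f
    have the same mean square. *)
Lemma weight_L2 f : L2a G f -> L2s (fun w => W w * f w) /\
  Ex P (fun w => (W w * f w) ^+ 2) <= Ex P (fun w => f w ^+ 2).
Proof.
move=> [lf [g mg fg]].
have lg : L2s g := L2s_ae (rv_measurable_fun subG mg) fg lf.
have [lWg Eg] := weight_L2m lg mg.
have lWf : L2s (fun w => W w * f w).
  apply: (L2s_ae _ _ lWg); first by apply: measurable_funM => //; case: lf.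
  by apply: filterS fg => w ->.
split => //.
rewrite (@eq_Ex_ae _ _ _ P _ _ (proj2 lWf) (proj2 lWg)).
  rewrite (@eq_Ex_ae _ _ _ P _ _ (proj2 lf) (proj2 lg))//.
  by apply: filterS fg => w ->.
by apply: filterS fg => w ->.
Qed.

Lemma weight_condE_exists Y : L2s Y -> L1 P (fun w => W w * Y w).
Proof.
move=> lY; apply: L2s_mul => //; split => //; by case: W1.
Qed.

(** Z is not known beforehand to be square integrable, so the conditional
    expectation is tested with truncations of Z. *)
Lemma weight_condE_L2 Y Z : L2s Y -> is_condE P G (fun w => W w * Y w) Z ->
  L2a G Z /\ Ex P (fun w => Z w ^+ 2) <= Ex P (fun w => Y w ^+ 2).
Proof.
move=> lY WYZ; have [lWY lZ mGZ _] := WYZ.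
have mZ := rv_measurable_fun subG mGZ.
pose phi (n : nat) w := Order.max (- n%:R) (Order.min n%:R (Z w)).
have mGphi n : rv_measurable G (phi n).
  apply: measurable_maxr; first exact: measurable_cst.
  by apply: measurable_minr; first exact: measurable_cst.
have mphi n := rv_measurable_fun subG (mGphi n).
have n0 (n : nat) : 0 <= n%:R :> R by exact: ler0n.
have phin n w : `|phi n w| <= n%:R.
  by rewrite ler_norml /phi le_max lexx/= ge_max ge_min lexx/= andbT; have := n0 n; lra.
have phi2 n w : phi n w ^+ 2 <= phi n w * Z w.
  have := n0 n; rewrite /phi; case: (leP n%:R (Z w)) => h1 h0.
    by case: (leP (- n%:R) n%:R) => h2; nra.
  by case: (leP (- n%:R) (Z w)) => h2; nra.
have l2phi n : L2s (phi n).
  split => //; apply: (@le_L1 _ _ _ P _ (fun=> n%:R ^+ 2)); last exact: L1_cst.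
    exact: measurable_funX.
  by move=> w; rewrite normrX lerXn2r ?nnegrE.
have lphiU n U : L1 P U -> L1 P (fun w => phi n w * U w).
  move=> lU; apply: (@le_L1 _ _ _ P _ (fun w => n%:R * `|U w|)).
  - by apply: measurable_funM => //; exact: L1_meas lU.
  - by move=> w; rewrite normrM ler_wpM2r.
  - by apply: L1Z; exact: integrable_norm lU.
have Ephi n : Ex P (fun w => phi n w ^+ 2) <= Ex P (fun w => Y w ^+ 2).
  have [lWphi EWphi] := weight_L2m (l2phi n) (mGphi n).
  have : Ex P (fun w => phi n w ^+ 2) <= Ex P (fun w => phi n w * Z w).
    apply: le_Ex; [by case: (l2phi n)|exact: lphiU|exact: aeW].
  rewrite -(pullout subG WYZ (mGphi n) (lphiU _ _ lWY) (lphiU _ _ lZ)).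
  have : Ex P (fun w => phi n w * (W w * Y w)) <=
      Ex P (fun w => 2^-1 * (W w * phi n w) ^+ 2 + 2^-1 * Y w ^+ 2).
    apply: le_Ex; [exact: lphiU| |].
    - by apply: L1D; apply: L1Z; [case: lWphi|case: lY].
    - by apply: aeW => w; have := sqr_ge0 (W w * phi n w - Y w); nra.
  rewrite ExD ?ExZ; [|by case: lY|by case: lWphi|by apply: L1Z; case: lWphi
    |by apply: L1Z; case: lY].
  lra.
have [||||||lZ2 EZ2] := @fatou_bound _ _ _ P (fun n w => phi n w ^+ 2)
    (fun w => Z w ^+ 2) (Ex P (fun w => Y w ^+ 2)).
- by move=> n; case: (l2phi n).
- by move=> n w; rewrite sqr_ge0.
- exact: measurable_funX.
- by move=> w; rewrite sqr_ge0.
- apply: aeW => w; apply: cvg_near_cst.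
  near=> n.
  have : `|Z w| <= n%:R by near: n; exact: nbhs_infty_ger.
  by rewrite ler_norml => /andP[h1 h2]; rewrite /phi min_r// max_r.
- exact: Ephi.
by split => //; split => //; exists Z => //; exact: aeW.
Unshelve. all: by end_near. Qed.

Lemma weight_adjoint phi Y Z : L2a G phi -> L2s Y ->
  is_condE P G (fun w => W w * Y w) Z ->
  Ex P (fun w => phi w * Z w) = Ex P (fun w => (W w * phi w) * Y w).
Proof.
move=> lphi lY WYZ; have [[lZ _] _] := weight_condE_L2 lY WYZ.
have [lWphi _] := weight_L2 lphi.
case: lphi => lphi [g mg phig].
have lg : L2s g := L2s_ae (rv_measurable_fun subG mg) phig lphi.
have [lWg _] := weight_L2m lg mg.
have eWg : (fun w => W w * g w * Y w) = (fun w => g w * (W w * Y w)).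
  by apply/funext => w; ring.
rewrite (@eq_Ex_ae _ _ _ P _ (fun w => g w * Z w)); [|exact: L2s_mul..|].
  rewrite -(pullout subG WYZ mg _ (L2s_mul lg lZ)) -eWg; last exact: L2s_mul.
  apply: eq_Ex_ae; [exact: L2s_mul..|].
  by apply: filterS phig => w ->.
by apply: filterS phig => w ->.
Qed.

End weight.

End SquareIntegrable.

(** * Almost sure limits, completeness and composition *)

Section AlmostSureLimits.
Context {R : realType} {d : measure_display} {Omega : measurableType d}.
Variables (P : probability Omega R) (G : set (set Omega)).

(** Taking upper limits of measurable versions makes the limit measurable for G
    itself, without completing G. *)
Lemma aemeas_cvg (F : nat -> Omega -> R) :
  (forall n, aemeas P G (F n)) -> {ae P, forall w, cvgn (F ^~ w)} ->
  exists2 f : Omega -> R, rv_measurable G f & {ae P, forall w, F ^~ w @ \oo --> f w}.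
Proof.
move=> aF cF.
have /choice[g hg] : forall n, exists g, rv_measurable G g /\ {ae P, forall w, F n w = g w}.
  by move=> n; have [g mg Fg] := aF n; exists g.
exists (fun w => fine (limn_esup (fun n => (g n w)%:E))).
  apply: (@measurableT_comp _ _ _ _ _ _ fine _
    (fun w : g_sigma_algebraType G => limn_esup (fun n => (g n w)%:E))) => //.
  by apply: measurable_fun_limn_esup => n; apply/measurable_EFinP; case: (hg n).
have Fg : {ae P, forall w, forall n, F n w = g n w}.
  by apply: ae_foralln => n; case: (hg n).
apply: filterS2 cF Fg => w cF Fg.
have -> : (fun n => (g n w)%:E) = (fun n => (F n w)%:E).
  by apply/funext => n; rewrite Fg.
have Fl : (fun n => (F n w)%:E) @ \oo --> (limn (F ^~ w))%:E.
  by apply: cvg_EFin => //; exact: nearW.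
by have [_ ->] := cvg_limn_einf_sup Fl.
Qed.

End AlmostSureLimits.

Section Completeness.
Context {R : realType} {d : measure_display} {Omega : measurableType d}.
Variables (P : probability Omega R) (G : set (set Omega)).
Hypothesis subG : <<s G >> `<=` measurable.
Variables (F : nat -> Omega -> R) (C : R).
Hypothesis lF : forall n, L2a P G (F n).
Hypothesis FC : forall n, Ex P (fun w => (F n.+1 w - F n w) ^+ 2) <= C * 4^-1 ^+ n.

Let lD n m : L1 P (fun w => (F n w - F m w) ^+ 2).
Proof. by have [[]] := L2aB (lF n) (lF m). Qed.

Let C0 : 0 <= C.
Proof.
have := FC 0; rewrite expr0 mulr1; apply: le_trans.
by apply: Ex_ge0 => w; rewrite sqr_ge0.
Qed.

Let gap m n : Ex P (fun w => (F (n + m)%N w - F n w) ^+ 2) <= 4 * C * 4^-1 ^+ n.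
Proof.
elim: m n => [|m IH] n.
  rewrite addn0; under eq_fun do rewrite subrr expr0n.
  by rewrite Ex_cst !mulr_ge0// exprn_ge0.
apply: (@le_trans _ _ (2 * (4 * C * 4^-1 ^+ n.+1) + 2 * (C * 4^-1 ^+ n))); last first.
  by rewrite exprS; have : 0 <= C * 4^-1 ^+ n; [rewrite mulr_ge0// exprn_ge0|lra].
rewrite addnS -addSn.
apply: (@le_trans _ _ (2 * Ex P (fun w => (F (n.+1 + m)%N w - F n.+1 w) ^+ 2)
   + 2 * Ex P (fun w => (F n.+1 w - F n w) ^+ 2))); last first.
  by apply: lerD; rewrite ler_pM2l.
rewrite -!ExZ -?ExD; [|exact: L1Z|exact: L1Z|exact: lD..].
apply: le_Ex; [exact: lD|by apply: L1D; exact: L1Z|apply: aeW => w].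
by have := sqr_ge0 (F (n.+1 + m)%N w - F n.+1 w - (F n.+1 w - F n w)); nra.
Qed.

Let incr n w := `|F n.+1 w - F n w|.

Let incr_L1 n : L1 P (incr n).
Proof.
apply: (integrable_norm (f := fun w => F n.+1 w - F n w)).
by have [/L2s_L1] := L2aB (lF n.+1) (lF n).
Qed.

(* Young's inequality with weight 2^n turns the bound 4^-n on the mean square of
   an increment into a bound 2^-n on its mean. *)
Let incr_mean n : Ex P (incr n) <= (C + 1) / (2 ^ n.+1)%:R.
Proof.
have q : 4^-1 ^+ n = (2 ^ n)%:R^-1 ^+ 2 :> R.
  by rewrite natrX -exprVn -!exprM mulnC exprM; congr (_ ^+ _); field.
have p0 : 0 < (2 ^ n)%:R :> R by rewrite ltr0n expn_gt0.
have e2 : (2 ^ n.+1)%:R = 2 * (2 ^ n)%:R :> R by rewrite expnS natrM.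
apply: (@le_trans _ _ (Ex P (fun w => ((2 ^ n)%:R / 2) * (F n.+1 w - F n w) ^+ 2
    + ((2 ^ n)%:R^-1 / 2)))).
  apply: le_Ex => //.
    by apply: L1D; [exact: L1Z|exact: L1_cst].
  apply: aeW => w; rewrite /incr -real_normK ?num_real//.
  set t := `|_|; set k : R := _%:R in p0 *.
  have ik : k * k^-1 = 1 by rewrite divff// gt_eqF.
  have : 0 <= k * (t - k^-1) ^+ 2 by rewrite mulr_ge0 ?sqr_ge0// ltW.
  have -> : k * (t - k^-1) ^+ 2 = k * t ^+ 2 - 2 * (k * k^-1) * t + (k * k^-1) * k^-1.
    by ring.
  rewrite ik; lra.
rewrite ExD; [|exact/L1Z/lD|exact: L1_cst].
rewrite ExZ ?Ex_cst; last exact: lD.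
have := FC n; rewrite q => h.
apply: (@le_trans _ _ ((2 ^ n)%:R / 2 * (C * (2 ^ n)%:R^-1 ^+ 2) + (2 ^ n)%:R^-1 / 2)).
  by rewrite lerD2r ler_pM2l// divr_gt0.
rewrite e2 le_eqVlt; apply/orP; left; apply/eqP; field.
by rewrite gt_eqF.
Qed.

Let incr_sum : {ae P, forall w, (\sum_(n <oo) (incr n w)%:E < +oo)%E}.
Proof.
have mi n : measurable_fun setT (fun w => (incr n w)%:E).
  by apply/measurable_EFinP; exact: L1_meas (incr_L1 n).
have iS : P.-integrable setT (fun w => \sum_(n <oo) (incr n w)%:E)%E.
  apply/integrableP; split.
    by apply: ge0_emeasurable_sum => // n w _ _; rewrite lee_fin normr_ge0.
  under eq_integral.
    move=> w _; rewrite gee0_abs; last first.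
      by apply: nneseries_ge0 => n _ _; rewrite lee_fin normr_ge0.
    over.
  rewrite /= integral_nneseries//; last by move=> n w _; rewrite lee_fin normr_ge0.
  apply: (@le_lt_trans _ _ (\sum_(n <oo) ((C + 1) / (2 ^ n.+1)%:R)%:E)%E).
    apply: lee_nneseries => [n _ _|n _].
      by apply: integral_ge0 => w _; rewrite lee_fin normr_ge0.
    rewrite -ExE; last exact: incr_L1.
    by rewrite lee_fin; exact: incr_mean.
  have E n : ((C + 1) / (2 ^ n.+1)%:R)%:E = ((C + 1) / (2 ^ (n + 1))%:R)%:E.
    by rewrite addn1.
  rewrite (eq_eseriesr (fun n _ => E n)).
  by rewrite (cvg_lim _ (@cvg_geometric_eseries_half R (C + 1) 0))// ltry.
have := integrable_ae measurableT iS.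
by apply: filterS => w /(_ I); rewrite ltey_eq => ->.
Qed.

Let F_cvg : {ae P, forall w, cvgn (F ^~ w)}.
Proof.
apply: filterS incr_sum => w hw.
have cs : cvgn (series (fun n => F n.+1 w - F n w)).
  apply: normed_cvg.
  apply: (@nondecreasing_is_cvgn _ (fun n => \sum_(0 <= k < n) incr k w)).
    by apply/nondecreasing_seqP => n; rewrite big_nat_recr//= lerDl normr_ge0.
  exists (fine (\sum_(n <oo) (incr n w)%:E)%E) => _ [n _ <-].
  have s0 : (0 <= \sum_(n <oo) (incr n w)%:E)%E.
    by apply: nneseries_ge0 => k _ _; rewrite lee_fin normr_ge0.
  rewrite -lee_fin fineK ?ge0_fin_numE// -sumEFin.
  by apply: nneseries_lim_ge => k _ _; rewrite lee_fin normr_ge0.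
have -> : F ^~ w = (fun n => F 0 w + series (fun n => F n.+1 w - F n w) n).
  by apply/funext => n; rewrite /series/= telescope_sumr// addrC subrK.
by apply: is_cvgD => //; exact: is_cvg_cst.
Qed.

(** Completeness of the space of square-integrable functions, for sequences
    whose increments decrease geometrically: such a sequence converges almost
    surely because its increments are absolutely summable in mean. *)
Lemma L2a_complete : exists2 f, L2a P G f &
  forall n, Ex P (fun w => (F n w - f w) ^+ 2) <= 4 * C * 4^-1 ^+ n.
Proof.
have [f mf Ff] := aemeas_cvg (fun n => (lF n).2) F_cvg.
have mf' := rv_measurable_fun subG mf.
have mF n : measurable_fun setT (F n) by case: (lF n) => [[]].
have bound n : L1 P (fun w => (F n w - f w) ^+ 2) /\
    Ex P (fun w => (F n w - f w) ^+ 2) <= 4 * C * 4^-1 ^+ n.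
  apply: (@fatou_bound _ _ _ P (fun m w => (F (n + m)%N w - F n w) ^+ 2)) => //.
  - by move=> m w; rewrite sqr_ge0.
  - by apply: measurable_funX; exact: measurable_funB.
  - by move=> w; rewrite sqr_ge0.
  - apply: filterS Ff => w Fw.
    rewrite -[(F n w - _) ^+ 2]sqrrN opprB.
    have Fn : (fun m => F (n + m)%N w) @ \oo --> f w.
      by rewrite -(@cvg_shiftn n) in Fw; under eq_fun do rewrite addnC.
    by apply: cvgM; (apply: cvgB; [exact: Fn|exact: cvg_cst]).
exists f => [|n]; last by case: (bound n).
split; last by exists f => //; exact: aeW.
have -> : f = (fun w => F 0 w - (F 0 w - f w)).
  by apply/funext => w; rewrite opprB addrC subrK.
apply: L2sB; first by case: (lF 0).
by split; [exact: measurable_funB|case: (bound 0)].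
Qed.

End Completeness.

Section Composition.
Context {R : realType} {d : measure_display} {Omega : measurableType d}.
Variables (P : probability Omega R) (G : set (set Omega)).
Variable I : finType.

Let gT := g_sigma_algebraType G.

(** A random field that is measurable at each deterministic point and Lipschitz
    in the point can be evaluated at a measurable random point: approximate the
    point on finer and finer grids, where countably many values occur. *)
Lemma aemeas_comp (h : Omega -> (I -> R) -> R) (L : R) (t : I -> Omega -> R) :
  (forall v, rv_measurable G (h ^~ v)) ->
  {ae P, forall w, forall v v', `|h w v - h w v'| <= L * \sum_i `|v i - v' i|} ->
  (forall i, aemeas P G (t i)) ->
  aemeas P G (fun w => h w (fun i => t i w)).
Proof.
move=> mh hL at_.
have /choice[g hg] : forall i, exists g, rv_measurable G g /\ {ae P, forall w, t i w = g w}.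
  by move=> i; have [g mg tg] := at_ i; exists g.
have tg : {ae P, forall w, forall i, t i w = g i w}.
  by apply: filter_forall => i; case: (hg i).
apply: (@aemeas_ae _ _ _ P G (fun w => h w (fun i => g i w))).
  apply: filterS tg => w tg; congr h; apply/funext => i; exact/esym/tg.
pose grid (n : nat) (c : {ffun I -> int}) : I -> R := fun i => (c i)%:~R / n.+1%:R.
pose cell n w : {ffun I -> int} := [ffun i => Num.floor (n.+1%:R * g i w)].
pose F n w := h w (grid n (cell n w)).
have mF n : aemeas P G (F n).
  exists (F n); last exact: aeW.
  move=> _ B mB; rewrite setTI.
  have -> : F n @^-1` B = \bigcup_(c in [set: {ffun I -> int}])
      ((\bigcap_i [set w | n.+1%:R * g i w \in `[(c i)%:~R, (c i + 1)%:~R[ ])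
       `&` (h ^~ (grid n c)) @^-1` B).
    apply/seteqP; split => [w FB|w [c _ [wc hB]]].
      exists (cell n w) => //; split => // i _ /=.
      by rewrite in_itv/= ffunE; exact: floor_itv.
    have -> // : F n @^-1` B = [set w | B (F n w)] by [].
    rewrite /= /F (_ : cell n w = c)//; apply/ffunP => i.
    by rewrite ffunE; apply: floor_def; have := wc i Logic.I; rewrite /= in_itv.
  apply: (@countable_bigcupT_measurable _ gT) => // c.
  apply: measurableI; last first.
    by have := mh (grid n c) measurableT B mB; rewrite setTI.
  rewrite -[X in _.-measurable X]setCK setC_bigcap; apply: measurableC.
  apply: (@countable_bigcupT_measurable _ gT) => // i; apply: measurableC.
  have [mgi _] := hg i.
  have := measurable_funM (measurable_cst (n.+1%:R : R)) mgi measurableT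
    (measurable_itv `[(c i)%:~R, (c i + 1)%:~R[).
  by rewrite setTI.
have Fh : {ae P, forall w, F ^~ w @ \oo --> h w (fun i => g i w)}.
  apply: filterS hL => w hL; rewrite -subr_cvg0; apply/norm_cvg0P.
  apply: (@squeeze_cvgr _ _ _ _ (fun=> 0)
      (fun n => (`|L| * #|I|%:R) * harmonic n)).
  - apply: nearW => n; rewrite normr_ge0/=; apply: (le_trans (hL _ _)).
    rewrite -mulrA; apply: (@le_trans _ _ (`|L| * \sum_i `|grid n (cell n w) i - g i w|)).
      by rewrite ler_wpM2r ?ler_norm// sumr_ge0.
    rewrite ler_wpM2l// mulrC mulr_natr -sumr_const; apply: ler_sum => i _.
    rewrite /grid ffunE /=; have /andP[] := floor_itv (n.+1%:R * g i w).
    set z := _%:~R; rewrite intrD -/z => h1 h2.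
    have n0 : 0 < n.+1%:R :> R by rewrite ltr0n.
    rewrite -(ler_pM2l n0) -{1}[n.+1%:R]gtr0_norm// -normrM mulrBr mulrCA divff ?gt_eqF//.
    by rewrite mulr1 ler_norml; apply/andP; split; lra.
  - exact: cvg_cst.
  - rewrite -[X in _ --> X](mulr0 (`|L| * #|I|%:R)).
    by apply: cvgM; [exact: cvg_cst|exact: cvg_harmonic].
have cF : {ae P, forall w, cvgn (F ^~ w)} by apply: filterS Fh => w /cvgP.
have [f mf Ff] := aemeas_cvg mF cF.
exists f => //; apply: filterS2 Ff Fh => w Ff Fh.
exact: cvg_unique Fh Ff.
Qed.

End Composition.

(** * Discrete Gronwall inequalities *)

Section Recursions.
Context {R : realType}.
Implicit Types (a B : R) (Z : nat -> R).

Fixpoint gronwall a k : R := if k is k'.+1 then a * (gronwall a k' + 1) else a.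

Definition gronwall_sum a N : R := \sum_(k < N.+1) gronwall a k.

Lemma gronwall_ge0 a k : 0 <= a -> 0 <= gronwall a k.
Proof. by move=> a0; elim: k => //= k IH; rewrite mulr_ge0// addr_ge0. Qed.

Lemma gronwall_sum_ge0 a N : 0 <= a -> 0 <= gronwall_sum a N.
Proof. by move=> a0; apply: sumr_ge0 => k _; exact: gronwall_ge0. Qed.

Lemma sum_recursion_le N a B Z : 0 <= a ->
  Z 0%N <= a * B -> (forall k, (k < N)%N -> Z k.+1 <= a * (Z k + B)) ->
  \sum_(k < N.+1) Z k <= gronwall_sum a N * B.
Proof.
move=> a0 Z0 ZS; rewrite mulr_suml; apply: ler_sum => -[k /= kN] _.
elim: k kN => [_|k IH kN] /=; first exact: Z0.
apply: (le_trans (ZS _ _)) => //; rewrite -mulrA ler_wpM2l//.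
by rewrite mulrDl mul1r lerD2r; apply: IH; exact: ltnW.
Qed.

Definition two_pass_cst a N : R :=
  gronwall_sum a N + gronwall_sum a N * (gronwall_sum a N + 1).

Lemma two_pass_cst_ge0 a N : 0 <= a -> 0 <= two_pass_cst a N.
Proof.
by move=> /(gronwall_sum_ge0 N) g0; rewrite addr_ge0// mulr_ge0// addr_ge0.
Qed.

(** One pass bounds Z by B, a second pass bounds Z' by Z and B: this covers
    both the forward-then-backward and the backward-then-forward case. *)
Lemma two_pass_le N a B (Z Z' : nat -> R) : 0 <= a ->
  (forall k, (k <= N)%N -> 0 <= Z k) ->
  Z 0%N <= a * B -> (forall k, (k < N)%N -> Z k.+1 <= a * (Z k + B)) ->
  (forall z, (forall k, (k <= N)%N -> Z k <= z) ->
    Z' 0%N <= a * (z + B) /\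
    (forall k, (k < N)%N -> Z' k.+1 <= a * (Z' k + (z + B)))) ->
  \sum_(k < N.+1) Z k + \sum_(k < N.+1) Z' k <= two_pass_cst a N * B.
Proof.
move=> a0 Zge0 Z0 ZS hZ'.
have h1 := sum_recursion_le a0 Z0 ZS; set s := \sum_(k < _) Z k in h1 *.
have [|Z'0 Z'S] := hZ' s.
  move=> k kN; rewrite /s (bigD1 (Ordinal (kN : (k < N.+1)%N)))//= lerDl.
  by apply: sumr_ge0 => -[i /= iN] _; apply: Zge0.
have h2 := sum_recursion_le a0 Z'0 Z'S.
have g0 := gronwall_sum_ge0 N a0.
rewrite /two_pass_cst mulrDl; apply: lerD => //; apply: (le_trans h2).
by rewrite -mulrA ler_wpM2l// mulrDl mul1r lerD2r.
Qed.

(** Young's inequality with e = 1 / (2 (C + 1)) leaves half of T on the right,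
    to be absorbed on the left. *)
Lemma absorb_le (T Pi rho C : R) : 0 <= C -> 0 <= rho ->
  T <= C * (Pi + rho) ->
  (forall e, 0 < e -> Pi <= e * T + e^-1 * rho) ->
  T <= 2 * (C * (2 * (C + 1) + 1)) * rho.
Proof.
move=> C0 rho0 TC hPi.
have e0 : 0 < (2 * (C + 1))^-1 by rewrite invr_gt0; lra.
have := hPi _ e0; rewrite invrK => h.
have : C * (Pi + rho) <= C * ((2 * (C + 1))^-1 * T + 2 * (C + 1) * rho + rho).
  by rewrite ler_wpM2l// lerD2r.
have : C * ((2 * (C + 1))^-1 * T) <= 2^-1 * T \/ T <= 0.
  have [T0|T0] := leP T 0; [by right|left].
  rewrite mulrA ler_wpM2r ?(ltW T0)// ler_pdivrMr; lra.
case=> [h1 h2|T0 _].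
  have : C * ((2 * (C + 1))^-1 * T + 2 * (C + 1) * rho + rho) =
    C * ((2 * (C + 1))^-1 * T) + C * (2 * (C + 1) + 1) * rho by ring.
  lra.
by apply: (le_trans T0); rewrite !mulr_ge0//; lra.
Qed.

Lemma le0_geometric (x M : R) : (forall n, x <= M * 4^-1 ^+ n) -> x <= 0.
Proof.
move=> h; have c : geometric M 4^-1 @ \oo --> (0 : R).
  by apply: cvg_geometric; rewrite ger0_norm// invf_lt1// ltr1n.
rewrite -(cvg_lim _ c)//; apply: limr_ge; first exact: cvgP c.
exact: nearW.
Qed.

End Recursions.

(** * The method of continuation *)

(** The equation u - tau S u = g is followed from tau = 0 to tau = 1. The space
    is only given through a square seminorm s, so that almost surely equal processes need not be
    identified: equations hold up to a remainder of seminorm zero. The factor 2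
    in sD is that of the squared triangle inequality, and D singles out the
    elements on which s is meaningful. *)
Section Continuation.
Context {R : realType} {U : lmodType R}.
Variables (D : U -> Prop) (s : U -> R) (S : U -> U) (Lam K : R).
Hypothesis DD : forall u v, D u -> D v -> D (u + v).
Hypothesis DZ : forall c u, D u -> D (c *: u).
Hypothesis DS : forall u, D u -> D (S u).
Hypothesis s_ge0 : forall u, D u -> 0 <= s u.
Hypothesis sD : forall u v, D u -> D v -> s (u + v) <= 2 * s u + 2 * s v.
Hypothesis sZ : forall c u, D u -> s (c *: u) = c ^+ 2 * s u.
Hypothesis complete : forall (F : nat -> U) (C : R), (forall n, D (F n)) ->
  (forall n, s (F n.+1 - F n) <= C * 4^-1 ^+ n) ->
  exists2 u, D u & exists C', forall n, s (F n - u) <= C' * 4^-1 ^+ n.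
Hypothesis lipS : forall u v, D u -> D v -> s (S u - S v) <= Lam * s (u - v).
Hypothesis stable : forall tau u v, 0 <= tau <= 1 -> D u -> D v ->
  s (u - v) <= K * s ((u - tau *: S u) - (v - tau *: S v)).
Hypothesis Lam0 : 0 <= Lam.
Hypothesis K0 : 0 <= K.
Variable u0 : U.
Hypothesis Du0 : D u0.

Let DN u : D u -> D (- u).
Proof. by move=> Du; rewrite -scaleN1r; exact: DZ. Qed.

Let DB u v : D u -> D v -> D (u - v).
Proof. by move=> Du Dv; apply: DD => //; exact: DN. Qed.

Let sN u : D u -> s (- u) = s u.
Proof. by move=> Du; rewrite -scaleN1r sZ// sqrrN expr1n mul1r. Qed.

Let sB u v : D u -> D v -> s (u - v) <= 2 * s u + 2 * s v.
Proof. by move=> Du Dv; rewrite -[X in _ + 2 * X]sN//; apply: sD => //; exact: DN. Qed.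

Let solvable tau := forall g, D g -> exists2 u, D u & s (u - tau *: S u - g) <= 0.

Let solvable0 : solvable 0.
Proof.
move=> g Dg; exists g => //; rewrite scale0r subr0 subrr.
by rewrite -(scale0r g) sZ// expr0n mul0r.
Qed.

(* From tau to tau + delta: the solution is the limit of the iteration that
   solves, at tau, the equation with right-hand side g + delta S u for the
   previous iterate u. By stability it contracts s by delta^2 K Lam, and the
   smallness hypothesis leaves room for the remainders. *)
Let step tau delta : 0 <= tau -> 0 <= delta -> tau + delta <= 1 ->
  2 * (K * (delta ^+ 2 * Lam)) <= 4^-1 -> solvable tau -> solvable (tau + delta).
Proof.
move=> tau0 delta0 taud1 small solv g Dg.
have tau01 : 0 <= tau <= 1 by rewrite tau0/= (le_trans _ taud1)// lerDl.
have Dg' u : D u -> D (g + delta *: S u) by move=> Du; exact/DD/DZ/DS.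
have /choice[next hnext] : forall u, exists v, D u ->
    D v /\ s (v - tau *: S v - (g + delta *: S u)) <= 0.
  move=> u; have [Du|nDu] := pselect (D u); last by exists u0.
  by have [v Dv hv] := solv _ (Dg' _ Du); exists v.
pose F n := iter n next g.
have DF n : D (F n) by elim: n => //= n /hnext[].
have FE n : s (F n.+1 - tau *: S (F n.+1) - (g + delta *: S (F n))) <= 0.
  by have [] := hnext _ (DF n).
have Dres n : D (F n.+1 - tau *: S (F n.+1) - (g + delta *: S (F n))).
  apply: DB; last exact: Dg'.
  by apply: DB => //; exact/DZ/DS.
have contr n : s (F n.+2 - F n.+1) <= 4^-1 * s (F n.+1 - F n).
  apply: (le_trans (stable tau01 (DF _) (DF _))).
  set e := F n.+2 - _; set e' := F n.+1 - tau *: _.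
  have -> : e - e' = delta *: (S (F n.+1) - S (F n)) +
     ((e - (g + delta *: S (F n.+1))) - (e' - (g + delta *: S (F n)))).
    have -> : delta *: (S (F n.+1) - S (F n)) =
        (g + delta *: S (F n.+1)) - (g + delta *: S (F n)).
      by rewrite scalerBr opprD addrACA subrr add0r.
    have zmodE (a b p q : U) : a - b = (p - q) + ((a - p) - (b - q)).
      by rewrite opprB addrACA [p + _]addrC subrK addKr.
    exact: zmodE.
  have h1 : s (delta *: (S (F n.+1) - S (F n)) +
     ((e - (g + delta *: S (F n.+1))) - (e' - (g + delta *: S (F n)))))
     <= 2 * (delta ^+ 2 * (Lam * s (F n.+1 - F n))).
    apply: (le_trans (sD _ _)).
    - by apply: DZ; apply: DB; exact: DS.
    - exact: DB (Dres n.+1) (Dres n).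
    have := sB (Dres n.+1) (Dres n); rewrite -/e -/e'.
    have := FE n; have := FE n.+1; rewrite -/e -/e'.
    rewrite sZ; last by apply: DB; exact: DS.
    have : delta ^+ 2 * s (S (F n.+1) - S (F n)) <= delta ^+ 2 * (Lam * s (F n.+1 - F n)).
      by rewrite ler_wpM2l ?sqr_ge0//; exact: lipS.
    lra.
  apply: (le_trans (ler_wpM2l K0 h1)).
  have := ler_wpM2r (s_ge0 (DB (DF n.+1) (DF n))) small.
  by apply: le_trans; rewrite le_eqVlt; apply/orP; left; apply/eqP; ring.
have geo n : s (F n.+1 - F n) <= s (F 1%N - F 0%N) * 4^-1 ^+ n.
  elim: n => [|n IH]; first by rewrite expr0 mulr1.
  apply: (le_trans (contr n)); rewrite exprS mulrCA ler_pM2l//.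
have [u Du [C hC]] := complete DF geo.
exists u => //.
have C0 : 0 <= C.
  by have := hC 0%N; rewrite expr0 mulr1; apply: le_trans; apply: s_ge0; exact: DB.
apply: (@le0_geometric _ _ (8 * (C + Lam * C + Lam * C))) => n.
have q0 : 0 <= 4^-1 ^+ n :> R by rewrite exprn_ge0.
have q1 : 4^-1 ^+ n.+1 <= 4^-1 ^+ n :> R by rewrite exprS ler_piMl// invf_le1// ler1n.
have -> : u - (tau + delta) *: S u - g =
   ((F n.+1 - tau *: S (F n.+1) - (g + delta *: S (F n))) - (F n.+1 - u)) +
   (tau *: (S (F n.+1) - S u) + delta *: (S (F n) - S u)).
  rewrite !scalerBr scalerDl.
  set a := tau *: _; set b := delta *: _; set a' := tau *: _; set b' := delta *: _.
  rewrite opprB -[F n.+1 - a - _]addrA -opprD [_ + (u - _)]addrC addrA subrK.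
  rewrite [a - a' + _]addrACA -[- a' - b']opprD [a + (g + b)]addrCA.
  by rewrite [- (g + _)]opprD [u + (_ - _)]addrA addrA subrK addrAC.
apply: (le_trans (sD _ _)).
- by apply: DB => //; exact: DB.
- by apply: DD; apply: DZ; apply: DB; exact: DS.
have h1 := sB (Dres n) (DB (DF n.+1) Du).
have h2 : s (tau *: (S (F n.+1) - S u) + delta *: (S (F n) - S u)) <=
    2 * (Lam * s (F n.+1 - u)) + 2 * (Lam * s (F n - u)).
  apply: (le_trans (sD _ _)); [by apply/DZ/DB; exact: DS..|].
  rewrite !sZ; [|by apply: DB; exact: DS..].
  have h c v v' : 0 <= c <= 1 -> D v -> D v' -> 2 * (c ^+ 2 * s (S v - S v')) <=
      2 * (Lam * s (v - v')).
    move=> /andP[c0 c1] Dv Dv'; rewrite ler_pM2l//.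
    apply: le_trans (lipS Dv Dv'); rewrite ler_piMl//; last by rewrite expr_le1.
    by apply: s_ge0; apply: DB; exact: DS.
  by apply: lerD; apply: h => //; rewrite delta0 (le_trans _ taud1)// lerDr.
have h3 := hC n; have h4 := hC n.+1; have h5 := FE n.
have h6 : C * 4^-1 ^+ n.+1 <= C * 4^-1 ^+ n by rewrite ler_wpM2l.
have h7 : Lam * s (F n.+1 - u) <= Lam * (C * 4^-1 ^+ n).
  by rewrite ler_wpM2l// (le_trans h4).
have h8 : Lam * s (F n - u) <= Lam * (C * 4^-1 ^+ n) by rewrite ler_wpM2l.
have h9 := mulr_ge0 C0 q0.
have -> : 8 * (C + Lam * C + Lam * C) * 4^-1 ^+ n =
   8 * (C * 4^-1 ^+ n) + 16 * (Lam * (C * 4^-1 ^+ n)) by ring.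
have h10 : 0 <= Lam * (C * 4^-1 ^+ n) by rewrite mulr_ge0.
lra.
Qed.

(** The admissible step depends on K and Lam only, so that finitely many equal
    steps lead from 0 to 1. *)
Lemma continuation_fixpoint : exists2 u, D u & s (u - S u) <= 0.
Proof.
have [J hJ] : exists J : nat, 8 * (K * Lam) <= J.+1%:R.
  exists (Num.bound (8 * (K * Lam))); apply: ltW.
  apply: (lt_le_trans (archi_boundP _)); last by rewrite ler_nat.
  by rewrite !mulr_ge0.
have J0 : 0 < J.+1%:R :> R by rewrite ltr0n.
have small : 2 * (K * ((J.+1%:R^-1) ^+ 2 * Lam)) <= 4^-1 :> R.
  have x0 : 0 <= J.+1%:R^-1 :> R by rewrite invr_ge0 ltW.
  have x1 : J.+1%:R^-1 <= 1 :> R by rewrite invf_le1// ler1n.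
  have h : 8 * (K * Lam) * J.+1%:R^-1 <= 1 by rewrite ler_pdivrMr// mul1r.
  have := ler_wpM2r x0 h; rewrite mul1r => h'.
  have -> : 2 * (K * (J.+1%:R^-1 ^+ 2 * Lam)) =
    4^-1 * (8 * (K * Lam) * J.+1%:R^-1 * J.+1%:R^-1) by field; rewrite gt_eqF.
  by rewrite ler_piMr// (le_trans h').
have solv j : (j <= J.+1)%N -> solvable (j%:R / J.+1%:R).
  elim: j => [_|j IH jJ]; first by rewrite mul0r; exact: solvable0.
  rewrite -natr1 mulrDl div1r; apply: step => //.
  - by rewrite -[X in _ + X]div1r -mulrDl natr1 ler_pdivrMr// mul1r ler_nat.
  - exact/IH/ltnW.
have [u Du hu] := solv J.+1 (leqnn _) (0 *: u0) (DZ 0 Du0).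
exists u => //; move: hu.
by rewrite divff ?gt_eqF// scale1r scale0r subr0.
Qed.

End Continuation.

(** * Recursions in the two directions of time *)

(** The arithmetic of the a priori estimate. X and Y stand for the mean squares
    of the increments of the two components, AX and AY for those of the
    right-hand sides, rho for the mean square of the residual, and Pi for the
    sum of the mean monotonicity gaps pi, piL, piF. *)
Section TwoPass.
Context {R : realType}.
Variables (N : nat) (K1 K2 L2 Pi rho piL piF : R) (X Y AX AY pi : nat -> R).
Hypotheses (K1_ge0 : 0 <= K1) (K2_ge0 : 0 <= K2) (L2_ge0 : 0 <= L2).
Hypotheses (rho_ge0 : 0 <= rho) (piL_ge0 : 0 <= piL) (piF_ge0 : 0 <= piF).
Hypothesis pi_ge0 : forall k, (k < N)%N -> 0 <= pi k.
Hypothesis PiE : Pi = piF + piL + \sum_(k < N) pi k.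
Hypothesis X_ge0 : forall k, 0 <= X k.
Hypothesis Y_ge0 : forall k, 0 <= Y k.
Hypothesis leX : forall k, (k <= N)%N -> X k <= 2 * AX k + 2 * rho.
Hypothesis leY : forall k, (k <= N)%N -> Y k <= 2 * AY k + 2 * rho.

(** A common bound for the coefficients of the four recursions below, as
    gathered from leX and leY. *)
Definition pass_cst (K1 K2 L2 : R) := 4 * K1 + 4 * K2 + 16 * L2 + 2.

Let a := pass_cst K1 K2 L2.

Let B := Pi + rho.

Let sum_pi_ge0 : 0 <= \sum_(k < N) pi k.
Proof. by apply: sumr_ge0 => -[k kN] _; exact: pi_ge0. Qed.

Let B_ge0 : 0 <= B.
Proof. by move: rho_ge0 piL_ge0 piF_ge0 sum_pi_ge0; rewrite /B PiE; lra. Qed.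

Let le_pi k : (k < N)%N -> K2 * pi k <= K2 * B.
Proof.
move=> kN; apply: ler_wpM2l => //.
have : pi k <= \sum_(k < N) pi k.
  rewrite (bigD1 (Ordinal kN))//= lerDl; apply: sumr_ge0 => -[i iN] _; exact: pi_ge0.
by move: rho_ge0 piL_ge0 piF_ge0; rewrite /B PiE; lra.
Qed.

Let le_piL : K2 * piL <= K2 * B.
Proof.
apply: ler_wpM2l => //; move: rho_ge0 piL_ge0 piF_ge0 sum_pi_ge0.
by rewrite /B PiE; lra.
Qed.

Let le_piF : K2 * piF <= K2 * B.
Proof.
apply: ler_wpM2l => //; move: rho_ge0 piL_ge0 piF_ge0 sum_pi_ge0.
by rewrite /B PiE; lra.
Qed.

Let le_rho : rho <= B.
Proof. by move: piL_ge0 piF_ge0 sum_pi_ge0; rewrite /B PiE; lra. Qed.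

Let a_ge0 : 0 <= a.
Proof. by move: K1_ge0 K2_ge0 L2_ge0; rewrite /a /pass_cst; lra. Qed.

Let expand z : 0 <= z -> [/\ 0 <= K1 * z, 0 <= K2 * z, 0 <= L2 * z &
  a * z = 4 * (K1 * z) + 4 * (K2 * z) + 16 * (L2 * z) + 2 * z].
Proof. by move=> z0; split; [rewrite mulr_ge0..|rewrite /a /pass_cst; ring]. Qed.

Let rev_sum (Z : nat -> R) : \sum_(k < N.+1) Z (N - k)%N = \sum_(k < N.+1) Z k.
Proof. by rewrite [RHS](reindex_inj rev_ord_inj)/=; under [RHS]eq_bigr do rewrite subSS. Qed.

(** When the gaps control the increments of the forward coefficients up to X,
    X satisfies a closed recursion; the Lipschitz bound on the backward
    coefficients then gives a recursion for Y in terms of X. *)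
Lemma forward_backward_le :
  AX 0%N <= K2 * piL ->
  (forall k, (k < N)%N -> AX k.+1 <= 2 * (K1 * X k) + 2 * (K2 * pi k)) ->
  AY N <= L2 * X N ->
  (forall k, (k < N)%N -> AY k <= L2 * (X k + 2 * Y k.+1)) ->
  \sum_(k < N.+1) X k + \sum_(k < N.+1) Y k <= two_pass_cst a N * B.
Proof.
move=> AX0 AXS AYN AYS; rewrite -[X in _ + X]rev_sum.
have [b1 b2 b3 Ba] := expand B_ge0.
apply: (two_pass_le (Z' := fun k => Y (N - k)%N) a_ge0) => //.
- by have := leX (leq0n N); have := le_piL; have := B_ge0; have := le_rho; lra.
- move=> k kN; have := leX kN; have := AXS k kN; have := le_pi kN; have := B_ge0; have := le_rho.
  have [x1 x2 x3 xa] := expand (X_ge0 k); have := X_ge0 k.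
  rewrite [a * (_ + _)]mulrDr xa Ba; lra.
move=> z hz; split=> [|k kN].
  rewrite subn0; have := leY (leqnn N); have := ler_wpM2l L2_ge0 (hz N (leqnn N)).
  have z0 := le_trans (X_ge0 0%N) (hz 0%N (leq0n N)).
  have [z1 z2 z3 za] := expand z0.
  have := B_ge0; have := le_rho; rewrite [a * (_ + _)]mulrDr za Ba; lra.
have jN : (N - k.+1 < N)%N by rewrite ltn_subrL/= (leq_ltn_trans _ kN).
have := leY (ltnW jN); have := AYS _ jN; have -> : (N - k.+1).+1 = (N - k)%N by rewrite subnSK.
have := ler_wpM2l L2_ge0 (hz _ (ltnW jN)).
have z0 := le_trans (X_ge0 0%N) (hz 0%N (leq0n N)).
have [z1 z2 z3 za] := expand z0.
have [y1 y2 y3 ya] := expand (Y_ge0 (N - k)%N); have := Y_ge0 (N - k)%N.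
have := B_ge0; have := le_rho; rewrite (mulrDr a (Y _)) (mulrDr a z B) za Ba ya (mulrDr L2) (mulrCA L2 2); lra.
Qed.

(** The mirror image: Y satisfies a closed backward recursion, and X follows. *)
Lemma backward_forward_le :
  AY N <= K2 * piF ->
  (forall k, (k < N)%N -> AY k <= 2 * (K1 * Y k.+1) + K2 * pi k) ->
  AX 0%N <= L2 * Y 0%N ->
  (forall k, (k < N)%N -> AX k.+1 <= 4 * (L2 * (X k + 2 * Y k.+1))) ->
  \sum_(k < N.+1) X k + \sum_(k < N.+1) Y k <= two_pass_cst a N * B.
Proof.
move=> AYN AYS AX0 AXS; rewrite -[X in _ + X]rev_sum addrC.
have [b1 b2 b3 Ba] := expand B_ge0.
apply: (two_pass_le (Z := fun k => Y (N - k)%N) a_ge0) => //.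
- by rewrite subn0; have := leY (leqnn N); have := le_piF; have := B_ge0; have := le_rho; lra.
- move=> k kN; have jN : (N - k.+1 < N)%N by rewrite ltn_subrL/= (leq_ltn_trans _ kN).
  have := leY (ltnW jN); have := AYS _ jN; have -> : (N - k.+1).+1 = (N - k)%N by rewrite subnSK.
  have := le_pi jN; have := B_ge0; have := le_rho.
  have [y1 y2 y3 ya] := expand (Y_ge0 (N - k)%N); have := Y_ge0 (N - k)%N.
  rewrite [a * (_ + _)]mulrDr ya Ba; lra.
move=> z hz'.
have hz k : (k <= N)%N -> Y k <= z by move=> kN; have := hz' _ (leq_subr k N); rewrite subKn.
have z0 := le_trans (Y_ge0 0%N) (hz 0%N (leq0n N)).
have [z1 z2 z3 za] := expand z0.
split=> [|k kN].
  have := leX (leq0n N); have := ler_wpM2l L2_ge0 (hz 0%N (leq0n N)).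
  have := B_ge0; have := le_rho; rewrite [a * (_ + _)]mulrDr za Ba; lra.
have := leX kN; have := AXS _ kN; have := ler_wpM2l L2_ge0 (hz _ kN).
have [x1 x2 x3 xa] := expand (X_ge0 k); have := X_ge0 k.
have := B_ge0; have := le_rho; rewrite (mulrDr a (X _)) (mulrDr a z B) za Ba xa (mulrDr L2) (mulrCA L2 2); lra.
Qed.

End TwoPass.

(** * The Euclidean norm *)

Section Euclidean.
Context {R : realType}.

Lemma enorm_ge0 p q (A : 'M[R]_(p, q)) : 0 <= enorm A.
Proof. exact: sqrtr_ge0. Qed.

Lemma enorm_sqrE p q (A : 'M[R]_(p, q)) :
  enorm A ^+ 2 = \sum_(i < p) \sum_(j < q) A i j ^+ 2.
Proof.
by rewrite sqr_sqrtr// sumr_ge0// => i _; apply: sumr_ge0 => j _; exact: sqr_ge0.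
Qed.

Section dot.
Variable n : nat.
Implicit Types u v x : 'cV[R]_n.

Lemma enorm_sqr u : enorm u ^+ 2 = dot u u.
Proof. by rewrite enorm_sqrE; apply: eq_bigr => i _; rewrite big_ord1 expr2. Qed.

Lemma dotC u v : dot u v = dot v u.
Proof. by apply: eq_bigr => i _; rewrite mulrC. Qed.

Lemma dotDl u v x : dot (u + v) x = dot u x + dot v x.
Proof. by rewrite /dot -big_split; apply: eq_bigr => i _; rewrite mxE mulrDl. Qed.

Lemma dotZl c u v : dot (c *: u) v = c * dot u v.
Proof. by rewrite /dot mulr_sumr; apply: eq_bigr => i _; rewrite mxE mulrA. Qed.

Lemma dotNl u v : dot (- u) v = - dot u v.
Proof. by rewrite -scaleN1r dotZl mulN1r. Qed.

Lemma dotDr u v x : dot x (u + v) = dot x u + dot x v.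
Proof. by rewrite dotC dotDl !(dotC x). Qed.

Lemma dotZr c u v : dot v (c *: u) = c * dot v u.
Proof. by rewrite dotC dotZl dotC. Qed.

Lemma dotNr u v : dot v (- u) = - dot v u.
Proof. by rewrite dotC dotNl dotC. Qed.

Lemma dot_ge0 u : 0 <= dot u u.
Proof. by rewrite -enorm_sqr sqr_ge0. Qed.

Lemma dotE u v : dot u v = \sum_i u i 0 * v i 0. Proof. by []. Qed.

Lemma dot_young e u v : 0 < e -> dot u v <= e * dot u u + e^-1 * dot v v.
Proof.
move=> e0; have i0 : 0 < e^-1 by rewrite invr_gt0.
have h : 0 <= dot (e *: u - v) (e *: u - v) := dot_ge0 _.
have := mulr_ge0 (ltW i0) h.
rewrite dotDl !dotDr !dotNl !dotNr !dotZl !dotZr (dotC v u).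
have -> : e^-1 * (e * (e * dot u u) - e * dot u v + (- (e * dot u v) - - dot v v))
   = (e^-1 * e) * (e * dot u u) - 2 * (e^-1 * e) * dot u v + e^-1 * dot v v by ring.
rewrite mulVf ?gt_eqF//.
have := mulr_ge0 (ltW e0) (dot_ge0 u); have := mulr_ge0 (ltW i0) (dot_ge0 v).
lra.
Qed.

Lemma dot_sqrD_le u v : dot (u + v) (u + v) <= 2 * dot u u + 2 * dot v v.
Proof.
have := dot_ge0 (u - v).
rewrite !(dotDl, dotDr, dotNl, dotNr) (dotC v u); lra.
Qed.

End dot.

Lemma enorm_le_dot n m (u : 'cV[R]_n) (v : 'cV[R]_m) c : 0 <= c ->
  enorm u <= c * enorm v -> dot u u <= c ^+ 2 * dot v v.
Proof.
move=> c0 h; rewrite -(enorm_sqr u) -(enorm_sqr v) -exprMn ler_sqr// nnegrE ?enorm_ge0//.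
by rewrite mulr_ge0// enorm_ge0.
Qed.

Lemma enorm3_sqr n (t : vec3 R n) :
  enorm3 t ^+ 2 = dot t.1.1 t.1.1 + dot t.1.2 t.1.2 + dot t.2 t.2.
Proof.
by rewrite sqr_sqrtr ?enorm_sqr//; rewrite !addr_ge0// -?enorm_sqr ?sqr_ge0.
Qed.

Lemma enorm3_ge0 n (t : vec3 R n) : 0 <= enorm3 t.
Proof. exact: sqrtr_ge0. Qed.

Lemma sqrt_sum_sqr_le (I : finType) (f : I -> R) :
  Num.sqrt (\sum_i f i ^+ 2) <= \sum_i `|f i|.
Proof.
have s0 : 0 <= \sum_i `|f i| by apply: sumr_ge0.
rewrite -(ger0_norm s0) -sqrtr_sqr ler_wsqrtr// expr2 mulr_suml.
apply: ler_sum => i _; rewrite -real_normK ?num_real// expr2 ler_wpM2l//.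
by rewrite (bigD1 i)//= lerDl; apply: sumr_ge0.
Qed.

End Euclidean.

(** * Square-integrable random vectors *)

Section SquareIntegrableVectors.
Context {R : realType} {d : measure_display} {Omega : measurableType d}.
Variable P : probability Omega R.
Hypothesis cP : measure_is_complete P.
Implicit Types G : set (set Omega).

Lemma L2s_le (f g : Omega -> R) : measurable_fun setT f -> L2s P g ->
  {ae P, forall w, `|f w| <= g w} -> L2s P f.
Proof.
move=> mf [mg lg] fg; split => //.
pose h w := Order.min (f w ^+ 2) (g w ^+ 2).
apply: (@L1_ae _ _ _ P h); first exact: measurable_funX.
  apply: filterS fg => w fg; rewrite /h min_l//.
  by rewrite -[X in X <= _]real_normK ?num_real// lerXn2r ?nnegrE// (le_trans _ fg).
apply: le_L1 lg.
  by apply: measurable_minr; exact: measurable_funX.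
by move=> w; rewrite ger0_norm ?ge_min ?lexx ?orbT// le_min !sqr_ge0.
Qed.

Lemma L2s_abs f : L2s P f -> L2s P (fun w => `|f w|).
Proof.
move=> [mf lf]; split; first exact: measurableT_comp.
by under eq_fun do rewrite real_normK ?num_real//.
Qed.

Lemma L2s_sum (I : finType) (f : I -> Omega -> R) :
  (forall i, L2s P (f i)) -> L2s P (fun w => \sum_i f i w).
Proof.
move=> lf; elim: (index_enum I) => [|i s IH].
  by under eq_fun do rewrite big_nil; exact: L2s_cst.
by under eq_fun do rewrite big_cons; exact: L2sD.
Qed.

Lemma aemeas_measurable G f : <<s G >> `<=` measurable -> aemeas P G f ->
  measurable_fun setT f.
Proof.
move=> subG [g mg fg]; apply/measurable_EFinP.
apply: (ae_measurable_fun cP (f := EFin \o g)).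
  by apply: filterS fg => w /= -> _.
exact/measurable_EFinP/(rv_measurable_fun subG).
Qed.

Section vectors.
Variable n : nat.
Implicit Types X Y Z : Omega -> 'cV[R]_n.

Definition L2v G X := forall i, L2a P G (fun w => X w i 0).

Definition ip X Y : R := Ex P (fun w => dot (X w) (Y w)).

Definition nsq X : R := ip X X.

Lemma ip_def X Y : ip X Y = Ex P (fun w => dot (X w) (Y w)). Proof. by []. Qed.

Lemma nsq_def X : nsq X = Ex P (fun w => dot (X w) (X w)). Proof. by []. Qed.

Lemma L2v_cst G (u : 'cV[R]_n) : L2v G (fun=> u).
Proof. by move=> i; exact: L2a_cst. Qed.

Lemma L2vD G X Y : L2v G X -> L2v G Y -> L2v G (fun w => X w + Y w).
Proof.
move=> lX lY i; under eq_fun do rewrite mxE; exact: L2aD.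
Qed.

Lemma L2vZ G c X : L2v G X -> L2v G (fun w => c *: X w).
Proof. by move=> lX i; under eq_fun do rewrite mxE; exact: L2aZ. Qed.

Lemma L2vN G X : L2v G X -> L2v G (fun w => - X w).
Proof. by move=> lX i; under eq_fun do rewrite mxE; exact: L2aN. Qed.

Lemma L2vB G X Y : L2v G X -> L2v G Y -> L2v G (fun w => X w - Y w).
Proof. by move=> lX lY; apply: L2vD => //; exact: L2vN. Qed.

Lemma L2v_sub G G' X : <<s G >> `<=` <<s G' >> -> L2v G X -> L2v G' X.
Proof. by move=> GG' lX i; exact: L2a_sub (lX i). Qed.

Lemma L1_dot G G' X Y : L2v G X -> L2v G' Y -> L1 P (fun w => dot (X w) (Y w)).
Proof.
move=> lX lY; apply: L1_sum => i.
by apply: L2s_mul; [case: (lX i)|case: (lY i)].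
Qed.

Lemma ipE G G' X Y : L2v G X -> L2v G' Y ->
  ip X Y = \sum_i Ex P (fun w => X w i 0 * Y w i 0).
Proof.
move=> lX lY; rewrite /ip /dot Ex_sum// => i.
by apply: L2s_mul; [case: (lX i)|case: (lY i)].
Qed.

Lemma nsq_ge0 X : 0 <= nsq X.
Proof. by apply: Ex_ge0 => w; exact: dot_ge0. Qed.

Lemma nsq_ae X Y G G' : L2v G X -> L2v G' Y -> {ae P, forall w, X w = Y w} ->
  nsq X = nsq Y.
Proof.
move=> lX lY XY; apply: eq_Ex_ae; [exact: (L1_dot lX lX)|exact: (L1_dot lY lY)|].
by apply: filterS XY => w ->.
Qed.

Lemma nsq_eq0 G X : L2v G X -> nsq X <= 0 -> {ae P, forall w, X w = 0}.
Proof.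
move=> lX X0; have := Ex_eq0_ae (L1_dot lX lX) (fun w => dot_ge0 (X w)) X0.
apply: filterS => w /eqP.
rewrite dotE psumr_eq0; last by move=> i _; rewrite -expr2 sqr_ge0.
move=> /allP Xw; apply/matrixP => i j; rewrite ord1 mxE.
by have /eqP/eqP := Xw i (mem_index_enum i); rewrite mulf_eq0 orbb => /eqP.
Qed.

Lemma nsqD_le G G' X Y : L2v G X -> L2v G' Y ->
  nsq (fun w => X w + Y w) <= 2 * nsq X + 2 * nsq Y.
Proof.
move=> lX lY; have lXX := L1_dot lX lX; have lYY := L1_dot lY lY.
rewrite /nsq /ip -!ExZ// -ExD; [|exact: L1Z..].
apply: le_Ex; [|by apply: L1D; exact: L1Z|apply: aeW => w; exact: dot_sqrD_le].
have lXY := L1_dot lX lY.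
have -> : (fun w => dot (X w + Y w) (X w + Y w)) =
  (fun w => dot (X w) (X w) + (2 * dot (X w) (Y w) + dot (Y w) (Y w))).
  by apply/funext => w; rewrite !(dotDl, dotDr) (dotC (Y w) (X w)); ring.
by apply: L1D => //; apply: L1D => //; exact: L1Z.
Qed.

Lemma nsqN X : nsq (fun w => - X w) = nsq X.
Proof. by congr (Ex P _); apply/funext => w; rewrite dotNl dotNr opprK. Qed.

Lemma nsqZ G c X : L2v G X -> nsq (fun w => c *: X w) = c ^+ 2 * nsq X.
Proof.
move=> lX; rewrite /nsq /ip -ExZ; last exact: (L1_dot lX lX).
by congr (Ex P _); apply/funext => w; rewrite dotZl dotZr mulrA.
Qed.

Lemma ip_young G G' e X Y : 0 < e -> L2v G X -> L2v G' Y ->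
  ip X Y <= e * nsq X + e^-1 * nsq Y.
Proof.
move=> e0 lX lY; have lXX := L1_dot lX lX; have lYY := L1_dot lY lY.
rewrite /nsq /ip -!ExZ// -ExD; [|exact: L1Z..].
apply: le_Ex; [exact: (L1_dot lX lY)|by apply: L1D; exact: L1Z|].
by apply: aeW => w; exact: dot_young.
Qed.

Lemma ipDl G G' G'' X Y Z : L2v G X -> L2v G' Y -> L2v G'' Z ->
  ip (fun w => X w + Y w) Z = ip X Z + ip Y Z.
Proof.
move=> lX lY lZ; rewrite /ip -ExD; [|exact: (L1_dot lX lZ)|exact: (L1_dot lY lZ)].
by congr (Ex P _); apply/funext => w; rewrite dotDl.
Qed.

Lemma ipC X Y : ip X Y = ip Y X.
Proof. by congr (Ex P _); apply/funext => w; rewrite dotC. Qed.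

Lemma ipZl G G' a X Y : L2v G X -> L2v G' Y ->
  ip (fun w => a *: X w) Y = a * ip X Y.
Proof.
move=> lX lY; rewrite /ip -ExZ; last exact: (L1_dot lX lY).
by congr (Ex P _); apply/funext => w; rewrite dotZl.
Qed.

Lemma ipNl G G' X Y : L2v G X -> L2v G' Y -> ip (fun w => - X w) Y = - ip X Y.
Proof.
move=> lX lY; rewrite -[RHS]mulN1r -(ipZl _ lX lY).
by congr (ip _ _); apply/funext => w; rewrite scaleN1r.
Qed.

(** Componentwise version of E[W Y | G] for a scalar weight W. *)
Definition vcondE G (W : Omega -> R) Y Z :=
  forall i, is_condE P G (fun w => W w * Y w i 0) (fun w => Z w i 0).

Lemma vcondEB G W Y Y' Z Z' : <<s G >> `<=` measurable ->
  vcondE G W Y Z -> vcondE G W Y' Z' ->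
  vcondE G W (fun w => Y w - Y' w) (fun w => Z w - Z' w).
Proof.
move=> subG YZ YZ' i; have := is_condEB subG (YZ i) (YZ' i).
congr is_condE; apply/funext => w; rewrite !mxE//.
by rewrite mulrBr.
Qed.

Section weight.
Variables (G G' : set (set Omega)) (W : Omega -> R).
Hypothesis subG : <<s G >> `<=` measurable.
Hypothesis mW : measurable_fun setT W.
Hypothesis W1 : is_condE P G (fun w => W w ^+ 2) (fun=> 1).

Lemma vcondE_L2 Y Z : L2v G' Y -> vcondE G W Y Z -> L2v G Z /\ nsq Z <= nsq Y.
Proof.
move=> lY YZ.
have h i : L2a P G (fun w => Z w i 0) /\
    Ex P (fun w => Z w i 0 ^+ 2) <= Ex P (fun w => Y w i 0 ^+ 2).
  by apply: (weight_condE_L2 subG mW W1 _ (YZ i)); case: (lY i).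
have lZ : L2v G Z by move=> i; case: (h i).
split => //; rewrite /nsq (ipE lZ lZ) (ipE lY lY).
by apply: ler_sum => i _; case: (h i).
Qed.

Lemma vcondE_adjoint X Y Z : L2v G X -> L2v G' Y -> vcondE G W Y Z ->
  ip X Z = ip (fun w => W w *: X w) Y.
Proof.
move=> lX lY YZ; have [lZ _] := vcondE_L2 lY YZ.
rewrite (ipE lX lZ) /ip /dot Ex_sum.
  apply: eq_bigr => i _.
  rewrite (_ : (fun w => (W w *: X w) i 0 * Y w i 0) =
    (fun w => (W w * X w i 0) * Y w i 0)); last by apply/funext => w; rewrite mxE.
  by apply: (weight_adjoint subG mW W1 (lX i) _ (YZ i)); case: (lY i).
move=> i; under eq_fun do rewrite mxE; apply: L2s_mul; last by case: (lY i).
by have [] := weight_L2 subG mW W1 (lX i).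
Qed.

Lemma vweight_L2 X (G1 : set (set Omega)) : <<s G >> `<=` <<s G1 >> ->
  rv_measurable G1 W -> L2v G X ->
  L2v G1 (fun w => W w *: X w) /\ nsq (fun w => W w *: X w) <= nsq X.
Proof.
move=> GG1 mG1W lX.
have lWX : L2v G1 (fun w => W w *: X w).
  move=> i; under eq_fun do rewrite mxE; split.
    by have [] := weight_L2 subG mW W1 (lX i).
  have [_ [g mg gX]] := lX i; exists (fun w => W w * g w).
    by apply: measurable_funM => //; exact: rv_measurable_sub mg.
  by apply: filterS gX => w ->.
split => //; rewrite /nsq (ipE lWX lWX) (ipE lX lX).
apply: ler_sum => i _; under eq_fun do rewrite mxE.
by have [] := weight_L2 subG mW W1 (lX i).
Qed.

Lemma vcondE_exists Y : L2v G' Y ->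
  vcondE G W Y (mx_condE P G (fun w => W w *: Y w)).
Proof.
move=> lY i; have -> : (fun w => mx_condE P G (fun w => W w *: Y w) w i 0) =
    condE P G (fun w => W w * Y w i 0).
  apply/funext => w; rewrite mxE; congr condE; apply/funext => w'.
  by rewrite mxE.
apply: condE_spec => //; apply: (weight_condE_exists mW W1).
by case: (lY i).
Qed.

Lemma mx_condE_ae Y Y' : L2v G' Y -> L2v G' Y' -> {ae P, forall w, Y w = Y' w} ->
  mx_condE P G (fun w => W w *: Y w) = mx_condE P G (fun w => W w *: Y' w).
Proof.
move=> lY lY' YY'; apply/funext => w; apply/matrixP => i j; rewrite ord1 !mxE.
have -> : (fun w => (W w *: Y w) i 0) = (fun w => W w * Y w i 0).
  by apply/funext => w'; rewrite mxE.
have -> : (fun w => (W w *: Y' w) i 0) = (fun w => W w * Y' w i 0).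
  by apply/funext => w'; rewrite mxE.
rewrite (@condE_eq_ae _ _ _ P G subG _ (fun w => W w * Y' w i 0))//.
- by apply: (weight_condE_exists mW W1); case: (lY i).
- by apply: (weight_condE_exists mW W1); case: (lY' i).
- by apply: filterS YY' => w' ->.
Qed.

End weight.

End vectors.

(** The space V of arguments is R^n or R^(3n), given by coordinates co with
    inverse de. Measurability of the composite comes from the approximation on
    grids, square integrability from the linear growth of h. *)
Section composition.
Variables (G : set (set Omega)) (n : nat) (V : Type) (I : finType).
Variables (co : V -> I -> R) (de : (I -> R) -> V) (dist : V -> V -> R).
Hypothesis subG : <<s G >> `<=` measurable.
Hypothesis deK : cancel co de.
Hypothesis coK : forall f i, co (de f) i = f i.
Hypothesis distE : forall v v',
  dist v v' = Num.sqrt (\sum_i (co v i - co v' i) ^+ 2).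

Lemma L2v_comp (h : Omega -> V -> 'cV[R]_n) (L : R) (X : Omega -> V) : 0 <= L ->
  (forall v, L2 P G (fun w => h w v)) ->
  {ae P, forall w, forall v v', enorm (h w v - h w v') <= L * dist v v'} ->
  (forall i, L2a P G (fun w => co (X w) i)) ->
  L2v G (fun w => h w (X w)).
Proof.
move=> L0 lh hL lX i.
have coord (u : 'cV[R]_n) : `|u i 0| <= enorm u :> R.
  rewrite -sqrtr_sqr ler_wsqrtr// (bigD1 i)//= big_ord1 lerDl.
  by apply: sumr_ge0 => j _; rewrite big_ord1 sqr_ge0.
have hLi : {ae P, forall w, forall v v',
    `|h w v i 0 - h w v' i 0| <= L * \sum_i `|co v i - co v' i|}.
  apply: filterS hL => w hL v v'.
  have -> : h w v i 0 - h w v' i 0 = (h w v - h w v') i 0 by rewrite !mxE.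
  apply: (le_trans (coord _)); apply: (le_trans (hL _ _)).
  by rewrite ler_wpM2l// distE; exact: sqrt_sum_sqr_le.
have am : aemeas P G (fun w => h w (X w) i 0).
  have := @aemeas_comp _ _ _ P G I (fun w f => h w (de f) i 0) L
    (fun j w => co (X w) j).
  have -> : (fun w => h w (de (co (X w))) i 0) = (fun w => h w (X w) i 0).
    by apply/funext => w; rewrite deK.
  apply.
  - by move=> f; case: (lh (de f)) => + _; apply.
  - apply: filterS hLi => w hLi f f'; apply: (le_trans (hLi _ _)).
    by under eq_bigr do rewrite !coK.
  - by move=> j; case: (lX j).
split => //.
pose v0 := de (fun=> 0).
have lv0 : L2s P (fun w => h w v0 i 0).
  have [mh Eh] := lh v0.
  have mhi : measurable_fun setT (fun w => h w v0 i 0) := rv_measurable_fun subG (mh i 0).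
  have mhj j : measurable_fun setT (fun w => h w v0 j 0) := rv_measurable_fun subG (mh j 0).
  split => //; apply: (@le_L1 _ _ _ P _ (fun w => enorm (h w v0) ^+ 2)).
  - exact: measurable_funX.
  - by move=> w; rewrite normrX lerXn2r ?nnegrE ?enorm_ge0.
  - apply/integrableP; split.
      apply/measurable_EFinP; under eq_fun do rewrite enorm_sqr /dot.
      by apply: measurable_sum => j; exact: measurable_funM.
    move: Eh; rewrite unlock; apply: le_lt_trans.
    by under eq_integral do rewrite /= ger0_norm ?sqr_ge0//.
apply: (@L2s_le _ (fun w => `|h w v0 i 0| + L * \sum_j `|co (X w) j|)).
- exact: aemeas_measurable am.
- apply: L2sD; first exact: L2s_abs.
  by apply/L2sZ/L2s_sum => j; apply: L2s_abs; case: (lX j).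
- apply: filterS hLi => w /(_ (X w) v0) hLi.
  rewrite -[h w (X w) i 0](subrK (h w v0 i 0)) (le_trans (ler_normD _ _))//.
  rewrite addrC lerD2l (le_trans hLi)// ler_wpM2l//.
  by apply: ler_sum => j _; rewrite coK subr0.
Qed.

End composition.

End SquareIntegrableVectors.

(** * The filtration of the noise *)

Section Filtration.
Context {R : realType} {d : measure_display} {Omega : measurableType d}.
Variables (P : probability Omega R) (N : nat) (w : nat -> Omega -> R).
Hypothesis mart : martingale_difference P N w.

Lemma noise_measurable k : (k < N)%N -> measurable_fun setT (w k).
Proof. by move=> /mart[[/L1_meas]]. Qed.

Lemma filt_measurable k : (k <= N)%N -> <<s filt w k >> `<=` measurable.
Proof.
move=> kN; apply: smallest_sub; first exact: sigma_algebra_measurable.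
move=> A [i /= ik [B mB <-]].
exact: noise_measurable (leq_trans ik kN) measurableT B mB.
Qed.

Lemma filt_le k l : (k <= l)%N -> <<s filt w k >> `<=` <<s filt w l >>.
Proof.
move=> kl; apply: smallest_sub; first exact: smallest_sigma_algebra.
move=> A [i /= ik Ai]; apply: sub_sigma_algebra.
by exists i => //=; exact: leq_trans kl.
Qed.

Lemma noise_adapted k : rv_measurable (filt w k.+1) (w k).
Proof.
move=> _ B mB; apply: sub_sigma_algebra; exists k => //=.
by exists B.
Qed.

Lemma weight_noise k : (k < N)%N ->
  is_condE P (filt w k) (fun omega => w k omega ^+ 2) (fun=> 1).
Proof. by move=> /mart[]. Qed.

Lemma weight_one k :
  is_condE P (filt w k) (fun omega => (fun=> 1 : R) omega ^+ 2) (fun=> 1).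
Proof.
have -> : (fun omega => (fun=> 1 : R) omega ^+ 2) = (fun=> 1 : R) :> (Omega -> R).
  by apply/funext => omega; rewrite expr1n.
by split => //; [exact: L1_cst|exact: L1_cst|exact: measurable_cst].
Qed.

End Filtration.

Section Integrability.
Context {R : realType} {d : measure_display} {Omega : measurableType d}.
Variable P : probability Omega R.

Lemma measurable_enorm_sqr p q (X : Omega -> 'M[R]_(p, q)) :
  (forall i j, measurable_fun setT (fun w => X w i j)) ->
  measurable_fun setT (fun w => enorm (X w) ^+ 2).
Proof.
move=> mX; under eq_fun do rewrite enorm_sqrE.
by apply: measurable_sum => i; apply: measurable_sum => j; exact: measurable_funX.
Qed.

Lemma expectationE (f : Omega -> R) : L1 P f -> ('E_P[f] = (Ex P f)%:E)%E.
Proof. by move=> lf; rewrite unlock ExE. Qed.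

Lemma expectation_lty (f : Omega -> R) : measurable_fun setT f ->
  (forall w, 0 <= f w) -> ('E_P[f] < +oo)%E -> L1 P f.
Proof.
move=> mf f0; rewrite unlock => Ef; apply/integrableP; split.
  exact/measurable_EFinP.
by rewrite (eq_integral (EFin \o f)) => [//|w _] /=; rewrite ger0_norm.
Qed.

Lemma L2P G n (X : Omega -> 'cV[R]_n) : <<s G >> `<=` measurable ->
  L2 P G X <-> mx_measurable G X /\ L2v P G X.
Proof.
move=> subG; split=> [[mX EX]|[mX lX]]; split => //.
- move=> i.
  have mXi j : measurable_fun setT (fun w => X w j 0) := rv_measurable_fun subG (mX j 0).
  split; last by exists (fun w => X w i 0) => //; exact: aeW.
  split => //; apply: (@le_L1 _ _ _ P _ (fun w => enorm (X w) ^+ 2)).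
  + exact: measurable_funX.
  + move=> w; rewrite ger0_norm ?sqr_ge0// enorm_sqr dotE (bigD1 i)//= -expr2 lerDl.
    by apply: sumr_ge0 => j _; rewrite -expr2 sqr_ge0.
  + apply: expectation_lty EX; last by move=> w; rewrite sqr_ge0.
    by apply: measurable_enorm_sqr => j k; rewrite ord1.
- rewrite expectationE ?ltry//.
  by under eq_fun do rewrite enorm_sqr; exact: (L1_dot lX lX).
Qed.

Lemma L2procP (w : nat -> Omega -> R) S n (h : nat -> Omega -> 'cV[R]_n) :
  (forall k, (k < S)%N -> <<s filt w k >> `<=` measurable) ->
  L2proc P w S h <-> (forall k, (k < S)%N -> L2 P (filt w k) (h k)).
Proof.
move=> subG; split=> [[mh Eh] k kS|lh].
  split; first exact: mh.
  have mhk i : (i < S)%N -> measurable_fun setT (fun w => enorm (h i w) ^+ 2).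
    move=> iS; apply: measurable_enorm_sqr => a b.
    exact: rv_measurable_fun (subG _ iS) _ (mh i iS a b).
  have lS : L1 P (fun w => \sum_(k < S) enorm (h k w) ^+ 2).
    apply: expectation_lty => //.
      by apply: measurable_sum => i; exact: mhk.
    by move=> w'; apply: sumr_ge0 => i _; rewrite sqr_ge0.
  rewrite expectationE ?ltry//; apply: le_L1 lS; first exact: mhk.
  move=> w'; rewrite ger0_norm ?sqr_ge0// (bigD1 (Ordinal kS))//= lerDl.
  by apply: sumr_ge0 => i _; rewrite sqr_ge0.
split; first by move=> k /lh[].
rewrite expectationE ?ltry//; apply: L1_sum => -[i iS] /=.
have /(L2P _ (subG _ iS))[_ lhi] := lh i iS.
by under eq_fun do rewrite enorm_sqr; exact: (L1_dot lhi lhi).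
Qed.

End Integrability.

Section Coordinates.
Context {R : realType}.
Variable n : nat.

Definition vec3_coord (t : vec3 R n) (i : 'I_n + 'I_n + 'I_n) : R :=
  match i with
  | inl (inl j) => t.1.1 j 0
  | inl (inr j) => t.1.2 j 0
  | inr j => t.2 j 0
  end.

Definition vec3_of_coord (f : 'I_n + 'I_n + 'I_n -> R) : vec3 R n :=
  (\col_j f (inl (inl j)), \col_j f (inl (inr j)), \col_j f (inr j)).

Lemma vec3_of_coordK : cancel vec3_coord vec3_of_coord.
Proof.
by move=> [[x y] z]; congr (_, _, _); apply/matrixP => i j; rewrite !mxE ord1.
Qed.

Lemma vec3_coordK f i : vec3_coord (vec3_of_coord f) i = f i.
Proof. by case: i => [[j|j]|j]; rewrite /= mxE. Qed.

Lemma enorm3_coord t t' : enorm3 (t - t') =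
  Num.sqrt (\sum_i (vec3_coord t i - vec3_coord t' i) ^+ 2).
Proof.
rewrite /enorm3 !enorm_sqr; congr Num.sqrt; rewrite big_sumType/= big_sumType/=.
by congr (_ + _ + _); apply: eq_bigr => i _; rewrite !mxE expr2.
Qed.

Lemma enorm_coord (x x' : 'cV[R]_n) : enorm (x - x') =
  Num.sqrt (\sum_i (x i 0 - x' i 0) ^+ 2).
Proof.
rewrite /enorm; congr Num.sqrt; apply: eq_bigr => i _.
by rewrite big_ord1 !mxE.
Qed.

End Coordinates.

(** * Monotonicity gaps *)

(** What the domination and monotonicity conditions say about one pair of
    arguments once the matrices are eliminated: a coefficient increment is
    controlled by the monotonicity gap, up to the variable in which the
    coefficient is only Lipschitz. Unlike the original conditions, these are
    inherited by tau c for every tau in [0, 1], with the same constants. *)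
Section Structure.
Context {R : realType} {d : measure_display} {Omega : measurableType d}.
Variables (P : probability Omega R) (N n : nat) (c : coeffs R Omega n).
Variables (K1 K2 : R).

Let dLam y y' := cLambda c y - cLambda c y'.
Let dPhi omega x x' := cPhi c omega x - cPhi c omega x'.
Let df k omega t t' := cf c k.+1 omega t - cf c k.+1 omega t'.
Let db k omega t t' := cb c k omega t - cb c k omega t'.
Let ds k omega t t' := cs c k omega t - cs c k omega t'.

Definition forward_gap : Prop :=
  [/\ forall y y', dot (dLam y y') (dLam y y') <= - K2 * dot (dLam y y') (y - y'),
      {ae P, forall omega, forall x x', 0 <= dot (dPhi omega x x') (x - x')}
    & forall k, (k < N)%N -> {ae P, forall omega, forall t t',
        Gamma_pairing c k omega t t' <= 0 /\
        dot (db k omega t t') (db k omega t t') +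
        dot (ds k omega t t') (ds k omega t t') <=
          K1 * dot (t - t').1.1 (t - t').1.1 - K2 * Gamma_pairing c k omega t t'}].

Definition backward_gap : Prop :=
  [/\ forall y y', dot (dLam y y') (y - y') <= 0,
      {ae P, forall omega, forall x x',
        dot (dPhi omega x x') (dPhi omega x x') <= K2 * dot (dPhi omega x x') (x - x')}
    & forall k, (k < N)%N -> {ae P, forall omega, forall t t',
        Gamma_pairing c k omega t t' <= 0 /\
        dot (df k omega t t') (df k omega t t') <=
          K1 * (dot (t - t').1.2 (t - t').1.2 + dot (t - t').2 (t - t').2)
          - K2 * Gamma_pairing c k omega t t'}].

(** Suppose mu > 0 and write p for the vector B y + C z formed from the
    increments. Monotonicity gives mu |p|^2 <= - g, where g is the pairing, and
    domination bounds the increments of b and sigma in (y, z) by |p| / mu,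
    hence their squares by mu^-3 (- g). The increments in x are bounded by the
    Lipschitz condition. The case v > 0 is symmetric. As 0^-1 = 0, the bound on
    K2 only involves the parameter that is positive. *)
Lemma gap_of_H1_H2 w L m mbar mtil mu v cM cG cA cB cC
    (M : 'M[R]_(mbar, n)) (G : Omega -> 'M[R]_(mtil, n))
    (A B C : nat -> Omega -> 'M[R]_(m, n)) :
  H1 P N w L c -> H2 P N w mu v cM cG cA cB cC M G A B C c ->
  4 * L ^+ 2 <= K1 -> 4 * (`|mu^-1| ^+ 3 + `|v^-1| ^+ 3) <= K2 ->
  forward_gap \/ backward_gap.
Proof.
move=> [_ [L0 _ _ HL]] [_ cases [domL domP domf domb] [monL monP monG]] hK1 hK2.
have inv0 (a : R) : 0 < a -> 0 < a^-1 by rewrite invr_gt0.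
have L2 : 0 <= L ^+ 2 by rewrite sqr_ge0.
have xsplit (x y z : 'cV[R]_n) : (x - z) = (x - y) + (y - z) by rewrite addrA subrK.
case: cases => [[mu0 v0]|[mu0 v0]].
  left; have i0 := inv0 _ mu0; have imu : mu^-1 * mu = 1 by rewrite mulVf ?gt_eqF.
  have hK2' : 4 * mu^-1 ^+ 3 <= K2.
    by move: hK2; rewrite v0 invr0 normr0 expr0n/= addr0 (ger0_norm (ltW i0)).
  have i3 : 0 <= mu^-1 ^+ 3 by rewrite exprn_ge0 ?ltW.
  (* from mu |p|^2 <= - g follows mu^-2 |p|^2 <= mu^-3 (- g) *)
  have gapE q g : g <= - (mu * q) -> mu^-1 ^+ 2 * q <= mu^-1 ^+ 3 * - g.
    move=> h; have -> : mu^-1 ^+ 2 * q = mu^-1 ^+ 3 * (mu * q).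
      by rewrite -[in LHS](mul1r q) -imu; ring.
    by rewrite ler_wpM2l//; lra.
  split.
  - move=> y y'; have := enorm_le_dot (ltW i0) (domL mu0 y y').
    move/le_trans; apply; have := monL y y'; rewrite enorm_sqr mulNr => h.
    apply: (le_trans (gapE _ _ h)).
    have g0 : 0 <= - dot (dLam y y') (y - y').
      have := dot_ge0 (M *m (y - y')); rewrite /dLam => ?; nra.
    rewrite mulNr -mulrN ler_wpM2r//; lra.
  - apply: filterS monP => omega monP x x'; apply: le_trans (monP x x').
    by rewrite v0 mul0r.
  - move=> k kN; apply: filterS3 (HL k kN) (domb mu0 k kN) (monG k kN).
    move=> omega {}HL {}domb {}monG [[x y] z] [[x' y'] z'].
    have := monG (x, y, z) (x', y', z').
    rewrite v0 oppr0 mul0r add0r enorm_sqr /=.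
    set g := Gamma_pairing _ _ _ _ _; set p := dot (B k omega *m (y - y') + C k omega *m (z - z')) _ => hg.
    have p0 : 0 <= p by exact: dot_ge0.
    have hg0 : 0 <= - g by nra.
    split; first by rewrite -oppr_ge0.
    have [hb hs _] := HL (x, y', z') (x', y', z').
    have [hb' hs'] := domb x y y' z z'.
    have e3 : enorm3 ((x, y', z') - (x', y', z')) = enorm (x - x').
      rewrite /enorm3 /= !subrr; have -> : enorm (0 : 'cV[R]_n) = 0.
        by rewrite /enorm big1 ?sqrtr0// => i _; rewrite big1// => j _; rewrite mxE expr0n.
      by rewrite expr0n !addr0 sqrtr_sqr ger0_norm ?enorm_ge0.
    rewrite e3 in hb hs.
    have gp := gapE _ _ hg.
    have part (h : vec3 R n -> 'cV[R]_n) :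
        enorm (h (x, y', z') - h (x', y', z')) <= L * enorm (x - x') ->
        enorm (h (x, y, z) - h (x, y', z')) <=
          mu^-1 * enorm (B k omega *m (y - y') + C k omega *m (z - z')) ->
        dot (h (x, y, z) - h (x', y', z')) (h (x, y, z) - h (x', y', z')) <=
          2 * (L ^+ 2 * dot (x - x') (x - x')) + 2 * (mu^-1 ^+ 3 * - g).
      move=> h1 h2; rewrite (xsplit _ (h (x, y', z'))) (le_trans (dot_sqrD_le _ _))//.
      have := enorm_le_dot (ltW L0) h1; have := enorm_le_dot (ltW i0) h2.
      rewrite -/p; lra.
    have := part _ hb hb'; have := part _ hs hs'; rewrite /db /ds.
    have := ler_wpM2r (dot_ge0 (x - x')) hK1.
    have := ler_wpM2r hg0 hK2'.
    lra.
right; have i0 := inv0 _ v0; have iv : v^-1 * v = 1 by rewrite mulVf ?gt_eqF.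
have hK2' : 4 * v^-1 ^+ 3 <= K2.
  by move: hK2; rewrite mu0 invr0 normr0 expr0n/= add0r (ger0_norm (ltW i0)).
have i3 : 0 <= v^-1 ^+ 3 by rewrite exprn_ge0 ?ltW.
have gapE q g : g <= - (v * q) -> v^-1 ^+ 2 * q <= v^-1 ^+ 3 * - g.
  move=> h; have -> : v^-1 ^+ 2 * q = v^-1 ^+ 3 * (v * q).
    by rewrite -[in LHS](mul1r q) -iv; ring.
  by rewrite ler_wpM2l//; lra.
split.
- by move=> y y'; apply: le_trans (monL y y') _; rewrite mu0 oppr0 mul0r.
- apply: filterS2 monP (domP v0) => omega {}monP {}domP x x'.
  have := enorm_le_dot (ltW i0) (domP x x'); move/le_trans; apply.
  have := monP x x'; rewrite enorm_sqr => h.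
  have h' : - dot (dPhi omega x x') (x - x') <= - (v * dot (G omega *m (x - x')) (G omega *m (x - x'))).
    by rewrite lerN2.
  apply: (le_trans (gapE _ _ h')); rewrite opprK ler_wpM2r//; last by lra.
  have := dot_ge0 (G omega *m (x - x')); rewrite /dPhi => ?; nra.
- move=> k kN; apply: filterS3 (HL k kN) (domf v0 k kN) (monG k kN).
  move=> omega {}HL {}domf {}monG [[x y] z] [[x' y'] z'].
  have := monG (x, y, z) (x', y', z').
  rewrite mu0 mul0r subr0 enorm_sqr mulNr /=.
  set g := Gamma_pairing _ _ _ _ _; set p := dot (A k omega *m (x - x')) _ => hg.
  have p0 : 0 <= p by exact: dot_ge0.
  have hg0 : 0 <= - g by nra.
  split; first by rewrite -oppr_ge0.
  have [_ _ hf] := HL (x', y, z) (x', y', z').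
  have hf' := domf x x' y z.
  have gp := gapE _ _ hg.
  have := enorm_le_dot (ltW i0) hf'; rewrite -/p => h1.
  have h2 : dot (cf c k.+1 omega (x', y, z) - cf c k.+1 omega (x', y', z'))
      (cf c k.+1 omega (x', y, z) - cf c k.+1 omega (x', y', z')) <=
      L ^+ 2 * (dot (y - y') (y - y') + dot (z - z') (z - z')).
    have h : 0 <= L * enorm3 ((x', y, z) - (x', y', z')).
      by rewrite mulr_ge0 ?enorm3_ge0 ?ltW.
    rewrite -enorm_sqr.
    have : enorm (cf c k.+1 omega (x', y, z) - cf c k.+1 omega (x', y', z')) ^+ 2 <=
        (L * enorm3 ((x', y, z) - (x', y', z'))) ^+ 2.
      by rewrite ler_sqr ?nnegrE ?enorm_ge0.
    rewrite exprMn enorm3_sqr /= subrr.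
    by have -> : dot (0 : 'cV[R]_n) 0 = 0; [rewrite dotE big1// => i _; rewrite mxE mul0r|rewrite add0r].
  rewrite /df (xsplit _ (cf c k.+1 omega (x', y, z))) (le_trans (dot_sqrD_le _ _))//.
  have := addr_ge0 (dot_ge0 (y - y')) (dot_ge0 (z - z')).
  set q := dot (y - y') _ + _ in h2 * => q0.
  have := ler_wpM2r q0 hK1; have := ler_wpM2r hg0 hK2'.
  have := mulr_ge0 L2 q0; have := mulr_ge0 i3 hg0.
  lra.
Qed.

End Structure.

(** * Adapted processes and the right-hand side of the equation *)

Section VectorCompleteness.
Context {R : realType} {d : measure_display} {Omega : measurableType d}.
Variables (P : probability Omega R) (G : set (set Omega)) (n : nat).
Hypothesis subG : <<s G >> `<=` measurable.

Lemma nsqBE G' (X Y : Omega -> 'cV[R]_n) : L2v P G X -> L2v P G' Y ->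
  nsq P (fun o => X o - Y o) = \sum_i Ex P (fun o => (X o i 0 - Y o i 0) ^+ 2).
Proof.
move=> lX lY; rewrite /nsq /ip /dot -Ex_sum.
  congr (Ex P _); apply/funext => o; apply: eq_bigr => i _.
  by rewrite !mxE expr2.
by move=> i; apply: (L2sB _ _).2; [case: (lX i)|case: (lY i)].
Qed.

Lemma L2v_complete (F : nat -> Omega -> 'cV[R]_n) (C : R) :
  (forall j, L2v P G (F j)) ->
  (forall j, nsq P (fun o => F j.+1 o - F j o) <= C * 4^-1 ^+ j) ->
  exists2 X, L2v P G X &
    forall j, nsq P (fun o => F j o - X o) <= (n%:R * (4 * C)) * 4^-1 ^+ j.
Proof.
move=> lF FC.
have /choice[f hf] : forall i, exists f, L2a P G f /\
    forall j, Ex P (fun o => (F j o i 0 - f o) ^+ 2) <= 4 * C * 4^-1 ^+ j.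
  move=> i; have [||f lf hf] := @L2a_complete _ _ _ P G subG (fun j o => F j o i 0) C.
  - by move=> j; exact: lF.
  - move=> j; apply: le_trans (FC j).
    rewrite (nsqBE (lF j.+1) (lF j)) (bigD1 i)//= lerDl.
    by apply: sumr_ge0 => k _; apply: Ex_ge0 => o; rewrite sqr_ge0.
  - by exists f.
have lX : L2v P G (fun o => \col_i f i o).
  by move=> i; under eq_fun do rewrite mxE; case: (hf i).
exists (fun o => \col_i f i o) => // j.
rewrite (nsqBE (lF j) lX) -mulrA mulr_natl -[X in _ *+ X]card_ord -sumr_const.
apply: ler_sum => i _; under eq_fun do rewrite mxE.
by case: (hf i).
Qed.

End VectorCompleteness.

Section Operator.
Context {R : realType} {d : measure_display} {Omega : measurableType d}.
Variables (P : probability Omega R) (N n : nat) (w : nat -> Omega -> R).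
Hypothesis cP : measure_is_complete P.
Hypothesis mart : martingale_difference P N w.

Definition process := ((nat -> Omega -> 'cV[R]_n) * (nat -> Omega -> 'cV[R]_n))%type.
Implicit Types u v : process.

(** Measurability is up to null sets here, as in L2v. *)
Definition adapted u := forall k, (k <= N)%N ->
  L2v P (filt w k) (u.1 k) /\ L2v P (filt w k) (u.2 k).

Definition sqnorm u : R :=
  \sum_(k < N.+1) nsq P (u.1 k) + \sum_(k < N.+1) nsq P (u.2 k).

Definition th u k := theta P w u.1 u.2 k.

(** The right-hand side of the equation, whose almost sure fixed points are the
    solutions. *)
Definition fbmap (c : coeffs R Omega n) u : process :=
  (fun k => if k is k'.+1
     then fun o => cb c k' o (th u k' o) + w k' o *: cs c k' o (th u k' o)
     else fun o => cLambda c (u.2 0%N o),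
   fun k => if k == N then fun o => cPhi c o (u.1 N o)
     else fun o => - cf c k.+1 o (th u k o)).

Let subF k : (k <= N)%N -> <<s filt w k >> `<=` measurable.
Proof. exact: (filt_measurable mart). Qed.

Lemma adaptedD u v : adapted u -> adapted v -> adapted (u + v).
Proof.
by move=> au av k kN; have [? ?] := au k kN; have [? ?] := av k kN;
  split; exact: L2vD.
Qed.

Lemma adaptedZ c u : adapted u -> adapted (c *: u).
Proof. by move=> au k kN; have [? ?] := au k kN; split; exact: L2vZ. Qed.

Lemma adaptedB u v : adapted u -> adapted v -> adapted (u - v).
Proof.
by move=> au av k kN; have [? ?] := au k kN; have [? ?] := av k kN;
  split; exact: L2vB.
Qed.

Lemma adapted0 : adapted 0.
Proof. by move=> k kN; split; exact: L2v_cst. Qed.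

Lemma sqnorm_ge0 u : 0 <= sqnorm u.
Proof. by rewrite addr_ge0// sumr_ge0// => i _; exact: nsq_ge0. Qed.

Lemma nsq_sqnorm u k l : (k <= N)%N -> (l <= N)%N ->
  nsq P (u.1 k) + nsq P (u.2 l) <= sqnorm u.
Proof.
rewrite -[(k <= N)%N]ltnS -[(l <= N)%N]ltnS => kN lN; apply: lerD.
  by rewrite (bigD1 (Ordinal kN))//= lerDl sumr_ge0// => i _; exact: nsq_ge0.
by rewrite (bigD1 (Ordinal lN))//= lerDl sumr_ge0// => i _; exact: nsq_ge0.
Qed.

Lemma sqnorm_le u (B : R) :
  (forall k, (k <= N)%N -> nsq P (u.1 k) <= B /\ nsq P (u.2 k) <= B) ->
  sqnorm u <= 2 * N.+1%:R * B.
Proof.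
move=> h; have e : \sum_(k < N.+1) B = N.+1%:R * B.
  by rewrite sumr_const card_ord mulr_natl.
have -> : 2 * N.+1%:R * B = N.+1%:R * B + N.+1%:R * B by ring.
by rewrite -!e; apply: lerD; apply: ler_sum => -[k kN] _; case: (h k kN).
Qed.

Lemma sqnormD u v : adapted u -> adapted v ->
  sqnorm (u + v) <= 2 * sqnorm u + 2 * sqnorm v.
Proof.
move=> au av; rewrite /sqnorm !mulrDr addrACA.
apply: lerD; rewrite !mulr_sumr -big_split/=; apply: ler_sum => -[k kN] _ /=;
  have [? ?] := au k kN; have [? ?] := av k kN; exact: nsqD_le.
Qed.

Lemma sqnormZ c u : adapted u -> sqnorm (c *: u) = c ^+ 2 * sqnorm u.
Proof.
move=> au; rewrite /sqnorm mulrDr !mulr_sumr.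
by congr (_ + _); apply: eq_bigr => -[k kN] _ /=; have [? ?] := au k kN; exact: nsqZ.
Qed.

Lemma sqnorm_ae u v : adapted u -> adapted v ->
  (forall k, (k <= N)%N -> {ae P, forall o, u.1 k o = v.1 k o} /\
    {ae P, forall o, u.2 k o = v.2 k o}) ->
  sqnorm u = sqnorm v.
Proof.
move=> au av uv; rewrite /sqnorm; congr (_ + _); apply: eq_bigr => -[k kN] _ /=;
  have [? ?] := au k kN; have [? ?] := av k kN; have [? ?] := uv k kN;
  exact: nsq_ae.
Qed.

Lemma sqnorm_eq0 u : adapted u -> sqnorm u <= 0 -> forall k, (k <= N)%N ->
  {ae P, forall o, u.1 k o = 0} /\ {ae P, forall o, u.2 k o = 0}.
Proof.
move=> au u0 k kN; have := nsq_sqnorm u kN kN; have [l1 l2] := au k kN.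
have := nsq_ge0 P (u.1 k); have := nsq_ge0 P (u.2 k) => h1 h2 h3.
split; [apply: nsq_eq0 l1 _; lra|apply: nsq_eq0 l2 _; lra].
Qed.

Lemma adapted_complete (F : nat -> process) (C : R) : (forall j, adapted (F j)) ->
  (forall j, sqnorm (F j.+1 - F j) <= C * 4^-1 ^+ j) ->
  exists2 u, adapted u & exists C', forall j, sqnorm (F j - u) <= C' * 4^-1 ^+ j.
Proof.
move=> aF FC.
have lim (sel : process -> nat -> Omega -> 'cV[R]_n) :
    (forall u, adapted u -> forall k, (k <= N)%N -> L2v P (filt w k) (sel u k)) ->
    (forall j k, (k <= N)%N ->
      nsq P (fun o => sel (F j.+1) k o - sel (F j) k o) <= C * 4^-1 ^+ j) ->
    exists X, forall k, (k <= N)%N -> L2v P (filt w k) (X k) /\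
      forall j, nsq P (fun o => sel (F j) k o - X k o) <= n%:R * (4 * C) * 4^-1 ^+ j.
  move=> lsel selC.
  suff /choice[X hX] : forall k, exists Xk : Omega -> 'cV[R]_n, (k <= N)%N ->
      L2v P (filt w k) Xk /\
      forall j, nsq P (fun o => sel (F j) k o - Xk o) <= n%:R * (4 * C) * 4^-1 ^+ j.
    by exists X.
  move=> k; have [kN|kN] := leqP k N; last by exists (fun=> 0).
  have [|X lX hX] := L2v_complete (subF kN) (F := fun j => sel (F j) k) _ (selC ^~ k ^~ kN).
    by move=> j; exact: lsel.
  by exists X.
have bound j k : (k <= N)%N -> _ := fun kN =>
  le_trans (nsq_sqnorm (F j.+1 - F j) kN kN) (FC j).
have [||X hX] := lim (fun u => u.1).
- by move=> u au k /au[].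
- by move=> j k /(bound j); apply: le_trans; rewrite lerDl nsq_ge0.
have [||Y hY] := lim (fun u => u.2).
- by move=> u au k /au[].
- by move=> j k /(bound j); apply: le_trans; rewrite lerDr nsq_ge0.
exists (X, Y); first by move=> k kN; split; [case: (hX k kN)|case: (hY k kN)].
exists (2 * N.+1%:R * (n%:R * (4 * C))) => j.
rewrite -[X in _ <= X]mulrA; apply: sqnorm_le => k kN.
by have [_ hXk] := hX k kN; have [_ hYk] := hY k kN; split; [exact: hXk|exact: hYk].
Qed.

Section theta.
Variables (u : process) (au : adapted u) (k : nat) (kN : (k < N)%N).

Let lY : L2v P (filt w k.+1) (u.2 k.+1). Proof. by case: (au kN). Qed.

Lemma vcondE_y : vcondE P (filt w k) (fun=> 1) (u.2 k.+1) (fun o => (th u k o).1.2).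
Proof.
have := vcondE_exists (subF (ltnW kN)) (measurable_cst _) (weight_one P w k) lY.
by have -> : (fun o => 1 *: u.2 k.+1 o) = u.2 k.+1
  by apply/funext => o; rewrite scale1r.
Qed.

Lemma vcondE_z : vcondE P (filt w k) (w k) (u.2 k.+1) (fun o => (th u k o).2).
Proof.
exact: (vcondE_exists (subF (ltnW kN)) (noise_measurable mart kN)
  (weight_noise mart kN) lY).
Qed.

Lemma th_L2v : [/\ L2v P (filt w k) (fun o => (th u k o).1.1),
  L2v P (filt w k) (fun o => (th u k o).1.2) & L2v P (filt w k) (fun o => (th u k o).2)].
Proof.
split; first by case: (au (ltnW kN)).
- by have [] := vcondE_L2 (subF (ltnW kN)) (measurable_cst _) (weight_one P w k) lY vcondE_y.
- by have [] := vcondE_L2 (subF (ltnW kN)) (noise_measurable mart kN)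
    (weight_noise mart kN) lY vcondE_z.
Qed.

End theta.

(** The conditional expectations in theta depend linearly on y and are adjoint
    contractions of multiplication by the weights 1 and w_k. *)
Section theta_difference.
Variables (u v : process) (au : adapted u) (av : adapted v) (k : nat) (kN : (k < N)%N).

Let lD : L2v P (filt w k.+1) ((u - v).2 k.+1).
Proof. by case: (adaptedB au av kN). Qed.

Let Dy := vcondEB (subF (ltnW kN)) (vcondE_y au kN) (vcondE_y av kN).
Let Dz := vcondEB (subF (ltnW kN)) (vcondE_z au kN) (vcondE_z av kN).

Lemma nsq_th_y : nsq P (fun o => (th u k o).1.2 - (th v k o).1.2) <= nsq P ((u - v).2 k.+1).
Proof.
by have [] := vcondE_L2 (subF (ltnW kN)) (measurable_cst _) (weight_one P w k) lD Dy.
Qed.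

Lemma nsq_th_z : nsq P (fun o => (th u k o).2 - (th v k o).2) <= nsq P ((u - v).2 k.+1).
Proof.
by have [] := vcondE_L2 (subF (ltnW kN)) (noise_measurable mart kN)
  (weight_noise mart kN) lD Dz.
Qed.

Lemma ip_th_y X : L2v P (filt w k) X ->
  ip P X (fun o => (th u k o).1.2 - (th v k o).1.2) = ip P X ((u - v).2 k.+1).
Proof.
move=> lX.
rewrite (vcondE_adjoint (subF (ltnW kN)) (measurable_cst _) (weight_one P w k) lX lD Dy).
by congr (ip P _ _); apply/funext => o; rewrite scale1r.
Qed.

Lemma ip_th_z X : L2v P (filt w k) X ->
  ip P X (fun o => (th u k o).2 - (th v k o).2) =
  ip P (fun o => w k o *: X o) ((u - v).2 k.+1).
Proof.
by move=> lX; rewrite (vcondE_adjoint (subF (ltnW kN)) (noise_measurable mart kN)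
  (weight_noise mart kN) lX lD Dz).
Qed.

End theta_difference.

Lemma noise_L2v k (X : Omega -> 'cV[R]_n) : (k < N)%N -> L2v P (filt w k) X ->
  L2v P (filt w k.+1) (fun o => w k o *: X o) /\ nsq P (fun o => w k o *: X o) <= nsq P X.
Proof.
move=> kN lX; apply: (vweight_L2 (subF (ltnW kN)) (noise_measurable mart kN)
  (weight_noise mart kN) _ _ lX); first exact: filt_le.
exact: noise_adapted.
Qed.

Section coefficients.
Variables (L : R) (c : coeffs R Omega n).
Hypothesis HH : H1 P N w L c.

Let L0 : 0 <= L. Proof. by case: HH => _ [/ltW]. Qed.

Lemma cLambda_L2v u : adapted u -> L2v P (filt w 0) (fun o => cLambda c (u.2 0%N o)).
Proof.
move=> au.
apply: (@L2v_comp _ _ _ P cP _ n _ _ (fun (x : 'cV[R]_n) i => x i 0)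
  (fun f => \col_i f i) (fun x x' => enorm (x - x')) (subF (leq0n N)) _ _ _
  (fun _ y => cLambda c y) L (u.2 0%N)) => //.
- by move=> x; apply/matrixP => i j; rewrite mxE ord1.
- by move=> f i; rewrite mxE.
- exact: enorm_coord.
- move=> y; apply: (@L2P _ _ _ P _ _ _ (subF (leq0n N))).2.
  split; last exact: L2v_cst.
  by move=> i j; exact: measurable_cst.
- by case: HH => _ [_ h _ _]; exact: aeW.
- by case: (au 0%N (leq0n N)).
Qed.

Lemma cPhi_L2v u : adapted u -> L2v P (filt w N) (fun o => cPhi c o (u.1 N o)).
Proof.
move=> au.
apply: (@L2v_comp _ _ _ P cP _ n _ _ (fun (x : 'cV[R]_n) i => x i 0)
  (fun f => \col_i f i) (fun x x' => enorm (x - x')) (subF (leqnn N)) _ _ _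
  (cPhi c) L (u.1 N)) => //.
- by move=> x; apply/matrixP => i j; rewrite mxE ord1.
- by move=> f i; rewrite mxE.
- exact: enorm_coord.
- by case: HH => [[]].
- by case: HH => _ [].
- by case: (au N (leqnn N)).
Qed.

Let comp3 k (h : Omega -> vec3 R n -> 'cV[R]_n) u : (k < N)%N -> adapted u ->
  (forall t, L2 P (filt w k) (fun o => h o t)) ->
  {ae P, forall o, forall t t', enorm (h o t - h o t') <= L * enorm3 (t - t')} ->
  L2v P (filt w k) (fun o => h o (th u k o)).
Proof.
move=> kN au lh hL.
apply: (@L2v_comp _ _ _ P cP _ n _ _ (@vec3_coord R n)
  (@vec3_of_coord R n) (fun t t' => enorm3 (t - t')) (subF (ltnW kN)) _ _ _
  h L (th u k)) => //.
- exact: vec3_of_coordK.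
- exact: vec3_coordK.
- exact: enorm3_coord.
- by have [h1 h2 h3] := th_L2v au kN; case=> [[i|i]|i] /=; [exact: h1|exact: h2|exact: h3].
Qed.

Let L2k (h : nat -> Omega -> 'cV[R]_n) k : L2proc P w N h -> (k < N)%N -> L2 P (filt w k) (h k).
Proof.
move=> lh; apply: (@L2procP _ _ _ P w N n h _).1 => // l lN.
exact: subF (ltnW lN).
Qed.

Lemma coef_lip k : (k < N)%N ->
  [/\ {ae P, forall o, forall t t', enorm (cb c k o t - cb c k o t') <= L * enorm3 (t - t')},
      {ae P, forall o, forall t t', enorm (cs c k o t - cs c k o t') <= L * enorm3 (t - t')}
    & {ae P, forall o, forall t t', enorm (cf c k.+1 o t - cf c k.+1 o t') <= L * enorm3 (t - t')}].
Proof.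
move=> kN; have [_ [_ _ _ /(_ k kN) h]] := HH.
by split; apply: filterS h => o h t t'; case: (h t t').
Qed.

Lemma coef_L2v u k : adapted u -> (k < N)%N ->
  [/\ L2v P (filt w k) (fun o => cb c k o (th u k o)),
      L2v P (filt w k) (fun o => cs c k o (th u k o))
    & L2v P (filt w k) (fun o => cf c k.+1 o (th u k o))].
Proof.
move=> au kN; have [h1 h2 h3] := coef_lip kN; have [[_ hG _] _] := HH.
split.
- by apply: comp3 => // t; have [_ lb _] := hG t; exact: (L2k lb kN).
- by apply: comp3 => // t; have [_ _ ls] := hG t; exact: (L2k ls kN).
- by apply: comp3 => // t; have [lf _ _] := hG t; exact: (L2k lf kN).
Qed.

Lemma fbmap_adapted u : adapted u -> adapted (fbmap c u).
Proof.
move=> au k kN; split.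
  case: k kN => [_|k kN] /=; first exact: cLambda_L2v.
  have [lb ls _] := coef_L2v au kN.
  apply: L2vD; first exact: (L2v_sub (filt_le (leqnSn k)) lb).
  by have [] := noise_L2v kN ls.
rewrite /fbmap /=; case: eqP => [->|/eqP kNN]; first exact: cPhi_L2v.
have {}kN : (k < N)%N by rewrite ltn_neqAle kNN.
by apply: L2vN; have [] := coef_L2v au kN.
Qed.

End coefficients.

End Operator.

(** * Solutions as almost sure fixed points *)

Section Solutions.
Context {R : realType} {d : measure_display} {Omega : measurableType d}.
Variables (P : probability Omega R) (N n : nat) (w : nat -> Omega -> R).
Hypothesis cP : measure_is_complete P.
Hypothesis mart : martingale_difference P N w.

Local Notation process := (@process R d Omega n).
Local Notation adapted := (adapted P N w).

Let subF k : (k <= N)%N -> <<s filt w k >> `<=` measurable.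
Proof. exact: (filt_measurable mart). Qed.

Lemma L2v_version G (X : Omega -> 'cV[R]_n) : <<s G >> `<=` measurable ->
  L2v P G X -> exists X', [/\ mx_measurable G X', L2v P G X' & {ae P, forall o, X o = X' o}].
Proof.
move=> subG lX.
have /choice[g hg] : forall i, exists g, rv_measurable G g /\ {ae P, forall o, X o i 0 = g o}.
  by move=> i; have [_ [g mg Xg]] := lX i; exists g.
have Xg : {ae P, forall o, X o = \col_i g i o}.
  have : {ae P, forall o, forall i, X o i 0 = g i o}.
    by apply: filter_forall => i; case: (hg i).
  by apply: filterS => o h; apply/matrixP => i j; rewrite mxE ord1.
exists (fun o => \col_i g i o); split => //.
- by move=> i j; under eq_fun do rewrite mxE; case: (hg i).
- move=> i; under eq_fun do rewrite mxE; have [mg gi] := hg i; split.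
    by have [lXi _] := lX i; exact: (L2s_ae (rv_measurable_fun subG mg) gi lXi).
  by exists (g i) => //; exact: aeW.
Qed.

(** Strict measurability, required of a solution, is recovered by changing each
    variable on a null set. *)
Lemma adapted_version (u : process) : adapted u -> exists v : process,
  [/\ adapted v,
      forall k, (k <= N)%N -> mx_measurable (filt w k) (v.1 k) /\
        mx_measurable (filt w k) (v.2 k)
    & forall k, (k <= N)%N -> {ae P, forall o, u.1 k o = v.1 k o} /\
        {ae P, forall o, u.2 k o = v.2 k o}].
Proof.
move=> au.
have ver (X : nat -> Omega -> 'cV[R]_n) : (forall k, (k <= N)%N -> L2v P (filt w k) (X k)) ->
    exists X', forall k, (k <= N)%N -> [/\ mx_measurable (filt w k) (X' k),
      L2v P (filt w k) (X' k) & {ae P, forall o, X k o = X' k o}].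
  move=> lX.
  suff /choice[X' hX'] : forall k, exists X', (k <= N)%N -> [/\ mx_measurable (filt w k) X',
      L2v P (filt w k) X' & {ae P, forall o, X k o = X' o}] by exists X'.
  move=> k; have [kN|kN] := leqP k N; last by exists (fun=> 0).
  by have [X' hX'] := L2v_version (subF kN) (lX k kN); exists X'.
have [x hx] := ver u.1 (fun k kN => proj1 (au k kN)).
have [y hy] := ver u.2 (fun k kN => proj2 (au k kN)).
exists (x, y); split => k kN; have [? ? ?] := hx k kN; have [? ? ?] := hy k kN; by split.
Qed.

Lemma th_ae (u v : process) k : (k < N)%N -> adapted u -> adapted v ->
  {ae P, forall o, u.1 k o = v.1 k o} -> {ae P, forall o, u.2 k.+1 o = v.2 k.+1 o} ->
  {ae P, forall o, th P w u k o = th P w v k o}.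
Proof.
move=> kN au av uv1 uv2.
have [_ lu] := au _ kN; have [_ lv] := av _ kN.
have e1 := mx_condE_ae (subF (ltnW kN)) (measurable_cst _) (weight_one P w k) lu lv uv2.
have e2 := mx_condE_ae (subF (ltnW kN)) (noise_measurable mart kN)
  (weight_noise mart kN) lu lv uv2.
have one (Y : Omega -> 'cV[R]_n) : (fun o => 1 *: Y o) = Y.
  by apply/funext => o; rewrite scale1r.
rewrite !one in e1.
by apply: filterS uv1 => o h; rewrite /th /theta h e1 e2.
Qed.

(** The conditional expectation of zero is chosen among all versions, so it is
    zero only almost surely. *)
Lemma th0 k : (k < N)%N -> {ae P, forall o, th P w (0 : process) k o = 0}.
Proof.
move=> kN; have a0 := @adapted0 _ _ _ P N n w.
have l0 : L2v P (filt w k.+1) ((0 : process).2 k.+1) by exact: L2v_cst.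
have n0 : nsq P ((0 : process).2 k.+1) = 0.
  rewrite /nsq /ip -[RHS](Ex_cst P 0); congr (Ex P _); apply/funext => o.
  by rewrite dotE big1// => i _; rewrite mxE mul0r.
have [ly ny] := vcondE_L2 (subF (ltnW kN)) (measurable_cst _) (weight_one P w k) l0
  (vcondE_y mart a0 kN).
have [lz nz] := vcondE_L2 (subF (ltnW kN)) (noise_measurable mart kN)
  (weight_noise mart kN) l0 (vcondE_z mart a0 kN).
rewrite n0 in ny nz.
apply: filterS2 (nsq_eq0 ly ny) (nsq_eq0 lz nz) => o.
by rewrite /th /theta /= => -> ->.
Qed.

Lemma fbmap_ae c (u v : process) : adapted u -> adapted v ->
  (forall k, (k <= N)%N -> {ae P, forall o, u.1 k o = v.1 k o} /\
    {ae P, forall o, u.2 k o = v.2 k o}) ->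
  forall k, (k <= N)%N ->
    {ae P, forall o, (fbmap P N w c u).1 k o = (fbmap P N w c v).1 k o} /\
    {ae P, forall o, (fbmap P N w c u).2 k o = (fbmap P N w c v).2 k o}.
Proof.
move=> au av uv k kN; split.
  case: k kN => [|k] kN /=.
    by have [_ h] := uv 0%N kN; apply: filterS h => o ->.
  have [h _] := uv k (ltnW kN); have [_ h'] := uv k.+1 kN.
  by apply: filterS (th_ae kN au av h h') => o ->.
rewrite /fbmap /=; case: eqP => [_|/eqP kNN].
  by have [h _] := uv N (leqnn N); apply: filterS h => o ->.
have {}kN : (k < N)%N by rewrite ltn_neqAle kNN.
have [h _] := uv k (ltnW kN); have [_ h'] := uv k.+1 kN.
by apply: filterS (th_ae kN au av h h') => o ->.
Qed.

(** Reduces the study of solutions to almost sure fixed points in the space of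
    adapted processes. *)
Lemma is_solutionP c (x y : nat -> Omega -> 'cV[R]_n) : is_solution P N w c x y <->
  [/\ adapted (x, y),
      forall k, (k <= N)%N -> mx_measurable (filt w k) (x k) /\
        mx_measurable (filt w k) (y k)
    & forall k, (k <= N)%N ->
        {ae P, forall o, x k o = (fbmap P N w c (x, y)).1 k o} /\
        {ae P, forall o, y k o = (fbmap P N w c (x, y)).2 k o}].
Proof.
have pr (X : nat -> Omega -> 'cV[R]_n) : L2proc P w N.+1 X <->
    (forall k, (k <= N)%N -> mx_measurable (filt w k) (X k) /\ L2v P (filt w k) (X k)).
  have h := @L2procP _ _ _ P w N.+1 n X (fun k kN => subF kN).
  split=> [/h hX k kN|hX]; first by exact: ((@L2P _ _ _ P _ _ _ (subF kN)).1 (hX k kN)).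
  by apply/h => k kN; apply: (@L2P _ _ _ P _ _ _ (subF kN)).2; exact: hX.
split=> [[[/pr lx /pr ly] [ex ey ex0 eyN]]|[axy mxy exy]].
  split=> k kN; first by have [_ ?] := lx k kN; have [_ ?] := ly k kN.
    by have [? _] := lx k kN; have [? _] := ly k kN.
  split.
    by case: k kN {lx ly} => [_|k kN] //=; exact: ex.
  rewrite /fbmap /=; case: eqP => [->|/eqP kNN]; first exact: eyN.
  by apply: ey; rewrite ltn_neqAle kNN.
split.
  by split; apply/pr => k kN; have [? ?] := axy k kN; have [? ?] := mxy k kN.
split=> [k kN|k kN||].
- by have [] := exy k.+1 kN.
- have [_] := exy k (ltnW kN).
  by rewrite /fbmap /= (ltn_eqF kN).
- by have [] := exy 0%N (leq0n N).
- by have [_] := exy N (leqnn N); rewrite /fbmap /= eqxx.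
Qed.

Lemma L1_enorm_sqr G (X : Omega -> 'cV[R]_n) : L2v P G X ->
  L1 P (fun o => enorm (X o) ^+ 2) /\ Ex P (fun o => enorm (X o) ^+ 2) = nsq P X.
Proof.
move=> lX; have -> : (fun o => enorm (X o) ^+ 2) = (fun o => dot (X o) (X o)).
  by apply/funext => o; exact: enorm_sqr.
by split => //; exact: (L1_dot lX lX).
Qed.

Lemma L1_sum_enorm_sqr m (X : nat -> Omega -> 'cV[R]_n) :
  (forall k, (k < m)%N -> exists G, L2v P G (X k)) ->
  L1 P (fun o => \sum_(k < m) enorm (X k o) ^+ 2) /\
  Ex P (fun o => \sum_(k < m) enorm (X k o) ^+ 2) = \sum_(k < m) nsq P (X k).
Proof.
move=> lX.
have l (k : 'I_m) : L1 P (fun o => enorm (X k o) ^+ 2).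
  by have [G /L1_enorm_sqr[]] := lX k (ltn_ord k).
split; first exact: L1_sum.
rewrite Ex_sum//; apply: eq_bigr => k _.
by have [G /L1_enorm_sqr[]] := lX k (ltn_ord k).
Qed.

Lemma expectation_sqnorm (u : process) : adapted u ->
  ('E_P[fun o => (\sum_(k < N.+1) enorm (u.1 k o) ^+ 2 +
                  \sum_(k < N.+1) enorm (u.2 k o) ^+ 2)%R] = (sqnorm P N u)%:E)%E.
Proof.
move=> au.
have [l1 e1] := @L1_sum_enorm_sqr N.+1 u.1
  (fun k kN => ex_intro (fun G => L2v P G (u.1 k)) _ (proj1 (au k kN))).
have [l2 e2] := @L1_sum_enorm_sqr N.+1 u.2
  (fun k kN => ex_intro (fun G => L2v P G (u.2 k)) _ (proj2 (au k kN))).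
by rewrite expectationE; [rewrite ExD// e1 e2|exact: L1D].
Qed.

(** Completeness of P provides the measurability of g. *)
Lemma L1_ae_complete (f g : Omega -> R) : {ae P, forall o, f o = g o} ->
  L1 P f -> L1 P g /\ Ex P f = Ex P g.
Proof.
move=> fg lf.
have mg : measurable_fun setT g.
  apply/measurable_EFinP; apply: (ae_measurable_fun cP (f := EFin \o f)).
    by apply: filterS fg => o /= -> _.
  exact: measurable_int lf.
have lg := L1_ae mg fg lf.
by split => //; exact: eq_Ex_ae.
Qed.

(** Comparison with these coefficients, solved by the zero process, turns the
    estimate of differences into the estimate of a single solution. *)
Definition zero_coeffs : coeffs R Omega n :=
  Coeffs (fun=> 0) (fun _ _ => 0) (fun _ _ _ => 0) (fun _ _ _ => 0) (fun _ _ _ => 0).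

Lemma H1_zero : H1 P N w 1 zero_coeffs.
Proof.
have m0 k i j : (k <= N)%N -> rv_measurable (filt w k) (fun o : Omega => (0 : 'cV[R]_n) i j).
  by move=> _; exact: measurable_cst.
have l2 k : (k <= N)%N -> L2 P (filt w k) (fun _ : Omega => (0 : 'cV[R]_n)).
  move=> kN; apply: (@L2P _ _ _ P _ _ _ (subF kN)).2; split; last exact: L2v_cst.
  by move=> i j; exact: m0.
have lproc : L2proc P w N (fun _ (_ : Omega) => (0 : 'cV[R]_n)).
  by apply: (@L2procP _ _ _ P w N n _ _).2 => k kN; [exact: subF (ltnW kN)|exact: l2 (ltnW kN)].
have e0 : enorm (0 - 0 : 'cV[R]_n) = 0.
  by rewrite subr0 /enorm big1 ?sqrtr0// => i _; rewrite big1// => j _; rewrite mxE expr0n.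
split; split => //.
- by move=> x; exact: l2.
- by split => //; exact: l2.
- by move=> y y' /=; rewrite e0 mul1r enorm_ge0.
- by apply: aeW => o x x' /=; rewrite e0 mul1r enorm_ge0.
- by move=> k kN; apply: aeW => o t t'; split; rewrite /= e0 mul1r enorm3_ge0.
Qed.

End Solutions.

(** * The a priori estimate *)

(* Means are manipulated by their algebraic rules only; unfolding them makes
   the comparison of two means by conversion diverge. *)
#[local] Opaque nsq ip Ex L2v L1 mx_condE.

Section Sums.
Context {R : realType}.

Lemma sum_combination N (tau : R) (a b x y : nat -> R) :
  (forall k, (k <= N)%N -> a k - b k = tau * x k - tau * y k) ->
  \sum_(k < N.+1) (a k - b k) = tau * (\sum_(k < N.+1) x k) - tau * (\sum_(k < N.+1) y k).
Proof.
by move=> h; rewrite !mulr_sumr -sumrB; apply: eq_bigr => -[k kN] _; exact: h.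
Qed.

Lemma sum_le_combination N (e i : R) (a x y x' y' : nat -> R) :
  (forall k, (k <= N)%N -> a k <= (e * x k + e * y k) + (i * x' k + i * y' k)) ->
  \sum_(k < N.+1) a k <= e * (\sum_(k < N.+1) x k + \sum_(k < N.+1) y k) +
    i * (\sum_(k < N.+1) x' k + \sum_(k < N.+1) y' k).
Proof.
move=> h; rewrite !mulrDr !mulr_sumr -!big_split.
by apply: ler_sum => -[k kN] _; exact: h.
Qed.

Lemma sum_gap N (tau p0 pN : R) (p q g : nat -> R) : p N = pN -> q 0%N = p0 ->
  (forall k, (k < N)%N -> g k = q k.+1 - p k) ->
  tau * pN - tau * p0 - tau * (\sum_(k < N) g k) =
  tau * (\sum_(k < N.+1) p k) - tau * (\sum_(k < N.+1) q k).
Proof.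
move=> <- <- hg; rewrite big_ord_recr big_ord_recl/= -!mulrBr; congr (tau * _).
have -> : \sum_(k < N) g k = \sum_(k < N) q k.+1 - \sum_(k < N) p k.
  by rewrite -sumrB; apply: eq_bigr => -[k kN] _; exact: hg.
ring.
Qed.

Lemma le_subl_addr (a b x y z t : R) : a <= x + y -> - b <= z + t ->
  a - b <= (z + x) + (y + t).
Proof. lra. Qed.

Lemma le_affine (a b e x : R) : x <= 2 * a + 2 * b -> b <= e -> x <= 2 * a + 2 * e.
Proof. lra. Qed.

Lemma le_double_sum (a b e : R) : a <= e -> b <= e -> 2 * a + 2 * b <= 4 * e.
Proof. lra. Qed.

(** The mean square of tau times an increment carries tau^2, its gap only tau;
    as tau <= 1, the square is still controlled by the scaled gap. *)
Lemma scale_le (t a b : R) : 0 <= t <= 1 -> 0 <= a -> a <= b -> t ^+ 2 * a <= t * b.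
Proof.
move=> /andP[t0 t1] a0 ab; rewrite expr2 -mulrA ler_wpM2l// (le_trans _ ab)//.
by rewrite ler_piMl.
Qed.

Lemma scale_le1 (t a b : R) : 0 <= t <= 1 -> 0 <= a -> a <= b -> t ^+ 2 * a <= b.
Proof.
move=> t01 a0 ab; have /andP[t0 t1] := t01; apply: (le_trans (scale_le t01 a0 ab)).
by rewrite ler_piMl// (le_trans a0).
Qed.

Lemma scale_gap (t a b q K : R) : 0 <= t <= 1 -> 0 <= a -> 0 <= b ->
  t * (a * b - K * q) <= a * b + K * - (t * q).
Proof.
move=> /andP[t0 t1] a0 b0.
have -> : t * (a * b - K * q) = t * (a * b) + K * - (t * q) by ring.
by rewrite lerD2r ler_piMl// mulr_ge0.
Qed.

Definition stab_cst N (L K1 K2 : R) : R :=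
  let C := two_pass_cst (pass_cst K1 K2 (L ^+ 2)) N in 2 * (C * (2 * (C + 1) + 1)).

Lemma pass_cst_ge0 (K1 K2 L2 : R) : 0 <= K1 -> 0 <= K2 -> 0 <= L2 -> 0 <= pass_cst K1 K2 L2.
Proof. by move=> *; rewrite /pass_cst !addr_ge0// mulr_ge0. Qed.

Lemma stab_cst_ge0 N (L K1 K2 : R) : 0 <= K1 -> 0 <= K2 -> 0 <= stab_cst N L K1 K2.
Proof.
move=> K1_ge0 K2_ge0.
have C0 := two_pass_cst_ge0 N (pass_cst_ge0 K1_ge0 K2_ge0 (sqr_ge0 L)).
by rewrite /stab_cst mulr_ge0// mulr_ge0// addr_ge0// mulr_ge0// addr_ge0.
Qed.

End Sums.

Section Stability.
Context {R : realType} {d : measure_display} {Omega : measurableType d}.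
Variables (P : probability Omega R) (N n : nat) (w : nat -> Omega -> R).
Hypothesis cP : measure_is_complete P.
Hypothesis mart : martingale_difference P N w.
Variables (L : R) (c : coeffs R Omega n).
Hypothesis HH : H1 P N w L c.

Local Notation process := (@process R d Omega n).
Local Notation adapted := (adapted P N w).
Local Notation sqnorm := (sqnorm P N).
Local Notation th := (th P w).
Local Notation S := (fbmap P N w c).

Let L0 : 0 <= L. Proof. by case: HH => _ [/ltW]. Qed.

Section pair.
Variables (u v : process) (au : adapted u) (av : adapted v).

Let hx k := (u - v).1 k.
Let hy k := (u - v).2 k.
Let hb k o := cb c k o (th u k o) - cb c k o (th v k o).
Let hs k o := cs c k o (th u k o) - cs c k o (th v k o).
Let hf k o := cf c k.+1 o (th u k o) - cf c k.+1 o (th v k o).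
Let hL o := cLambda c (u.2 0%N o) - cLambda c (v.2 0%N o).
Let hP o := cPhi c o (u.1 N o) - cPhi c o (v.1 N o).
Let hyp k o := (th u k o).1.2 - (th v k o).1.2.
Let hzp k o := (th u k o).2 - (th v k o).2.

Let lhx k : (k <= N)%N -> L2v P (filt w k) (hx k).
Proof. by move=> kN; have [h _] := adaptedB au av kN; exact: h. Qed.

Let lhy k : (k <= N)%N -> L2v P (filt w k) (hy k).
Proof. by move=> kN; have [_ h] := adaptedB au av kN; exact: h. Qed.

Let lhyp k : (k < N)%N -> L2v P (filt w k) (hyp k).
Proof.
by move=> kN; have [_ ? _] := th_L2v mart au kN; have [_ ? _] := th_L2v mart av kN;
  exact: L2vB.
Qed.

Let lhzp k : (k < N)%N -> L2v P (filt w k) (hzp k).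
Proof.
by move=> kN; have [_ _ ?] := th_L2v mart au kN; have [_ _ ?] := th_L2v mart av kN;
  exact: L2vB.
Qed.

Let lhbsf k : (k < N)%N -> [/\ L2v P (filt w k) (hb k),
  L2v P (filt w k) (hs k) & L2v P (filt w k) (hf k)].
Proof.
move=> kN; have [? ? ?] := coef_L2v cP mart HH au kN.
by have [? ? ?] := coef_L2v cP mart HH av kN; split; exact: L2vB.
Qed.

Let lhL : L2v P (filt w 0) hL.
Proof. by apply: L2vB; exact: (cLambda_L2v cP mart HH). Qed.

Let lhP : L2v P (filt w N) hP.
Proof. by apply: L2vB; exact: (cPhi_L2v cP mart HH). Qed.

Lemma nsq_lip3 k (h : Omega -> vec3 R n -> 'cV[R]_n) : (k < N)%N ->
  L2v P (filt w k) (fun o => h o (th u k o) - h o (th v k o)) ->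
  {ae P, forall o, forall t t', enorm (h o t - h o t') <= L * enorm3 (t - t')} ->
  nsq P (fun o => h o (th u k o) - h o (th v k o)) <=
    L ^+ 2 * (nsq P ((u - v).1 k) + 2 * nsq P ((u - v).2 k.+1)).
Proof.
move=> kN lh hL'.
have lx := L1_dot (lhx (ltnW kN)) (lhx (ltnW kN)).
have ly := L1_dot (lhyp kN) (lhyp kN).
have lz := L1_dot (lhzp kN) (lhzp kN).
have lxy := L1D lx ly.
apply: (@le_trans _ _ (L ^+ 2 * (nsq P (hx k) + nsq P (hyp k) + nsq P (hzp k)))); last first.
  apply: ler_wpM2l; first exact: sqr_ge0.
  have add3 (a b b' e : R) : b <= e -> b' <= e -> a + b + b' <= a + 2 * e by lra.
  exact: (add3 _ _ _ _ (nsq_th_y mart au av kN) (nsq_th_z mart au av kN)).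
rewrite !nsq_def -ExD// -ExD// -ExZ; last exact: L1D.
apply: le_Ex; [exact: (L1_dot lh lh)|by apply: L1Z; exact: L1D|].
apply: filterS hL' => o hL'.
rewrite -enorm_sqr; have e := enorm3_sqr (th u k o - th v k o).
rewrite -[X in _ * X]e -exprMn ler_sqr ?nnegrE ?enorm_ge0 ?mulr_ge0 ?enorm3_ge0//.
Qed.

Lemma nsq_lip_coef k : (k < N)%N ->
  let B := L ^+ 2 * (nsq P ((u - v).1 k) + 2 * nsq P ((u - v).2 k.+1)) in
  [/\ nsq P (hb k) <= B, nsq P (hs k) <= B & nsq P (hf k) <= B].
Proof.
move=> kN B; have [l1 l2 l3] := lhbsf kN; have [h1 h2 h3] := coef_lip HH kN.
by split; apply: nsq_lip3.
Qed.

Lemma nsq_lip_Lambda : nsq P hL <= L ^+ 2 * nsq P ((u - v).2 0%N).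
Proof.
have ly := L1_dot (lhy (leq0n N)) (lhy (leq0n N)).
rewrite !nsq_def -ExZ//; apply: le_Ex; [exact: (L1_dot lhL lhL)|exact: L1Z|].
apply: aeW => o; apply: enorm_le_dot => //.
by case: HH => _ [_ h _ _]; exact: h.
Qed.

Lemma nsq_lip_Phi : nsq P hP <= L ^+ 2 * nsq P ((u - v).1 N).
Proof.
have lx := L1_dot (lhx (leqnn N)) (lhx (leqnn N)).
rewrite !nsq_def -ExZ//; apply: le_Ex; [exact: (L1_dot lhP lhP)|exact: L1Z|].
have [_ [_ _ h _]] := HH; apply: filterS h => o h.
by apply: enorm_le_dot => //; exact: h.
Qed.

Lemma nsq_dS_succ k : (k < N)%N ->
  nsq P ((S u - S v).1 k.+1) <= 2 * nsq P (hb k) + 2 * nsq P (hs k).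
Proof.
move=> kN; have [lb ls _] := lhbsf kN; have [lws nws] := noise_L2v mart kN ls.
have -> : (S u - S v).1 k.+1 = (fun o => hb k o + w k o *: hs k o).
  by apply/funext => o; rewrite /hb /hs scalerBr addrACA -opprD.
apply: (le_trans (nsqD_le lb lws)).
by rewrite lerD2l ler_pM2l.
Qed.

Lemma dS_y k : (k < N)%N -> (S u - S v).2 k = (fun o => - hf k o).
Proof.
move=> kN; apply/funext => o; rewrite /hf.
have -> : (S u - S v).2 k o = (S u).2 k o - (S v).2 k o by [].
by rewrite /fbmap /= (ltn_eqF kN) opprB opprK addrC.
Qed.

Lemma dS_yN : (S u - S v).2 N = hP.
Proof.
apply/funext => o.
have -> : (S u - S v).2 N o = (S u).2 N o - (S v).2 N o by [].
by rewrite /fbmap /= eqxx.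
Qed.

(** The Lipschitz conditions carry over to S because the conditional
    expectations in theta are contractions. *)
Lemma fbmap_lip : sqnorm (S u - S v) <=
  2 * N.+1%:R * (8 * L ^+ 2) * sqnorm (u - v).
Proof.
have L2 : 0 <= L ^+ 2 by exact: sqr_ge0.
have le2 k l : (k <= N)%N -> (l <= N)%N ->
    L ^+ 2 * (nsq P ((u - v).1 k) + 2 * nsq P ((u - v).2 l)) <=
    2 * (L ^+ 2 * sqnorm (u - v)).
  move=> kN lN; rewrite [leRHS]mulrCA; apply: ler_wpM2l => //.
  have h (a b e : R) : 0 <= a -> a + b <= e -> a + 2 * b <= 2 * e by lra.
  exact: (h _ _ _ (nsq_ge0 P _) (nsq_sqnorm P (u - v) kN lN)).
have s0 := mulr_ge0 L2 (sqnorm_ge0 P N (u - v)).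
have weaken (a b : R) : 0 <= b -> a <= 2 * b -> a <= 8 * b by lra.
have weaken2 (a b e b' : R) : 0 <= b' -> a <= 2 * b + 2 * e -> b <= 2 * b' ->
  e <= 2 * b' -> a <= 8 * b' by lra.
have assoc (a b e : R) : a * (8 * b) * e = a * (8 * (b * e)) by ring.
rewrite assoc; apply: sqnorm_le => k kN; split.
  case: k kN => [_|k kN].
    apply: weaken s0 _; apply: (le_trans nsq_lip_Lambda).
    apply: le_trans (le2 0%N 0%N (leq0n N) (leq0n N)); apply: ler_wpM2l => //.
    have h (a b : R) : 0 <= a -> 0 <= b -> b <= a + 2 * b by lra.
    by apply: h; exact: nsq_ge0.
  have [h1 h2 _] := nsq_lip_coef kN; have h3 := le2 k k.+1 (ltnW kN) kN.
  exact: (weaken2 _ _ _ _ s0 (nsq_dS_succ kN) (le_trans h1 h3) (le_trans h2 h3)).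
apply: weaken s0 _.
have [->|kNN] := eqVneq k N.
  rewrite dS_yN; apply: (le_trans nsq_lip_Phi).
  apply: le_trans (le2 N N (leqnn N) (leqnn N)); apply: ler_wpM2l => //.
  have h (a b : R) : 0 <= b -> a <= a + 2 * b by lra.
  by apply: h; exact: nsq_ge0.
have {}kN : (k < N)%N by rewrite ltn_neqAle kNN.
rewrite dS_y// nsqN; have [_ _ h] := nsq_lip_coef kN.
exact: (le_trans h (le2 k k.+1 (ltnW kN) kN)).
Qed.

Definition mean_gap k : R := Ex P (fun o => Gamma_pairing c k o (th u k o) (th v k o)).

Lemma L1_gap k : (k < N)%N ->
  L1 P (fun o => Gamma_pairing c k o (th u k o) (th v k o)).
Proof.
move=> kN; have [lb ls lf] := lhbsf kN.
by apply: L1D; first apply: L1D;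
  [exact: (L1_dot lf (lhx (ltnW kN)))|exact: (L1_dot lb (lhyp kN))
  |exact: (L1_dot ls (lhzp kN))].
Qed.

Lemma mean_gapE k : (k < N)%N -> mean_gap k =
  ip P (hf k) ((u - v).1 k) + ip P (fun o => hb k o + w k o *: hs k o) ((u - v).2 k.+1).
Proof.
move=> kN; have [lb ls lf] := lhbsf kN.
have lfx := L1_dot lf (lhx (ltnW kN)).
have lby := L1_dot lb (lhyp kN); have lsz := L1_dot ls (lhzp kN).
have -> : mean_gap k = ip P (hf k) (hx k) + ip P (hb k) (hyp k) + ip P (hs k) (hzp k).
  by rewrite !ip_def -ExD// -ExD//; exact: L1D.
have [lws _] := noise_L2v mart kN ls.
rewrite (ip_th_y mart au av kN lb) (ip_th_z mart au av kN ls) -addrA.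
by rewrite (ipDl lb lws (lhy kN)).
Qed.

(** The duality between the forward and the backward component: the inner
    product of the increments, computed from either equation at every time,
    gives the same sum, whence the monotonicity gaps add up to inner products
    with the residual only. *)
Lemma energy_identity tau : let r := (u - tau *: S u) - (v - tau *: S v) in
  tau * ip P hP ((u - v).1 N) - tau * ip P hL ((u - v).2 0%N)
    - tau * \sum_(k < N) mean_gap k =
  \sum_(k < N.+1) (ip P (r.1 k) ((u - v).2 k) - ip P (r.2 k) ((u - v).1 k)).
Proof.
move=> r.
have rE : r = (u - v) - tau *: (S u - S v).
  by rewrite /r scalerBr !opprD !opprK !addrA; congr (_ + _); rewrite addrAC.
have aS := adaptedB (fbmap_adapted cP mart HH au) (fbmap_adapted cP mart HH av).
have r1E k : (k <= N)%N -> ip P (r.1 k) (hy k) =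
    ip P (hx k) (hy k) - tau * ip P ((S u - S v).1 k) (hy k).
  move=> kN; have [l1 l2] := aS k kN.
  have -> : r.1 k = (fun o => hx k o + (- tau) *: (S u - S v).1 k o).
    by rewrite rE; apply/funext => o; rewrite scaleNr.
  rewrite (ipDl (lhx kN) (L2vZ (- tau) l1) (lhy kN)) -mulNr; congr (_ + _).
  exact: (ipZl _ l1 (lhy kN)).
have r2E k : (k <= N)%N -> ip P (r.2 k) (hx k) =
    ip P (hx k) (hy k) - tau * ip P ((S u - S v).2 k) (hx k).
  move=> kN; have [l1 l2] := aS k kN.
  have -> : r.2 k = (fun o => hy k o + (- tau) *: (S u - S v).2 k o).
    by rewrite rE; apply/funext => o; rewrite scaleNr.
  rewrite (ipDl (lhy kN) (L2vZ (- tau) l2) (lhx kN)) -mulNr ipC; congr (_ + _).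
  exact: (ipZl _ l2 (lhx kN)).
have -> : \sum_(k < N.+1) (ip P (r.1 k) (hy k) - ip P (r.2 k) (hx k)) =
   tau * (\sum_(k < N.+1) ip P ((S u - S v).2 k) (hx k))
   - tau * (\sum_(k < N.+1) ip P ((S u - S v).1 k) (hy k)).
  apply: (sum_combination (a := fun k => ip P (r.1 k) (hy k))
    (b := fun k => ip P (r.2 k) (hx k)) (x := fun k => ip P ((S u - S v).2 k) (hx k))
    (y := fun k => ip P ((S u - S v).1 k) (hy k))) => k kN; rewrite r1E// r2E//.
  have h (a b e : R) : (a - b) - (a - e) = e - b by ring.
  exact: h.
apply: (@sum_gap _ N tau _ _ (fun k => ip P ((S u - S v).2 k) (hx k))
  (fun k => ip P ((S u - S v).1 k) (hy k)) mean_gap) => [|//|k kN].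
  by rewrite dS_yN.
have [_ _ lf] := lhbsf kN.
rewrite mean_gapE// addrC dS_y// (ipNl lf (lhx (ltnW kN))) opprK; congr (_ + _).
congr (ip P _ _); apply/funext => o.
by rewrite /hb /hs scalerBr addrACA -opprD.
Qed.

(** Young's inequality in the energy identity. The free parameter e serves to
    absorb the first term later. *)
Lemma energy_le tau e : 0 < e ->
  tau * ip P hP ((u - v).1 N) - tau * ip P hL ((u - v).2 0%N)
    - tau * \sum_(k < N) mean_gap k <=
  e * sqnorm (u - v) + e^-1 * sqnorm ((u - tau *: S u) - (v - tau *: S v)).
Proof.
move=> e0; rewrite energy_identity; set r := u - _ - _.
have ar : adapted r.
  by apply: adaptedB; apply: adaptedB => //; apply: adaptedZ; exact: (fbmap_adapted cP mart HH).
apply: (sum_le_combination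
  (a := fun k => ip P (r.1 k) (hy k) - ip P (r.2 k) (hx k))
  (x := fun k => nsq P (hx k)) (y := fun k => nsq P (hy k))
  (x' := fun k => nsq P (r.1 k)) (y' := fun k => nsq P (r.2 k))) => k kN.
have [lr1 lr2] := ar k kN.
have h1 := ip_young e0 (lhy kN) lr1.
have h2 := ip_young e0 (L2vN (lhx kN)) lr2.
have e1 : ip P (fun o => - hx k o) (r.2 k) = - ip P (r.2 k) (hx k).
  by rewrite (ipNl (lhx kN) lr2) ipC.
rewrite e1 nsqN in h2; rewrite ipC in h1.
exact: (le_subl_addr h1 h2).
Qed.

Section gaps.
Variables (K1 K2 : R).

Let lLy := L1_dot lhL (lhy (leq0n N)).
Let lPx := L1_dot lhP (lhx (leqnn N)).

Lemma mean_forward_gap : forward_gap P N c K1 K2 ->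
  [/\ nsq P hL <= - K2 * ip P hL ((u - v).2 0%N), 0 <= ip P hP ((u - v).1 N)
    & forall k, (k < N)%N -> mean_gap k <= 0 /\
      nsq P (hb k) + nsq P (hs k) <= K1 * nsq P ((u - v).1 k) - K2 * mean_gap k].
Proof.
case=> gL gP gk; split.
- rewrite nsq_def ip_def -ExZ//; apply: le_Ex; [exact: (L1_dot lhL lhL)|exact: L1Z|].
  by apply: aeW => o; exact: gL.
- rewrite ip_def -(Ex_cst P 0); apply: le_Ex; [exact: L1_cst|exact: lPx|].
  by apply: filterS gP => o; apply.
- move=> k kN; have lg := L1_gap kN; have [lb ls _] := lhbsf kN.
  have lx := L1_dot (lhx (ltnW kN)) (lhx (ltnW kN)).
  split.
    rewrite /mean_gap -(Ex_cst P 0); apply: le_Ex; [exact: lg|exact: L1_cst|].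
    by apply: filterS (gk k kN) => o /(_ (th u k o) (th v k o))[].
  have lbb := L1_dot lb lb; have lss := L1_dot ls ls.
  rewrite !nsq_def /mean_gap -ExD// -!ExZ// -ExB; [|exact: L1Z..].
  apply: le_Ex; [exact: L1D|by apply: L1B; exact: L1Z|].
  by apply: filterS (gk k kN) => o /(_ (th u k o) (th v k o))[].
Qed.

Lemma mean_backward_gap : backward_gap P N c K1 K2 ->
  [/\ ip P hL ((u - v).2 0%N) <= 0, nsq P hP <= K2 * ip P hP ((u - v).1 N)
    & forall k, (k < N)%N -> mean_gap k <= 0 /\
      nsq P (hf k) <= K1 * (nsq P (hyp k) + nsq P (hzp k)) - K2 * mean_gap k].
Proof.
case=> gL gP gk; split.
- rewrite ip_def -(Ex_cst P 0); apply: le_Ex; [exact: lLy|exact: L1_cst|].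
  by apply: aeW => o; exact: gL.
- rewrite nsq_def ip_def -ExZ//; apply: le_Ex; [exact: (L1_dot lhP lhP)|exact: L1Z|].
  by apply: filterS gP => o; apply.
- move=> k kN; have lg := L1_gap kN; have [_ _ lf] := lhbsf kN.
  have ly := L1_dot (lhyp kN) (lhyp kN); have lz := L1_dot (lhzp kN) (lhzp kN).
  have lyz := L1D ly lz.
  split.
    rewrite /mean_gap -(Ex_cst P 0); apply: le_Ex; [exact: lg|exact: L1_cst|].
    by apply: filterS (gk k kN) => o /(_ (th u k o) (th v k o))[].
  rewrite !nsq_def /mean_gap -ExD// -!ExZ// -ExB; [|exact: L1Z..].
  apply: le_Ex; [exact: (L1_dot lf lf)|by apply: L1B; exact: L1Z|].
  by apply: filterS (gk k kN) => o /(_ (th u k o) (th v k o))[].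
Qed.

Hypotheses (K1_ge0 : 0 <= K1) (K2_gt0 : 0 < K2).

(** The increment is tau (S u - S v) plus the residual. *)
Lemma increment_le tau k : (k <= N)%N ->
  let r := (u - tau *: S u) - (v - tau *: S v) in
  nsq P ((u - v).1 k) <= 2 * (tau ^+ 2 * nsq P ((S u - S v).1 k)) + 2 * sqnorm r /\
  nsq P ((u - v).2 k) <= 2 * (tau ^+ 2 * nsq P ((S u - S v).2 k)) + 2 * sqnorm r.
Proof.
move=> kN r.
have ar : adapted r.
  by apply: adaptedB; apply: adaptedB => //; apply: adaptedZ; exact: (fbmap_adapted cP mart HH).
have aS := adaptedB (fbmap_adapted cP mart HH au) (fbmap_adapted cP mart HH av).
have e : u - v = tau *: (S u - S v) + r.
  have zmodE (U : zmodType) (x y a b : U) : x - y = a - b + ((x - a) - (y - b)).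
    by rewrite [RHS]addrC opprB [RHS]addrAC !addrA !subrK.
  by rewrite /r scalerBr; exact: zmodE.
have [l1 l2] := aS k kN; have [lr1 lr2] := ar k kN.
have s12 := nsq_sqnorm P r kN kN.
have r1 : nsq P (r.1 k) <= sqnorm r by apply: le_trans s12; rewrite lerDl nsq_ge0.
have r2 : nsq P (r.2 k) <= sqnorm r by apply: le_trans s12; rewrite lerDr nsq_ge0.
split.
  have -> : (u - v).1 k = (fun o => tau *: (S u - S v).1 k o + r.1 k o) by rewrite e.
  have := nsqD_le (L2vZ tau l1) lr1; rewrite (nsqZ _ l1) => h.
  exact: (le_affine h r1).
have -> : (u - v).2 k = (fun o => tau *: (S u - S v).2 k o + r.2 k o) by rewrite e.
have := nsqD_le (L2vZ tau l2) lr2; rewrite (nsqZ _ l2) => h.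
exact: (le_affine h r2).
Qed.

(** The energy inequality bounds the mean gaps by the residual and a small
    multiple of the increment itself. The gaps start the recursion that bounds
    one component, which in turn bounds the other, and the small multiple is
    absorbed. *)
Lemma stability tau : forward_gap P N c K1 K2 \/ backward_gap P N c K1 K2 ->
  0 <= tau <= 1 ->
  sqnorm (u - v) <= stab_cst N L K1 K2 * sqnorm ((u - tau *: S u) - (v - tau *: S v)).
Proof.
move=> gaps tau01; have /andP[tau0 tau1] := tau01.
set r := _ - (v - tau *: S v).
have K2_ge0 : 0 <= K2 := ltW K2_gt0.
have L2_ge0 : 0 <= L ^+ 2 := sqr_ge0 L.
have a0 := pass_cst_ge0 K1_ge0 K2_ge0 L2_ge0.
apply: (absorb_le (two_pass_cst_ge0 N a0) (sqnorm_ge0 P N r)); last first.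
  by move=> e e0; exact: energy_le.
have leX k kN := proj1 (@increment_le tau k kN).
have leY k kN := proj2 (@increment_le tau k kN).
have dS0 : (S u - S v).1 0%N = hL by [].
have lip := nsq_lip_coef; have lipL := nsq_lip_Lambda; have lipP := nsq_lip_Phi.
have piE : tau * ip P hP ((u - v).1 N) - tau * ip P hL ((u - v).2 0%N)
    - tau * \sum_(k < N) mean_gap k =
  tau * ip P hP ((u - v).1 N) + - (tau * ip P hL ((u - v).2 0%N))
    + \sum_(k < N) - (tau * mean_gap k).
  by rewrite sumrN mulr_sumr.
have hS k : (k < N)%N -> tau ^+ 2 * nsq P ((S u - S v).1 k.+1) <=
    tau ^+ 2 * (2 * nsq P (hb k) + 2 * nsq P (hs k)).
  by move=> kN; rewrite ler_wpM2l ?sqr_ge0//; exact: nsq_dS_succ.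
have nbs0 k : 0 <= 2 * nsq P (hb k) + 2 * nsq P (hs k).
  by rewrite addr_ge0// mulr_ge0// nsq_ge0.
case: gaps => [/mean_forward_gap|/mean_backward_gap] [gL gP gk].
  apply: (forward_backward_le (pi := fun k => - (tau * mean_gap k)) K1_ge0 K2_ge0 L2_ge0 (sqnorm_ge0 P N r) _ _ _ piE
    (fun k => nsq_ge0 P _) (fun k => nsq_ge0 P _) leX leY).
  - rewrite oppr_ge0 mulr_ge0_le0//; have := le_trans (nsq_ge0 P _) gL.
    by rewrite mulNr oppr_ge0 pmulr_rle0.
  - exact: mulr_ge0.
  - by move=> k kN; rewrite oppr_ge0 mulr_ge0_le0//; case: (gk k kN).
  - rewrite dS0; apply: (le_trans (scale_le tau01 (nsq_ge0 P _) gL)).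
    by rewrite mulNr !mulrN mulrCA.
  - move=> k kN; have [_ g2] := gk k kN; apply: (le_trans (hS k kN)).
    have g3 : 2 * nsq P (hb k) + 2 * nsq P (hs k) <=
      (2 * K1) * nsq P ((u - v).1 k) - (2 * K2) * mean_gap k.
      by rewrite -mulrDr -!mulrA -mulrBr ler_pM2l.
    apply: (le_trans (scale_le tau01 (nbs0 k) g3)).
    rewrite ![2 * (_ * _)]mulrA; apply: (scale_gap _ _ tau01 _ (nsq_ge0 P ((u - v).1 k))).
    exact: mulr_ge0.
  - by rewrite dS_yN; exact: (scale_le1 tau01 (nsq_ge0 P _) lipP).
  - move=> k kN; rewrite dS_y// nsqN; apply: (scale_le1 tau01 (nsq_ge0 P _)).
    by have [_ _ h] := lip k kN.
apply: (backward_forward_le (pi := fun k => - (tau * mean_gap k)) K1_ge0 K2_ge0 L2_ge0 (sqnorm_ge0 P N r) _ _ _ piE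
    (fun k => nsq_ge0 P _) (fun k => nsq_ge0 P _) leX leY).
- by rewrite oppr_ge0 mulr_ge0_le0.
- rewrite mulr_ge0//; have := le_trans (nsq_ge0 P _) gP.
  by rewrite pmulr_rge0.
- by move=> k kN; rewrite oppr_ge0 mulr_ge0_le0//; case: (gk k kN).
- rewrite dS_yN; apply: (le_trans (scale_le tau01 (nsq_ge0 P _) gP)).
  by rewrite mulrCA.
- move=> k kN; have [_ g2] := gk k kN; rewrite dS_y// nsqN.
  have g3 : nsq P (hf k) <= (2 * K1) * nsq P ((u - v).2 k.+1) - K2 * mean_gap k.
    apply: (le_trans g2); rewrite lerD2r [2 * K1]mulrC -mulrA ler_wpM2l//.
    rewrite -[2]natr1 mulrDl !mul1r; apply: lerD.
      exact: (nsq_th_y mart au av kN).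
    exact: (nsq_th_z mart au av kN).
  apply: (le_trans (scale_le tau01 (nsq_ge0 P _) g3)).
  rewrite ![2 * (_ * _)]mulrA; apply: (scale_gap _ _ tau01 _ (nsq_ge0 P ((u - v).2 k.+1))).
  exact: mulr_ge0.
- by rewrite dS0; exact: (scale_le1 tau01 (nsq_ge0 P _) lipL).
- move=> k kN; apply: (le_trans (hS k kN)); apply: (scale_le1 tau01 (nbs0 k)).
  have [h1 h2 _] := lip k kN.
  exact: (le_double_sum h1 h2).
Qed.

End gaps.

End pair.

End Stability.

(** * Existence, uniqueness and continuous dependence *)

Section Estimates.
Context {R : realType} {d : measure_display} {Omega : measurableType d}.
Variables (P : probability Omega R) (N n : nat) (w : nat -> Omega -> R).
Hypothesis cP : measure_is_complete P.
Hypothesis mart : martingale_difference P N w.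

Local Notation process := (@process R d Omega n).
Local Notation adapted := (adapted P N w).
Local Notation sqnorm := (sqnorm P N).
Local Notation th := (th P w).
Local Notation S := (fbmap P N w).

Definition ae_equal (u v : process) := forall k, (k <= N)%N ->
  {ae P, forall o, u.1 k o = v.1 k o} /\ {ae P, forall o, u.2 k o = v.2 k o}.

Lemma ae_equalB (u v u' v' : process) : ae_equal u u' -> ae_equal v v' ->
  ae_equal (u - v) (u' - v').
Proof.
move=> uu vv k kN; have [a1 a2] := uu k kN; have [b1 b2] := vv k kN.
split; [apply: filterS2 a1 b1 => o e1 e2|apply: filterS2 a2 b2 => o e1 e2].
- by have -> : (u - v).1 k o = u.1 k o - v.1 k o by []; rewrite e1 e2.
- by have -> : (u - v).2 k o = u.2 k o - v.2 k o by []; rewrite e1 e2.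
Qed.

Lemma ae_equal_refl (u : process) : ae_equal u u.
Proof. by move=> k kN; split; exact: aeW. Qed.

Lemma ae_equalP (u v : process) : adapted u -> adapted v ->
  sqnorm (u - v) <= 0 -> ae_equal u v.
Proof.
move=> au av s0 k kN; have [h1 h2] := sqnorm_eq0 (adaptedB au av) s0 kN.
split; [apply: filterS h1 => o e|apply: filterS h2 => o e].
- by apply/eqP; rewrite -subr_eq0; apply/eqP; exact: e.
- by apply/eqP; rewrite -subr_eq0; apply/eqP; exact: e.
Qed.

Lemma sqnorm0 : sqnorm (0 : process) = 0.
Proof.
by rewrite -(scale0r (0 : process)) (sqnormZ _ (@adapted0 _ _ _ P N n w)) expr0n mul0r.
Qed.

Section data.
Variables (L L' : R) (c c' : coeffs R Omega n).
Hypothesis HH : H1 P N w L c.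
Hypothesis HH' : H1 P N w L' c'.
Variables (v : process) (av : adapted v).

Let db k o := cb c k o (th v k o) - cb c' k o (th v k o).
Let ds k o := cs c k o (th v k o) - cs c' k o (th v k o).
Let df k o := cf c k.+1 o (th v k o) - cf c' k.+1 o (th v k o).
Let dL o := cLambda c (v.2 0%N o) - cLambda c' (v.2 0%N o).
Let dP o := cPhi c o (v.1 N o) - cPhi c' o (v.1 N o).

Let lbsf k : (k < N)%N -> [/\ L2v P (filt w k) (db k),
  L2v P (filt w k) (ds k) & L2v P (filt w k) (df k)].
Proof.
move=> kN; have [? ? ?] := coef_L2v cP mart HH av kN.
by have [? ? ?] := coef_L2v cP mart HH' av kN; split; exact: L2vB.
Qed.

Let lL : L2v P (filt w 0) dL.
Proof.
by apply: L2vB; [exact: (cLambda_L2v cP mart HH)|exact: (cLambda_L2v cP mart HH')].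
Qed.

Let lP : L2v P (filt w N) dP.
Proof.
by apply: L2vB; [exact: (cPhi_L2v cP mart HH)|exact: (cPhi_L2v cP mart HH')].
Qed.

Lemma L1_data : let f := data_Ihat P N w c c' v.1 v.2 in
  L1 P f /\ Ex P f = nsq P dP + \sum_(k < N) nsq P (db k) +
    \sum_(k < N) nsq P (ds k) + \sum_(k < N) nsq P (df k) + nsq P dL.
Proof.
move=> f.
have [l1 e1] := @L1_enorm_sqr _ _ _ P n _ _ lP.
have [l2 e2] := @L1_sum_enorm_sqr _ _ _ P n N db (fun k kN =>
  let: And3 h _ _ := lbsf kN in ex_intro (fun G => L2v P G (db k)) _ h).
have [l3 e3] := @L1_sum_enorm_sqr _ _ _ P n N ds (fun k kN =>
  let: And3 _ h _ := lbsf kN in ex_intro (fun G => L2v P G (ds k)) _ h).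
have [l4 e4] := @L1_sum_enorm_sqr _ _ _ P n N df (fun k kN =>
  let: And3 _ _ h := lbsf kN in ex_intro (fun G => L2v P G (df k)) _ h).
have [l5 e5] := @L1_enorm_sqr _ _ _ P n _ _ lL.
have l12 := L1D l1 l2; have l123 := L1D l12 l3; have l1234 := L1D l123 l4.
split; first exact: (L1D l1234 l5).
by rewrite -e1 -e2 -e3 -e4 -e5 -(ExD l1 l2) -(ExD l12 l3) -(ExD l123 l4) -(ExD l1234 l5).
Qed.

(** Multiplication by the noise does not increase the mean square of the
    sigma-difference; the factor 2 comes from splitting the forward difference into its two terms. *)
Lemma sqnorm_data_le : sqnorm (S c v - S c' v) <= 2 * Ex P (data_Ihat P N w c c' v.1 v.2).
Proof.
have [_ ->] := L1_data.
have x0 : (S c v - S c' v).1 0%N = dL by [].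
have xS k : (k < N)%N ->
    nsq P ((S c v - S c' v).1 k.+1) <= 2 * nsq P (db k) + 2 * nsq P (ds k).
  move=> kN; have [lb ls _] := lbsf kN; have [lws nws] := noise_L2v mart kN ls.
  have -> : (S c v - S c' v).1 k.+1 = (fun o => db k o + w k o *: ds k o).
    by apply/funext => o; rewrite /db /ds scalerBr addrACA -opprD.
  by apply: (le_trans (nsqD_le lb lws)); rewrite lerD2l ler_pM2l.
have yk k : (k < N)%N -> nsq P ((S c v - S c' v).2 k) = nsq P (df k).
  move=> kN; rewrite -[RHS]nsqN; congr nsq; apply/funext => o; rewrite /df.
  have -> : (S c v - S c' v).2 k o = (S c v).2 k o - (S c' v).2 k o by [].
  by rewrite /fbmap /= (ltn_eqF kN) opprB opprK addrC.
have yN : (S c v - S c' v).2 N = dP.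
  apply/funext => o.
  have -> : (S c v - S c' v).2 N o = (S c v).2 N o - (S c' v).2 N o by [].
  by rewrite /fbmap /= eqxx.
have sX : \sum_(k < N) nsq P ((S c v - S c' v).1 k.+1) <=
    2 * \sum_(k < N) nsq P (db k) + 2 * \sum_(k < N) nsq P (ds k).
  by rewrite !mulr_sumr -big_split; apply: ler_sum => -[k kN] _; exact: xS.
have sY : \sum_(k < N) nsq P ((S c v - S c' v).2 k) = \sum_(k < N) nsq P (df k).
  by apply: eq_bigr => -[k kN] _; exact: yk.
have -> : sqnorm (S c v - S c' v) =
    nsq P dL + \sum_(k < N) nsq P ((S c v - S c' v).1 k.+1) +
    (\sum_(k < N) nsq P ((S c v - S c' v).2 k) + nsq P dP).
  rewrite /sqnorm big_ord_recl big_ord_recr; congr (_ + _ + (_ + _)).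
  by rewrite -yN.
rewrite sY.
have h (a b e f g x : R) : 0 <= a -> 0 <= f -> 0 <= g -> x <= 2 * b + 2 * e ->
  a + x + (f + g) <= 2 * (g + b + e + f + a) by lra.
apply: (h _ _ _ _ _ _ (nsq_ge0 P _) _ (nsq_ge0 P _) sX).
by apply: sumr_ge0 => k _; exact: nsq_ge0.
Qed.

End data.

Section solution.
Variables (L K1 K2 : R) (c : coeffs R Omega n).
Hypothesis HH : H1 P N w L c.
Hypotheses (K1_ge0 : 0 <= K1) (K2_gt0 : 0 < K2).
Hypothesis gaps : forward_gap P N c K1 K2 \/ backward_gap P N c K1 K2.

Lemma fixpoint_exists : exists2 u, adapted u & ae_equal u (S c u).
Proof.
have [u au s0] : exists2 u, adapted u & sqnorm (u - S c u) <= 0.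
  apply: (@continuation_fixpoint R (process : lmodType R) adapted (fun u : process => sqnorm u) (S c)
    (2 * N.+1%:R * (8 * L ^+ 2)) (stab_cst N L K1 K2) _ _ _ _ _ _ _ _ _ _ _ 0 _).
  - by move=> u v; exact: adaptedD.
  - by move=> a u; exact: adaptedZ.
  - by move=> u; exact: (fbmap_adapted cP mart HH).
  - by move=> u _; exact: sqnorm_ge0.
  - by move=> u v; exact: sqnormD.
  - by move=> a u; exact: sqnormZ.
  - by move=> F C; exact: (adapted_complete mart).
  - by move=> u v; exact: (fbmap_lip cP mart HH).
  - by move=> tau u v tau01 au av; exact: (stability cP mart HH au av K1_ge0 K2_gt0 gaps tau01).
  - by rewrite mulr_ge0// mulr_ge0// sqr_ge0.
  - exact: (stab_cst_ge0 N L K1_ge0 (ltW K2_gt0)).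
  - exact: adapted0.
by exists u => //; apply: ae_equalP => //; exact: (fbmap_adapted cP mart HH).
Qed.

(** The a priori estimate at tau = 1, where the residual of u vanishes. *)
Lemma fixpoint_stability u v : adapted u -> adapted v -> ae_equal u (S c u) ->
  sqnorm (u - v) <= stab_cst N L K1 K2 * sqnorm (S c v - v).
Proof.
move=> au av fu; have aSu := fbmap_adapted cP mart HH au.
have aSv := fbmap_adapted cP mart HH av.
have tau01 : 0 <= (1 : R) <= 1 by rewrite ler01 lexx.
apply: (le_trans (stability cP mart HH au av K1_ge0 K2_gt0 gaps tau01)).
apply: ler_wpM2l; first exact: (stab_cst_ge0 N L K1_ge0 (ltW K2_gt0)).
rewrite !scale1r le_eqVlt; apply/orP; left; apply/eqP.
have zmodE (U : zmodType) (a b e : U) : b - a = e - e - (a - b).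
  by rewrite subrr sub0r opprB.
rewrite (zmodE _ v (S c v) (S c u)).
apply: (sqnorm_ae (w := w)).
- by apply: adaptedB; exact: adaptedB.
- by apply: adaptedB; exact: adaptedB.
- apply: ae_equalB; last exact: ae_equal_refl.
  by apply: ae_equalB; [exact: fu|exact: ae_equal_refl].
Qed.

Lemma fixpoint_unique u v : adapted u -> adapted v -> ae_equal u (S c u) ->
  ae_equal v (S c v) -> ae_equal u v.
Proof.
move=> au av fu fv; apply: ae_equalP => //.
have aSv := fbmap_adapted cP mart HH av.
apply: (le_trans (fixpoint_stability au av fu)).
have -> : sqnorm (S c v - v) = sqnorm (S c v - S c v).
  apply: (sqnorm_ae (w := w)); [exact: adaptedB|exact: adaptedB|].
  by apply: ae_equalB; [exact: ae_equal_refl|exact: fv].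
by rewrite subrr sqnorm0 mulr0.
Qed.

(** The residual of v for the coefficients c is the difference of the two
    right-hand sides at v. The added 1 makes the constant positive. *)
Lemma fixpoint_estimate L' c' u v : H1 P N w L' c' -> adapted u -> adapted v ->
  ae_equal u (S c u) -> ae_equal v (S c' v) ->
  sqnorm (u - v) <= (2 * stab_cst N L K1 K2 + 1) * Ex P (data_Ihat P N w c c' v.1 v.2).
Proof.
move=> HH' au av fu fv.
have aSv := fbmap_adapted cP mart HH av; have aSv' := fbmap_adapted cP mart HH' av.
have K0 := stab_cst_ge0 N L K1_ge0 (ltW K2_gt0).
apply: (le_trans (fixpoint_stability au av fu)).
have -> : sqnorm (S c v - v) = sqnorm (S c v - S c' v).
  apply: (sqnorm_ae (w := w)); [exact: adaptedB|exact: adaptedB|].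
  by apply: ae_equalB; [exact: ae_equal_refl|exact: fv].
have le := sqnorm_data_le HH HH' av.
apply: (le_trans (ler_wpM2l K0 le)).
rewrite mulrA [_ * 2]mulrC ler_wpM2r//; last by rewrite lerDl.
by have := le_trans (sqnorm_ge0 P N _) le; rewrite pmulr_rge0.
Qed.

Lemma solution_exists : exists x y, is_solution P N w c x y.
Proof.
have [u au fu] := fixpoint_exists.
have [[x y] [av mv uv]] := adapted_version mart au.
exists x, y; apply/(is_solutionP mart); split; [exact: av|exact: mv|].
move=> k kN; have [u1 u2] := uv k kN; have [f1 f2] := fu k kN.
have [s1 s2] := fbmap_ae mart c au av uv kN.
split; [apply: filterS3 u1 f1 s1 => o e1 e2 e3|apply: filterS3 u2 f2 s2 => o e1 e2 e3].
- exact: (etrans (esym e1) (etrans e2 e3)).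
- exact: (etrans (esym e1) (etrans e2 e3)).
Qed.

Lemma solution_unique x y x' y' : is_solution P N w c x y -> is_solution P N w c x' y' ->
  forall k, (k <= N)%N -> {ae P, forall o, x' k o = x k o /\ y' k o = y k o}.
Proof.
move=> /(is_solutionP mart)[a _ f] /(is_solutionP mart)[a' _ f'] k kN.
have [h1 h2] := fixpoint_unique a' a f' f kN.
by apply: filterS2 h1 h2 => o e1 e2; split; [exact: e1|exact: e2].
Qed.

Lemma solution_estimate L' c' x y x' y' : H1 P N w L' c' ->
  is_solution P N w c x y -> is_solution P N w c' x' y' ->
  ('E_P[fun o => (\sum_(k < N.+1) enorm (x k o - x' k o) ^+ 2 +
                  \sum_(k < N.+1) enorm (y k o - y' k o) ^+ 2)%R]
   <= (2 * stab_cst N L K1 K2 + 1)%:E * 'E_P[data_Ihat P N w c c' x' y'])%E.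
Proof.
move=> HH' /(is_solutionP mart)[a _ f] /(is_solutionP mart)[a' _ f'].
have [lI _] := L1_data HH HH' a'.
rewrite (expectationE lI) -EFinM.
have le := fixpoint_estimate HH' a a' f f'.
by rewrite (expectation_sqnorm (adaptedB a a')) lee_fin.
Qed.

Lemma solution_bound x y : is_solution P N w c x y ->
  ('E_P[fun o => (\sum_(k < N.+1) enorm (x k o) ^+ 2 +
                  \sum_(k < N.+1) enorm (y k o) ^+ 2)%R]
   <= (2 * stab_cst N L K1 K2 + 1)%:E * 'E_P[data_I N c])%E.
Proof.
move=> /(is_solutionP mart)[a _ f].
have a0 := @adapted0 _ _ _ P N n w.
have HH0 := @H1_zero _ _ _ P N n w mart.
have [lI _] := L1_data HH HH0 a0.
have f0 : ae_equal 0 (S (@zero_coeffs R d Omega n) 0).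
  move=> k kN; split; apply: aeW => o.
    by case: k {kN} => [|k] //=; rewrite scaler0 addr0.
  by rewrite /fbmap /=; case: eqP => // _; rewrite oppr0.
have le := fixpoint_estimate HH0 a a0 f f0.
have Iae : {ae P, forall o, data_Ihat P N w c (@zero_coeffs R d Omega n) (0 : process).1
    (0 : process).2 o = data_I N c o}.
  have : {ae P, forall o, forall k : 'I_N, th (0 : process) k o = 0}.
    by apply: filter_forall => k; apply: filterS (@th0 R d Omega P N n w mart k (ltn_ord k)) => o.
  apply: filterS => o t0; rewrite /data_Ihat /data_I /=.
  congr (_ + _ + _ + _ + _); rewrite ?subr0//.
  - by apply: eq_bigr => k _; rewrite subr0; have := t0 k; rewrite /th => ->.
  - by apply: eq_bigr => k _; rewrite subr0; have := t0 k; rewrite /th => ->.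
  - by apply: eq_bigr => k _; rewrite subr0; have := t0 k; rewrite /th => ->.
have [lI0 eI] := L1_ae_complete cP Iae lI.
rewrite (expectationE lI0) -EFinM -eI.
by move: le; rewrite subr0 => le; rewrite (expectation_sqnorm a) lee_fin.
Qed.

End solution.

End Estimates.

Theorem theorem3p1 (R : realType) (N : nat) (hN : (0 < N)%N)
    (L mu v cM cG cA cB cC : R) :
  exists K : R, 0 < K /\
  forall (n m mbar mtil : nat) (d : measure_display) (Omega : measurableType d)
    (P : probability Omega R) (w : nat -> Omega -> R)
    (M : 'M[R]_(mbar, n)) (G : Omega -> 'M[R]_(mtil, n))
    (A B C : nat -> Omega -> 'M[R]_(m, n)) (c : coeffs R Omega n),
  measure_is_complete P ->
  martingale_difference P N w ->
  H1 P N w L c ->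
  H2 P N w mu v cM cG cA cB cC M G A B C c ->
  (exists x y : nat -> Omega -> 'cV[R]_n,
     is_solution P N w c x y /\
     forall x1 y1 : nat -> Omega -> 'cV[R]_n, is_solution P N w c x1 y1 ->
       forall k, (k <= N)%N ->
         {ae P, forall omega, x1 k omega = x k omega /\ y1 k omega = y k omega})
  /\
  (forall x y : nat -> Omega -> 'cV[R]_n, is_solution P N w c x y ->
     ('E_P[fun omega => (\sum_(k < N.+1) enorm (x k omega) ^+ 2
                         + \sum_(k < N.+1) enorm (y k omega) ^+ 2)%R]
      <= K%:E * 'E_P[data_I N c])%E
     /\
     forall (c' : coeffs R Omega n) (x' y' : nat -> Omega -> 'cV[R]_n),
       satisfies_H1_H2 P N w c' ->
       is_solution P N w c' x' y' ->
       ('E_P[fun omega =>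
          (\sum_(k < N.+1) enorm (x k omega - x' k omega) ^+ 2
           + \sum_(k < N.+1) enorm (y k omega - y' k omega) ^+ 2)%R]
        <= K%:E * 'E_P[data_Ihat P N w c c' x' y'])%E).
Proof.
pose K1 : R := 4 * L ^+ 2.
pose K2 : R := 4 * (`|mu^-1| ^+ 3 + `|v^-1| ^+ 3) + 1.
have K1_ge0 : 0 <= K1 by rewrite mulr_ge0// sqr_ge0.
have K2_gt0 : 0 < K2 by rewrite ltr_wpDl// mulr_ge0// addr_ge0// exprn_ge0.
have K_ge0 := stab_cst_ge0 N L K1_ge0 (ltW K2_gt0).
exists (2 * stab_cst N L K1 K2 + 1); split; first by rewrite ltr_wpDl// mulr_ge0.
move=> n m mbar mtil d Omega P w M G A B C c cP mart HH1 HH2.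
have gaps : forward_gap P N c K1 K2 \/ backward_gap P N c K1 K2.
  by apply: (gap_of_H1_H2 HH1 HH2); [exact: lexx|rewrite lerDl].
split.
  have [x [y sxy]] := solution_exists cP mart HH1 K1_ge0 K2_gt0 gaps.
  exists x, y; split => // x1 y1 sxy1 k kN.
  exact: (solution_unique cP mart HH1 K1_ge0 K2_gt0 gaps sxy sxy1 kN).
move=> x y sxy; split.
  exact: (solution_bound cP mart HH1 K1_ge0 K2_gt0 gaps sxy).
move=> c' x' y' [[L' HH1'] _] sxy'.
exact: (solution_estimate cP mart HH1 K1_ge0 K2_gt0 gaps HH1' sxy sxy').
Qed.
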